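(* Let $\mathcal{F}(\lambda_1,\dots,\lambda_k)$ be the set of isomorphism classes of frescos with fundamental invariants $\lambda_1,\dots,\lambda_k$. Define the rational numbers $p_j:=\lambda_{j+1}-\lambda_j+1$ for $j\in[1,k-1]$. For $1\le i<j\le k-2$ define the function $\pi_{i,j}:\mathcal{F}(\lambda_1,\dots,\lambda_k)\to\mathbb{C}$ by $$\pi_{i,j}(E)=(p_j-1)(p_{j+1}-1)(p_j+p_{j+1}-1).\gamma_i(E)-(p_i-1)(p_{i+1}-1)(p_i+p_{i+1}-1).\gamma_j(E),$$ where $\gamma_h(E):=\gamma(F_{h+2}/F_{h-1})$ for $h\in[1,k-2]$, with $F_h$ the $h$-th term in the principal J-H. sequence of $E$. Then $\pi_{i,j}$ is a holomorphic parameter which is quasi-invariant of weight $1$ by changes of variable.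
   Context: **Frescos.** $\hat A$ is the $\mathbb{C}$-algebra of series $\sum_{\nu\ge 0}P_\nu(a)b^\nu$, $P_\nu\in\mathbb{C}[[a]]$, with $ab-ba=b^2$ and with left and right multiplication by any $T\in\mathbb{C}[[a]]$ continuous for the $b$-adic filtration; $\tilde{\mathcal A}\subset\hat A$ is the subalgebra where all $P_\nu\in\mathbb{C}[a]$. An (a,b)-module is a left $\tilde{\mathcal A}$-module free of finite rank over $\mathbb{C}[[b]]$. It has a simple pole if $aE\subset bE$, and is regular if contained in a simple pole (a,b)-module; a regular (a,b)-module is canonically a left $\hat A$-module. For $E$ regular, $E^\sharp\subset E[b^{-1}]$ is the smallest simple pole (a,b)-module containing $E$, and the Bernstein polynomial of $E$ is the minimal polynomial of $-b^{-1}a$ on $E^\sharp/bE^\sharp$. $E$ is geometric if it is regular and all roots of its Bernstein polynomial are negative rationals. A fresco is a geometric (a,b)-module generated by one element over $\tilde{\mathcal A}$ (equivalently over $\hat A$). A submodule $F\subset E$ is normal if $E/F$ is free over $\mathbb{C}[[b]]$. For $[\Lambda]\subset\mathbb{Q}/\mathbb{Z}$, $E$ is $[\Lambda]$-primitive if the opposite of every root of its Bernstein polynomial has class in $[\Lambda]$; $E[\Lambda]$ is the maximal $[\Lambda]$-primitive submodule of $E$ (it is normal). $E_\lambda:=\hat A/\hat A(a-\lambda b)$. **Principal J-H. sequence.** A J-H. (Jordan-Hölder) sequence of a rank $k$ fresco is a sequence of normal submodules $0=F_0\subset F_1\subset\dots\subset F_k=E$ with $F_j/F_{j-1}\simeq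 E_{\lambda_j}$ of rank 1. A $[\lambda]$-primitive fresco ($[\lambda]$ a single class) has a unique J-H. sequence with $\lambda_1+1\le\lambda_2+2\le\dots\le\lambda_k+k$, called principal. A total order on $\mathbb{Q}/\mathbb{Z}$ is fixed. For a general fresco, let $[\mu_1]<\dots<[\mu_H]$ be the classes of the opposites of the roots of its Bernstein polynomial, and $G_h:=E[\{[\mu_1],\dots,[\mu_h]\}]$. The principal J-H. sequence is the unique J-H. sequence compatible with $(G_h)$ and inducing on each $[\mu_h]$-primitive fresco $G_h/G_{h-1}$ its principal J-H. sequence. The corresponding ordered numbers $(\lambda_1,\dots,\lambda_k)$ are the fundamental invariants of $E$. **The number $\gamma$.** For a rank 3 fresco $E$ with fundamental invariants $\lambda_1,\lambda_2,\lambda_3$, put $p_1=\lambda_2-\lambda_1+1$, $p_2=\lambda_3-\lambda_2+1$. If $E\simeq\tilde{\mathcal A}/\tilde{\mathcal A}(a-\lambda_1b)S_1^{-1}(a-\lambda_2b)S_2^{-1}(a-\lambda_3b)$ with $S_1,S_2\in\mathbb{C}[[b]]$, $S_1(0)=S_2(0)=1$, then $\gamma(E):=(p_2-1)S_1'(0)-(p_1-1)S_2'(0)$; this depends only on the isomorphism class of $E$. **Change of variable.** A change of variable is $\theta\in\mathbb{C}[[a]]$ with $\theta(0)=0$, $\chi(\theta):=\theta'(0)\ne0$. There is a unique continuous algebra automorphism $\Theta$ of $\hat A$ with $\Theta(a)=\theta(a)$, $\Theta(b)=b\,\theta'(a)$. For a left $\hat A$-module $E$, $\theta_*(E)$ is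 the vector space $E$ with $u\in\hat A$ acting as $\Theta(u)$ acts on $E$. It sends frescos to frescos with the same fundamental invariants. **Holomorphic parameters.** For $j\in[1,k]$ let $l_j\ge 0$ be the maximal integer such that $\lambda_j,\dots,\lambda_{j+l_j}$ are equal modulo $\mathbb{Z}$, and let $Y(\lambda_j,\dots,\lambda_k)\subset\mathbb{C}[[b]]$ be the span of $b^h$, $0\le h\le k-j-1$, and of all $b^q$ with $q\ge k-j$ of the form $q=p_j+\dots+p_{j+l}$, $l\in[0,l_j-1]$. Let $\mathcal{G}(\lambda_1,\dots,\lambda_k)$ be the affine space of $(S_1,\dots,S_{k-1})$ with $S_j\in Y(\lambda_j,\dots,\lambda_k)$, $S_j(0)=1$, and $I:\mathcal{G}(\lambda_1,\dots,\lambda_k)\to\mathcal{F}(\lambda_1,\dots,\lambda_k)$ the surjective map sending $(S_1,\dots,S_{k-1})$ to the class of $\tilde{\mathcal A}/\tilde{\mathcal A}(a-\lambda_1b)S_1^{-1}\cdots S_{k-1}^{-1}(a-\lambda_kb)$. A function $f:\mathcal{F}_0\to\mathbb{C}$ on a subset $\mathcal{F}_0\subset\mathcal{F}(\lambda_1,\dots,\lambda_k)$ is a holomorphic parameter if there are a locally closed analytic subset $\mathcal{G}_0\subset\mathcal{G}(\lambda_1,\dots,\lambda_k)$ containing $I^{-1}(\mathcal{F}_0)$ and a holomorphic $F:\mathcal{G}_0\to\mathbb{C}$ with $f(I(s))=F(s)$ for all $s\in\mathcal{G}_0$ with $I(s)\in\mathcal{F}_0$. If $\mathcal{F}_0$ is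 invariant by changes of variable, a holomorphic parameter $f$ on $\mathcal{F}_0$ is quasi-invariant of weight $w\in\mathbb{N}$ if $f(\theta_*(E))=\chi(\theta)^{w}f(E)$ for every change of variable $\theta$ and every $E\in\mathcal{F}_0$.
   Formalization: With θ_* as defined, the stated rule f(θ_*(E)) = χ(θ)^w f(E) fails for π_{i,j} (θ = 2a, λ = (10,11,12,13), S_1 = 1+b, S_2 = S_3 = 1: π goes from 3 to 3/2, not 6); the formal theorem proves f(E) = χ(θ)^w f(θ_*(E)) with w = 1. *)

(* Defs.v *)
From HB Require Import structures.
From mathcomp Require Import all_boot all_order all_algebra.
From mathcomp Require Import boolp classical_sets functions reals.
From mathcomp Require Import topology normedtype derive.
From mathcomp Require Import complex ring.

Set Implicit Arguments.
Unset Strict Implicit.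
Unset Printing Implicit Defensive.

Import Order.TTheory GRing.Theory Num.Theory.
Import numFieldNormedType.Exports.
Local Open Scope classical_set_scope.
Local Open Scope ring_scope.

(* The field C is kept abstract here; the theorem takes C = R[i], R a realType. *)

(* x : Ahat C stands for the series \sum_n P_n(a) b^n, where x m n is the
   coefficient of a^m in P_n: it is the (infinite) combination of the a^m b^n. *)
Definition Ahat (C : numFieldType) : Type := nat -> nat -> C.

Section AhatRing.
Variable C : numFieldType.
Implicit Types x y z : Ahat C.

HB.instance Definition _ := GRing.Zmodule.copy (Ahat C) (nat -> nat -> C).

(* Left multiplication by b. From ab - ba = b^2 one gets b P = P b - b P' b for P in
   C[[a]]; hence b x = x b - (d/da)(b x) b for all x, which is the recursion below. *)
Fixpoint lmulb x (m n : nat) : C :=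
  if n is n'.+1 then x m n' - m.+1%:R * lmulb x m.+1 n' else 0.

Definition Ahat_one : Ahat C := fun m n => ((m == 0) && (n == 0))%N%:R.

Definition lmula x : Ahat C := fun m n => if m is m'.+1 then x m' n else 0.

(* x y = \sum_(s, v) x_(s, v) a^s b^v y; the coefficient of a^m b^n in a^s b^v y
   vanishes for s > m or v > n. *)
Definition Ahat_mul x y : Ahat C := fun m n =>
  \sum_(s < m.+1) \sum_(v < n.+1)
    x s v * iter s lmula (iter v lmulb y) m n.

Local Notation B := lmulb.
Local Notation Aop := lmula.
Let D x : Ahat C := fun m n => m.+1%:R * x m.+1 n.

Lemma AhatP x y : (forall m n, x m n = y m n) -> x = y.
Proof. by move=> xy; apply/funext => m; apply/funext => n. Qed.

Lemma AhatDE x y m n : (x + y) m n = x m n + y m n. Proof. by []. Qed.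
Lemma AhatNE x m n : (- x) m n = - x m n. Proof. by []. Qed.
Lemma Ahat0E m n : (0 : Ahat C) m n = 0. Proof. by []. Qed.

Lemma Ahat_sumE (I : Type) (r : seq I) (P : pred I) (F : I -> Ahat C) m n :
  (\sum_(i <- r | P i) F i) m n = \sum_(i <- r | P i) F i m n.
Proof.
elim: r => [|i r IH]; first by rewrite !big_nil.
by rewrite !big_cons; case: ifP => // _; rewrite AhatDE IH.
Qed.

Let scl (c : C) x : Ahat C := fun m n => c * x m n.

Lemma lmulbD x y : B (x + y) = B x + B y.
Proof.
apply: AhatP => m n; elim: n m => [|n IH] m /=; first by rewrite AhatDE /= addr0.
by rewrite /= !AhatDE /= IH AhatDE mulrDr opprD addrACA.
Qed.

Lemma lmulbZ c x : B (scl c x) = scl c (B x).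
Proof.
apply: AhatP => m n; elim: n m => [|n IH] m; rewrite /scl /= ?mulr0 //.
by have := IH m.+1; rewrite /scl => ->; rewrite mulrBr mulrCA.
Qed.

Lemma lmulb0 : B 0 = 0.
Proof. by apply: AhatP => m n; elim: n m => [|n IH] m //=; rewrite IH mulr0 subr0. Qed.

Lemma iterB_lt v x m n : (n < v)%N -> iter v B x m n = 0.
Proof.
elim: v m n => [//|v IH] m [|n]; first by [].
rewrite ltnS => nv; rewrite iterS.
have H m' n' : (n' <= n)%N -> B (iter v B x) m' n'.+1 = 0.
  elim: n' m' => [|n' IHn] m' le_n' /=; rewrite IH ?(leq_ltn_trans le_n') // ?mulr0 ?subr0 //.
  by have /= -> := IHn m'.+1 (ltnW le_n'); rewrite mulr0 subr0.
exact: H.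
Qed.

Lemma iterA_lt s x m n : (m < s)%N -> iter s Aop x m n = 0.
Proof. by elim: s m => [//|s IH] [|m] //; rewrite ltnS => /IH /= ->. Qed.

Lemma iterA s x m n : (s <= m)%N -> iter s Aop x m n = x (m - s)%N n.
Proof.
elim: s m => [|s IH] m; first by rewrite subn0.
by case: m => // m; rewrite ltnS => /IH /= ->; rewrite subSS.
Qed.

Lemma Ahat_mulE x y m n : Ahat_mul x y m n =
  \sum_(s < m.+1) \sum_(v < n.+1) x s v * iter v B y (m - s)%N n.
Proof.
by apply: eq_bigr => s _; apply: eq_bigr => v _; rewrite iterA // -ltnS.
Qed.

Lemma mulE S V x y m n : (m < S)%N -> (n < V)%N ->
  Ahat_mul x y m n =
  \sum_(s < S) \sum_(v < V) x s v * iter s Aop (iter v B y) m n.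
Proof.
move=> mS nV; rewrite !Ahat_mulE.
rewrite (big_ord_widen_cond S (fun _ => true)
  (fun s => \sum_(v < n.+1) x s v * iter v B y (m - s)%N n)) //.
rewrite big_mkcond; apply: eq_bigr => s _; rewrite ltnS; case: leqP => /= [sm|ms]; last first.
  by rewrite big1 // => v _; rewrite iterA_lt // mulr0.
rewrite (big_ord_widen_cond V (fun _ => true)
  (fun v => x s v * iter v B y (m - s)%N n)) //.
rewrite big_mkcond; apply: eq_bigr => v _; rewrite ltnS iterA //.
by case: leqP => //= nv; rewrite iterB_lt // mulr0.
Qed.

Lemma iterAD s x y : iter s Aop (x + y) = iter s Aop x + iter s Aop y.
Proof.
elim: s => //= s ->; apply: AhatP => -[|m] n //=; by rewrite AhatDE /= addr0.
Qed.

Lemma iterBD s x y : iter s B (x + y) = iter s B x + iter s B y.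
Proof. by elim: s => //= s ->; rewrite lmulbD. Qed.

Lemma Ahat_mulDl : left_distributive Ahat_mul +%R.
Proof.
move=> x y z; apply: AhatP => m n; rewrite AhatDE !Ahat_mulE -big_split /=.
apply: eq_bigr => s _; rewrite -big_split /=; apply: eq_bigr => v _.
by rewrite AhatDE mulrDl.
Qed.

Lemma Ahat_mulDr : right_distributive Ahat_mul +%R.
Proof.
move=> x y z; apply: AhatP => m n; rewrite AhatDE !Ahat_mulE -big_split /=.
apply: eq_bigr => s _; rewrite -big_split /=; apply: eq_bigr => v _.
by rewrite iterBD AhatDE mulrDr.
Qed.

Lemma Ahat_mul0l x : Ahat_mul 0 x = 0.
Proof. by apply: (addrI (Ahat_mul 0 x)); rewrite -Ahat_mulDl !addr0. Qed.

Lemma Ahat_mul1l : left_id Ahat_one Ahat_mul.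
Proof.
move=> x; apply: AhatP => m n; rewrite !Ahat_mulE big_ord_recl big_ord_recl /=.
rewrite /Ahat_one mul1r subn0 big1 ?addr0 => [|v _]; last by rewrite mul0r.
by rewrite big1 ?addr0 // => s _; rewrite big1 // => v _; rewrite mul0r.
Qed.

Let mono m0 n0 : Ahat C := fun m n => ((m == m0) && (n == n0))%N%:R.

Lemma lmulb_monomial v : B (fun m n => ((m == 0%N) && (n == v))%:R) =
  fun m n => ((m == 0%N) && (n == v.+1))%:R.
Proof.
apply: AhatP => m n; elim: n m => [|n IH] m /=; first by rewrite andbF.
by rewrite IH /= mulr0 subr0 eqSS.
Qed.

Let iterB_one v : iter v B Ahat_one = mono 0%N v.
Proof. by elim: v => [//|v IH]; rewrite iterS IH /mono lmulb_monomial. Qed.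

Lemma Ahat_mul1r : right_id Ahat_one Ahat_mul.
Proof.
move=> x; apply: AhatP => m n; rewrite !Ahat_mulE.
rewrite big_ord_recr big_ord_recr /= big1 ?add0r => [|s _]; last first.
  rewrite big1 // => v _; rewrite iterB_one /mono subn_eq0 leqNgt ltn_ord /=.
  by rewrite mulr0.
rewrite big1 ?add0r => [|v _]; last first.
  by rewrite iterB_one /mono (gtn_eqF (ltn_ord v)) andbF mulr0.
by rewrite iterB_one /mono subnn !eqxx mulr1.
Qed.

Lemma lmulb_lmula x : B (Aop x) = Aop (B x) - B (B x).
Proof.
apply: AhatP => m n; rewrite AhatDE AhatNE.
elim: n m => [|n IH] m /=; first by case: m => [|m] /=; rewrite subr0.
by rewrite IH; case: m => [|m] /=; ring.
Qed.

Let BD x : B (D x) = D (B x).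
Proof.
apply: AhatP => m n; elim: n m => [|n IH] m /=; first by rewrite /D /= mulr0.
by rewrite IH /D /=; ring.
Qed.


Let sclE c x m n : scl c x m n = c * x m n. Proof. by []. Qed.

Let BN x : B (- x) = - B x.
Proof. by apply: (addrI (B x)); rewrite -lmulbD !subrr lmulb0. Qed.

(* b a^(s+1) = a^(s+1) b - (s+1) b a^s b *)
Let BAs s x : B (iter s.+1 Aop x) =
  iter s.+1 Aop (B x) - scl s.+1%:R (B (iter s Aop (B x))).
Proof.
elim: s x => [|s IH] x.
  by rewrite lmulb_lmula; apply: AhatP => m n; rewrite !AhatDE !AhatNE /scl mul1r.
rewrite [iter s.+2 Aop x]iterS lmulb_lmula IH.
set u := iter s Aop (B x); rewrite !iterS -/u lmulbD BN lmulbZ lmulb_lmula.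
apply: AhatP => m n; rewrite !(AhatDE, AhatNE, sclE).
by case: m => [|m] /=; rewrite ?(AhatDE, AhatNE, sclE) /= -?natr1; ring.
Qed.

Let B_sum (I : Type) (r : seq I) (F : I -> Ahat C) :
  B (\sum_(i <- r) F i) = \sum_(i <- r) B (F i).
Proof. by elim: r => [|i r IH]; rewrite ?big_nil ?lmulb0 // !big_cons lmulbD IH. Qed.

Let B_loc S V x x' :
  (forall m n, (m < S)%N -> (n < V)%N -> x m n = x' m n) ->
  forall m n, (m + n < S)%N -> (n <= V)%N -> B x m n = B x' m n.
Proof.
move=> xx' m n; elim: n m => [//|n IH] m mS nV /=.
by rewrite xx' ?IH ?(leq_ltn_trans _ mS) ?addSnnS ?leq_addr // ltnW.
Qed.

Let fin S V y z : Ahat C :=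
  \sum_(s < S) \sum_(v < V) scl (y s v) (iter s Aop (iter v B z)).

Let finE S V y z m n : (m < S)%N -> (n < V)%N -> Ahat_mul y z m n = fin S V y z m n.
Proof.
move=> mS nV; rewrite (mulE _ _ mS nV) /fin Ahat_sumE; apply: eq_bigr => s _.
by rewrite Ahat_sumE.
Qed.

Let B_mul1 y z : B (Ahat_mul y z) = Ahat_mul y (B z) - B (Ahat_mul (D y) (B z)).
Proof.
apply: AhatP => m n; rewrite AhatDE AhatNE.
pose S := (m + n).+1; pose V := n.+1.
have mS : (m < S)%N by rewrite ltnS leq_addr.
rewrite (@B_loc S.+1 V _ (fin S.+1 V y z)); first last.
- exact: leqnSn.
- by rewrite ltnW.
- by move=> *; exact: finE.
rewrite (@B_loc S V (Ahat_mul (D y) (B z)) (fin S V (D y) (B z))); first last.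
- exact: leqnSn.
- by [].
- by move=> *; exact: finE.
rewrite (@finE S.+1 V) ?(leqW mS) //.
suff -> : B (fin S.+1 V y z) = fin S.+1 V y (B z) - B (fin S V (D y) (B z)) by [].
rewrite /fin B_sum big_ord_recl [X in _ = X - _]big_ord_recl -!addrA; congr (_ + _).
  rewrite B_sum; apply: eq_bigr => v _; rewrite lmulbZ /=.
  by rewrite -iterSr.
rewrite B_sum -sumrN -big_split; apply: eq_bigr => s _ /=.
rewrite !B_sum -sumrN -big_split; apply: eq_bigr => v _ /=.
rewrite !lmulbZ -!iterS BAs -!iterSr; apply: AhatP => a b.
rewrite /bump /= add1n ?(AhatDE, AhatNE, sclE) /D.
by ring.
Qed.

Let mul_B1 y z : Ahat_mul (B y) z = Ahat_mul y (B z) - Ahat_mul (B (D y)) (B z).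
Proof.
apply: AhatP => m n; rewrite AhatDE AhatNE.
rewrite (@mulE m.+1 n.+2) ?(@mulE m.+1 n.+1) // -sumrB; apply: eq_bigr => s _.
rewrite big_ord_recl [X in X + _]mul0r add0r -sumrB; apply: eq_bigr => v _.
by rewrite lift0 BD /D /= -iterS iterSr; ring.
Qed.

Let mul_iterB_lt k y z m n : (n < k)%N -> Ahat_mul y (iter k B z) m n = 0.
Proof.
move=> nk; rewrite !Ahat_mulE big1 // => s _; rewrite big1 // => v _.
by rewrite -iterD iterB_lt ?mulr0 // (leq_trans nk) // leq_addl.
Qed.


Let B_lt k x m n : (forall m n, (n < k)%N -> x m n = 0) -> (n < k)%N -> B x m n = 0.
Proof.
move=> x0; elim: n m => [//|n IH] m nk /=.
by rewrite x0 ?IH ?mulr0 ?subr0 // ltnW.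
Qed.

Let B_mul y z : B (Ahat_mul y z) = Ahat_mul (B y) z.
Proof.
apply: AhatP => m n.
suff H k : (k <= n.+1)%N -> forall y z,
    B (Ahat_mul y (iter (n.+1 - k)%N B z)) m n = Ahat_mul (B y) (iter (n.+1 - k)%N B z) m n.
  by have := H n.+1 (leqnn _) y z; rewrite subnn.
elim: k => [_ {}y {}z|k IH kn {}y {}z].
  rewrite subn0 mul_iterB_lt // (@B_lt n.+1) // => a b bn.
  exact: mul_iterB_lt.
have E : B (iter (n.+1 - k.+1)%N B z) = iter (n.+1 - k)%N B z by rewrite -iterS subnSK.
rewrite B_mul1 mul_B1 !AhatDE !AhatNE E; congr (_ - _).
by rewrite IH // ltnW.
Qed.

Let A_mul y z : Aop (Ahat_mul y z) = Ahat_mul (Aop y) z.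
Proof.
apply: AhatP => -[|m] n /=.
  rewrite !Ahat_mulE big1 // => s _; rewrite big1 // => v _.
  by case: s => -[|//] ? /=; rewrite mul0r.
rewrite !Ahat_mulE [RHS]big_ord_recl /= [X in X + _]big1 ?add0r => [|v _]; last by rewrite mul0r.
by apply: eq_bigr => s _; apply: eq_bigr => v _; rewrite /bump add1n subSS.
Qed.

Lemma Ahat_mulA : associative Ahat_mul.
Proof.
move=> x y z; apply: AhatP => m n.
rewrite (@mulE m.+1 n.+1) // [RHS](@mulE m.+1 n.+1) //.
transitivity (\sum_(s < m.+1) \sum_(v < n.+1) \sum_(s' < m.+1) \sum_(v' < n.+1)
    x s v * (iter s Aop (iter v B y) s' v' * iter s' Aop (iter v' B z) m n)).
  apply: eq_bigr => s _; apply: eq_bigr => v _.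
  have -> : iter s Aop (iter v B (Ahat_mul y z)) =
            Ahat_mul (iter s Aop (iter v B y)) z.
    elim: (s : nat) => [|i /= ->]; last by rewrite A_mul.
    by elim: (v : nat) => [//|i /= ->]; rewrite B_mul.
  rewrite (@mulE m.+1 n.+1) // mulr_sumr; apply: eq_bigr => s' _.
  by rewrite mulr_sumr.
transitivity (\sum_(s < m.+1) \sum_(s' < m.+1) \sum_(v < n.+1) \sum_(v' < n.+1)
    x s v * (iter s Aop (iter v B y) s' v' * iter s' Aop (iter v' B z) m n)).
  by apply: eq_bigr => s _; rewrite exchange_big.
rewrite exchange_big; apply: eq_bigr => s' _ /=.
transitivity (\sum_(s < m.+1) \sum_(v' < n.+1) \sum_(v < n.+1)
    x s v * (iter s Aop (iter v B y) s' v' * iter s' Aop (iter v' B z) m n)).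
  by apply: eq_bigr => s _; rewrite exchange_big.
rewrite exchange_big; apply: eq_bigr => v' _ /=.
rewrite (@mulE m.+1 n.+1 x y s' v') // mulr_suml; apply: eq_bigr => s _.
by rewrite mulr_suml; apply: eq_bigr => v _; rewrite mulrA.
Qed.

Lemma Ahat_1neq0 : Ahat_one != 0.
Proof. by apply/eqP => /(congr1 (fun x => x 0 0)%N)/eqP; rewrite oner_eq0. Qed.

HB.instance Definition _ := GRing.Zmodule_isNzRing.Build (Ahat C)
  Ahat_mulA Ahat_mul1l Ahat_mul1r Ahat_mulDl Ahat_mulDr Ahat_1neq0.

End AhatRing.

(* Elements of C[[a]] and C[[b]] are sequences of coefficients. *)
Notation fps C := (nat -> C).

Section Generators.
Variable C : numFieldType.
Implicit Types (P S : fps C) (x y : Ahat C).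

Definition ser_a P : Ahat C := fun m n => if n == 0%N then P m else 0.
Definition ser_b S : Ahat C := fun m n => if m == 0%N then S n else 0.
Definition hat_cst (c : C) : Ahat C := ser_b (fun n => if n == 0%N then c else 0).
Definition hat_a : Ahat C := ser_a (fun m => (m == 1%N)%:R).
Definition hat_b : Ahat C := ser_b (fun n => (n == 1%N)%:R).

Lemma hat_bE x : hat_b * x = lmulb x.
Proof.
apply: AhatP => m n; rewrite /GRing.mul /= Ahat_mulE big_ord_recl subn0.
rewrite [X in _ + X]big1 ?addr0 => [|s _]; last first.
  by rewrite big1 // => v _; rewrite /hat_b /ser_b /= mul0r.
case: n => [|n]; first by rewrite big_ord1 /hat_b /ser_b /= mul0r.
rewrite 2!big_ord_recl big1 ?addr0 => [|v _].
  by rewrite /hat_b /ser_b /= mul0r add0r mul1r.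
by rewrite /hat_b /ser_b /= mul0r.
Qed.

Lemma hat_aE x : hat_a * x = lmula x.
Proof.
apply: AhatP => m n; rewrite /GRing.mul /= Ahat_mulE exchange_big /= big_ord_recl.
rewrite [X in _ + X]big1 ?addr0 => [|v _]; last first.
  by rewrite big1 // => s _; rewrite /hat_a /ser_a /= mul0r.
case: m => [|m]; first by rewrite big_ord1 /hat_a /ser_a /= mul0r.
rewrite 2!big_ord_recl big1 ?addr0 => [|v _].
  by rewrite /hat_a /ser_a /= mul0r add0r mul1r /= subSS subn0.
by rewrite /hat_a /ser_a /= mul0r.
Qed.

Lemma hat_ab : hat_a * hat_b - hat_b * hat_a = hat_b * hat_b.
Proof.
have ea : hat_a = lmula 1 by rewrite -hat_aE mulr1.
have eb : hat_b = lmulb 1 by rewrite -hat_bE mulr1.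
by rewrite !(hat_aE, hat_bE) ea eb lmulb_lmula opprB addrC subrK.
Qed.

Lemma hat_monomial i j m n :
  (hat_a ^+ i * hat_b ^+ j) m n = ((m == i) && (n == j))%:R.
Proof.
have -> : hat_b ^+ j = fun m n => ((m == 0%N) && (n == j))%:R.
  elim: j => [//|j IH]; rewrite exprS hat_bE IH; exact: lmulb_monomial.
elim: i m => [|i IH] m; first by rewrite mul1r.
by rewrite exprS -mulrA hat_aE; case: m => [|m] //=; rewrite IH.
Qed.

End Generators.

Section Atilde.
Variable C : numFieldType.

Definition in_Atilde : pred (Ahat C) :=
  fun x => `[< forall n, exists d, forall m, (d <= m)%N -> x m n = 0 >].

Let bounded (x : Ahat C) (n d : nat) :=
  forall m n', (n' < n)%N -> (d <= m)%N -> x m n' = 0.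

Let in_AtildeP (x : Ahat C) : x \in in_Atilde <-> forall n, exists d, bounded x n d.
Proof.
split=> [/asboolP H n|H]; last first.
  apply/asboolP => n; have [d Hd] := H n.+1; exists d => m dm; exact: Hd.
elim: n => [|n [d IH]]; first by exists 0%N.
have [e He] := H n; exists (maxn d e) => m n'; rewrite ltnS leq_eqVlt geq_max.
by move=> /orP[/eqP ->|n'n] /andP[dm em]; [exact: He|exact: IH].
Qed.

Let bounded_iterb x n d v : bounded x n d -> bounded (iter v (@lmulb C) x) n d.
Proof.
move=> Hx; elim: v => [//|v IH] /= m n'.
elim: n' m => [//|n' IHn] m n'n dm /=.
by rewrite IH ?IHn ?mulr0 ?subr0 // ltnW.
Qed.

Lemma Atilde_subring : subring_closed in_Atilde.
Proof.
split.
- apply/asboolP => n; exists 1%N => -[//|m] _.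
  by rewrite /GRing.one /= /Ahat_one.
- move=> x y /asboolP Hx /asboolP Hy; apply/asboolP => n.
  have [[d Hd] [e He]] := (Hx n, Hy n); exists (maxn d e) => m.
  by rewrite geq_max AhatDE AhatNE => /andP[dm em]; rewrite Hd ?He ?subr0.
- move=> x y /in_AtildeP Hx /in_AtildeP Hy; apply/asboolP => n.
  have [[d Hd] [e He]] := (Hx n.+1, Hy n.+1); exists (d + e)%N => m dem.
  rewrite /GRing.mul /= Ahat_mulE big1 // => s _; rewrite big1 // => v _.
  have [ds|sd] := leqP d s; first by rewrite Hd ?mul0r.
  rewrite (bounded_iterb _ He) ?mulr0 // leq_subRL; last by rewrite -ltnS.
  by rewrite (leq_trans _ dem) // leq_add2r ltnW.
Qed.

HB.instance Definition _ :=
  GRing.isSubringClosed.Build (Ahat C) in_Atilde Atilde_subring.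

Definition Atilde : Type := {x : Ahat C | in_Atilde x}.
HB.instance Definition _ := SubChoice.on Atilde.
HB.instance Definition _ := [SubChoice_isSubNzRing of Atilde by <:].

Lemma ser_b_in_Atilde (S : fps C) : in_Atilde (ser_b S).
Proof. by apply/asboolP => n; exists 1%N => -[]. Qed.

Lemma hat_a_in_Atilde : in_Atilde (hat_a C).
Proof. by apply/asboolP => n; exists 2%N => -[|[|m]] //; rewrite /hat_a /ser_a if_same. Qed.

Definition til_a : Atilde := exist in_Atilde (hat_a C) hat_a_in_Atilde.
Definition til_ser (S : fps C) : Atilde :=
  exist in_Atilde (ser_b S) (ser_b_in_Atilde S).
Definition til_b : Atilde := til_ser (fun n => (n == 1%N)%:R).
Definition til_cst (c : C) : Atilde := til_ser (fun n => if n == 0%N then c else 0).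
Definition til_val : {rmorphism Atilde -> Ahat C} :=
  GRing.RMorphism.clone _ _ (val : Atilde -> Ahat C) _.

End Atilde.

Section Modules.
Variable A : nzRingType.

Definition ring_inv (u : A) : A := xget 0 [set v | v * u = 1 /\ u * v = 1].

Definition iso (E E' : lmodType A) : Prop := exists f : {linear E -> E'}, bijective f.

Section Submodule.
Variables (E : lmodType A) (N : submodClosed E).

Definition submod : Type := {x : E | x \in N}.
HB.instance Definition _ := SubChoice.on submod.
HB.instance Definition _ := [SubChoice_isSubLmodule of submod by <:].

Definition zmod_pred : {pred E} := N.
Lemma zmod_pred_closed : zmod_closed zmod_pred.
Proof. exact: (GRing.submod_closedB (submodClosedP N)). Qed.
HB.instance Definition _ := GRing.isZmodClosed.Build E zmod_pred zmod_pred_closed.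

Local Notation quot := (Quotient.quot (GRing.ZmodClosed.clone E zmod_pred _)).

Definition quomod : Type := quot.
HB.instance Definition _ := GRing.Zmodule.on quomod.

Definition quo_class (x : E) : quomod := (\pi_quot x)%qT.

Definition quo_scale (u : A) (x : quomod) : quomod :=
  quo_class (u *: repr (x : quot)).

Lemma quo_classP x y : (quo_class x == quo_class y) = (x - y \in N).
Proof. by rewrite -Quotient.idealrBE. Qed.

Lemma quo_classK (x : quomod) : quo_class (repr (x : quot)) = x.
Proof. exact: reprK. Qed.

Lemma quo_classD x y : quo_class (x + y) = quo_class x + quo_class y.
Proof. exact: Quotient.pi_add. Qed.

Lemma quo_scaleE u x : quo_scale u (quo_class x) = quo_class (u *: x).
Proof. by apply/eqP; rewrite quo_classP -scalerBr rpredZ // -quo_classP quo_classK. Qed.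

Lemma quo_scaleA u v (x : quomod) : quo_scale u (quo_scale v x) = quo_scale (u * v) x.
Proof. by rewrite -[x]quo_classK !quo_scaleE scalerA. Qed.

Lemma quo_scale1 : left_id 1 quo_scale.
Proof. by move=> x; rewrite -[x]quo_classK !quo_scaleE scale1r. Qed.

Lemma quo_scaleDr : right_distributive quo_scale +%R.
Proof.
move=> u x y; rewrite -[x]quo_classK -[y]quo_classK -quo_classD !quo_scaleE.
by rewrite scalerDr quo_classD.
Qed.

Lemma quo_scaleDl x : {morph quo_scale^~ x : u v / u + v}.
Proof. by move=> u v; rewrite -[x]quo_classK !quo_scaleE scalerDl quo_classD. Qed.

HB.instance Definition _ := GRing.Zmodule_isLmodule.Build A quomod
  quo_scaleA quo_scale1 quo_scaleDr quo_scaleDl.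

Lemma quo_class_linear : linear quo_class.
Proof. by move=> u x y; rewrite quo_classD -quo_scaleE. Qed.

End Submodule.

Section Subquotient.
Variables (E : lmodType A) (F G N : submodClosed E).

Definition trace_pred : {pred submod F} := fun x => val x \in G.
Lemma trace_closed : submod_closed trace_pred.
Proof.
split; first by rewrite /trace_pred unfold_in /= rpred0.
by move=> u x y xG yG; rewrite /trace_pred unfold_in /= rpredD ?rpredZ.
Qed.
HB.instance Definition _ :=
  GRing.isSubmodClosed.Build A (submod F) trace_pred trace_closed.

Definition trace : submodClosed (submod F) :=
  GRing.SubmodClosed.clone A (submod F) trace_pred _.

(* F / G, meaningful when G is contained in F. *)
Definition subquo : lmodType A := quomod trace.

Definition induced_pred : {pred subquo} :=
  fun y => `[< exists x : submod F, val x \in N /\ y = quo_class trace x >].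
Lemma induced_closed : submod_closed induced_pred.
Proof.
split.
  apply/asboolP; exists 0; rewrite rpred0; split=> //.
  by apply: (addrI (quo_class trace 0)); rewrite addr0 -quo_classD addr0.
move=> u x y /asboolP[x' [x'N ->]] /asboolP[y' [y'N ->]]; apply/asboolP.
by exists (u *: x' + y'); rewrite rpredD ?rpredZ //= quo_class_linear.
Qed.
HB.instance Definition _ :=
  GRing.isSubmodClosed.Build A subquo induced_pred induced_closed.

(* N / G as a submodule of F / G, meaningful for N between G and F. *)
Definition induced : submodClosed subquo :=
  GRing.SubmodClosed.clone A subquo induced_pred _.

End Subquotient.

Section Cyclic.
Variable P : A.

Definition left_ideal_pred : {pred A^o} := fun x => `[< exists u : A, x = u * P >].
Lemma left_ideal_closed : submod_closed left_ideal_pred.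
Proof.
split; first by apply/asboolP; exists 0; rewrite mul0r.
move=> c x y /asboolP[u ->] /asboolP[v ->]; apply/asboolP; exists (c * u + v).
by rewrite mulrDl -mulrA.
Qed.
HB.instance Definition _ :=
  GRing.isSubmodClosed.Build A A^o left_ideal_pred left_ideal_closed.

Definition cyc : lmodType A :=
  quomod (GRing.SubmodClosed.clone A A^o left_ideal_pred _).

End Cyclic.
End Modules.

Definition pullback (A B : nzRingType) (phi : {rmorphism A -> B}) (M : lmodType B) :
  Type := M.

Section Pullback.
Variables (A B : nzRingType) (phi : {rmorphism A -> B}) (M : lmodType B).

HB.instance Definition _ := GRing.Zmodule.on (pullback phi M).

Definition pullback_scale (u : A) (x : pullback phi M) : pullback phi M :=
  phi u *: (x : M).

Lemma pullback_scaleA u v x :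
  pullback_scale u (pullback_scale v x) = pullback_scale (u * v) x.
Proof. by rewrite /pullback_scale scalerA rmorphM. Qed.

Lemma pullback_scale1 : left_id 1 pullback_scale.
Proof. by move=> x; rewrite /pullback_scale rmorph1 scale1r. Qed.

Lemma pullback_scaleDr : right_distributive pullback_scale +%R.
Proof. by move=> u x y; rewrite /pullback_scale scalerDr. Qed.

Lemma pullback_scaleDl x : {morph pullback_scale^~ x : u v / u + v}.
Proof. by move=> u v; rewrite /pullback_scale rmorphD scalerDl. Qed.

HB.instance Definition _ := GRing.Zmodule_isLmodule.Build A (pullback phi M)
  pullback_scaleA pullback_scale1 pullback_scaleDr pullback_scaleDl.

End Pullback.

Definition QZ : Type :=
  Quotient.quot (GRing.ZmodClosed.clone rat (@Num.int_num_subdef rat) _).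
HB.instance Definition _ := GRing.Zmodule.on QZ.

Definition qz_class (x : rat) : QZ :=
  (\pi_(Quotient.quot (GRing.ZmodClosed.clone rat (@Num.int_num_subdef rat) _)) x)%qT.

Lemma qz_classP x y : (qz_class x == qz_class y) = (x - y \is a Num.int).
Proof. by rewrite -Quotient.idealrBE. Qed.

Definition total_order (le : rel QZ) : Prop :=
  [/\ reflexive le, antisymmetric le, transitive le & total le].

Section ABModules.
Variable C : numFieldType.
Local Notation A := (Atilde C).
Local Notation a := (til_a C).
Local Notation b := (til_b C).
Implicit Types E L : lmodType A.

(* Freeness of finite rank over the subring C[[b]] of A. *)
Definition ab_module E : Prop :=
  exists (k : nat) (e : 'I_k -> E), forall x : E,
    exists! S : 'I_k -> fps C, x = \sum_i til_ser (S i) *: e i.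

Definition simple_pole E : Prop := forall x : E, exists y : E, a *: x = b *: y.

Definition regular E : Prop :=
  ab_module E /\ exists M : lmodType A,
    [/\ ab_module M, simple_pole M & exists f : {linear E -> M}, injective f].

(* This characterizes (L, iota) as E[b^-1], up to a unique isomorphism, when b acts
   injectively on E, as it does on an (a,b)-module. *)
Definition is_b_localization E L (iota : {linear E -> L}) : Prop :=
  [/\ injective iota,
      bijective (fun y : L => b *: y) &
      forall y : L, exists (n : nat) (x : E), b ^+ n *: y = iota x].

Definition simple_pole_over E L (iota : {linear E -> L}) (N : submodClosed L) : Prop :=
  [/\ ab_module (submod N), simple_pole (submod N) & forall x, iota x \in N].

Definition is_sharp E L (iota : {linear E -> L}) (N : submodClosed L) : Prop :=
  simple_pole_over iota N /\
  forall N' : submodClosed L, simple_pole_over iota N' -> {subset N <= N'}.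

(* D is the operator - b^-1 a of E[b^-1]; Q(D) maps E^sharp to b E^sharp exactly
   when Q is a multiple of the minimal polynomial of D on E^sharp / b E^sharp. *)
Definition is_bernstein E (B : {poly C}) : Prop :=
  exists (L : lmodType A) (iota : {linear E -> L}) (N : submodClosed L) (D : L -> L),
    [/\ is_b_localization iota,
        is_sharp iota N,
        forall y, b *: D y = - (a *: y),
        B \is monic &
        forall Q : {poly C},
          (forall y, y \in N -> exists2 z, z \in N &
             \sum_(i < size Q) til_cst Q`_i *: iter i D y = b *: z) <-> B %| Q].

Definition geometric E : Prop :=
  regular E /\ exists B, is_bernstein E B /\
    forall r, root B r -> exists2 q : rat, q < 0 & r = ratr q.

Definition primitive (Lam : set QZ) E : Prop :=
  regular E /\ exists B, is_bernstein E B /\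
    forall r, root B r -> exists2 q : rat, Lam (qz_class q) & - r = ratr q.

Definition is_primitive_part (Lam : set QZ) E (F : submodClosed E) : Prop :=
  primitive Lam (submod F) /\
  forall F' : submodClosed E, primitive Lam (submod F') -> {subset F' <= F}.

Definition fresco E : Prop :=
  geometric E /\ exists e : E, forall x : E, exists u : A, x = u *: e.

Definition normal E (F : submodClosed E) : Prop := ab_module (quomod F).

Definition restr (M : lmodType (Ahat C)) : lmodType A := pullback (til_val C) M.

Definition E_ (l : rat) : lmodType A :=
  restr (cyc (hat_a C - hat_cst (ratr l) * hat_b C)).

(* A finite sequence (l_1, ..., l_k) is a seq; ent s j is l_j, for 1 <= j <= k. *)
Definition ent (s : seq rat) (j : nat) : rat := nth 0 s j.-1.

(* F j matters only for j <= k = size s. *)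
Definition is_JH E (s : seq rat) (F : nat -> submodClosed E) : Prop :=
  [/\ forall x, (x \in F 0%N) = (x == 0),
      forall x, x \in F (size s),
      forall j, (j < size s)%N -> {subset F j <= F j.+1},
      forall j, (j <= size s)%N -> normal (F j) &
      forall j, (1 <= j <= size s)%N -> iso (subquo (F j) (F j.-1)) (E_ (ent s j))].

Definition is_principal_primitive_JH E (s : seq rat) (F : nat -> submodClosed E) : Prop :=
  is_JH s F /\
  forall j, (1 <= j < size s)%N -> ent s j + j%:R <= ent s j.+1 + j.+1%:R.

(* mu = ([mu_1], ..., [mu_H]), G h = G_h and F (d h) = G_h: the sequence F is
   compatible with (G_h), and (F_(d h + j) / G_h)_j is the induced sequence of
   G_(h+1) / G_h. *)
Definition is_principal_JH (le : rel QZ) E (s : seq rat) (F : nat -> submodClosed E) : Prop :=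
  is_JH s F /\
  exists (B : {poly C}) (mu : seq QZ) (G : nat -> submodClosed E) (d : nat -> nat),
    [/\ is_bernstein E B,
        sorted (fun x y => le x y && (x != y)) mu /\
        (forall c, c \in mu <-> exists2 q : rat, qz_class q = c & root B (- ratr q)),
        forall h, (h <= size mu)%N -> is_primitive_part [set c | c \in take h mu] (G h),
        forall h, (h <= size mu)%N -> (d h <= size s)%N /\ F (d h) =i G h &
        forall h, (h < size mu)%N ->
          is_principal_primitive_JH (drop (d h) (take (d h.+1) s))
            (fun j => induced (G h.+1) (G h) (F (d h + j)%N))].

Definition fundamental_invariants (le : rel QZ) E (s : seq rat) : Prop :=
  exists F, is_principal_JH le (E := E) s F.

(* A predicate on modules invariant by isomorphism stands for a set of classes. *)
Definition frescos (le : rel QZ) (s : seq rat) E : Prop :=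
  fresco E /\ fundamental_invariants le E s.

Definition p_ (s : seq rat) (j : nat) : rat := ent s j.+1 - ent s j + 1.

Definition lin (l : rat) : A := a - til_cst (ratr l) * b.

Definition gamma (le : rel QZ) E : C :=
  xget 0 [set z | exists (s : seq rat) (S1 S2 : fps C),
    [/\ size s = 3%N, fundamental_invariants le E s,
        S1 0%N = 1 /\ S2 0%N = 1,
        iso E (cyc (lin (ent s 1%N) * ring_inv (til_ser S1) * lin (ent s 2%N)
                      * ring_inv (til_ser S2) * lin (ent s 3%N))) &
        z = ratr (p_ s 2%N - 1) * S1 1%N - ratr (p_ s 1%N - 1) * S2 1%N]].

Definition gamma_ (le : rel QZ) (h : nat) E : C :=
  xget 0 [set z | exists (s : seq rat) (F : nat -> submodClosed E),
    is_principal_JH le s F /\ z = gamma le (subquo (F (h + 2)%N) (F h.-1))].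

Definition pi_ (le : rel QZ) (s : seq rat) (i j : nat) E : C :=
  ratr ((p_ s j - 1) * (p_ s j.+1 - 1) * (p_ s j + p_ s j.+1 - 1)) * gamma_ le i E
  - ratr ((p_ s i - 1) * (p_ s i.+1 - 1) * (p_ s i + p_ s i.+1 - 1)) * gamma_ le j E.

End ABModules.

Section ChangeOfVariable.
Variable C : numFieldType.

Definition is_change_of_variable (theta : fps C) : Prop :=
  theta 0%N = 0 /\ theta 1%N != 0.

(* x \in b^n Ahat *)
Definition b_adic (n : nat) (x : Ahat C) : Prop :=
  forall m v, (v < n)%N -> x m v = 0.

Definition is_induced_automorphism (theta : fps C)
    (Theta : {rmorphism Ahat C -> Ahat C}) : Prop :=
  [/\ bijective Theta,
      forall c, Theta (hat_cst c) = hat_cst c,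
      forall n, exists m, forall x, b_adic m x -> b_adic n (Theta x),
      Theta (hat_a C) = ser_a theta &
      Theta (hat_b C) = hat_b C * ser_a (fun m => m.+1%:R * theta m.+1)].

(* theta_*(M) is pullback Theta M, and theta'(0) is theta 1. An (a,b)-module E that is
   regular has exactly one structure of left Ahat-module, so that the modules restr M
   below are all of them.
     The weight counts powers of b: if theta(a) = chi a then b acts on theta_*(M) as
   chi b does on M, so S_j(b) becomes S_j(b / chi), and the coefficient of b^w in S_j
   is multiplied by chi^(-w); it is a parameter of weight w, hence the side on which
   chi^w stands. *)
Definition invariant_by_changes (F0 : lmodType (Atilde C) -> Prop) : Prop :=
  forall theta Theta (M : lmodType (Ahat C)),
    is_change_of_variable theta -> is_induced_automorphism theta Theta ->
    F0 (restr M) -> F0 (restr (pullback Theta M)).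

Definition quasi_invariant (F0 : lmodType (Atilde C) -> Prop)
    (f : lmodType (Atilde C) -> C) (w : nat) : Prop :=
  invariant_by_changes F0 /\
  forall theta Theta (M : lmodType (Ahat C)),
    is_change_of_variable theta -> is_induced_automorphism theta Theta ->
    F0 (restr M) ->
    f (restr M) = theta 1%N ^+ w * f (restr (pullback Theta M)).

End ChangeOfVariable.

Section HolomorphicParameters.
Variable C : numFieldType.

Section Analytic.
Variables m n : nat.
Implicit Types (X : set 'M[C]_(m, n)) (x : 'M[C]_(m, n)) (f : 'M[C]_(m, n) -> C^o).

Definition holomorphic_at f x : Prop := \forall y \near x, differentiable f y.

Definition locally_closed_analytic X : Prop :=
  forall x, X x -> exists (r : nat) (g : 'I_r -> 'M[C]_(m, n) -> C^o),
    (forall i, holomorphic_at (g i) x) /\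
    \forall y \near x, X y <-> forall i, g i y = 0.

Definition holomorphic_on X f : Prop :=
  forall x, X x -> exists g, holomorphic_at g x /\
    \forall y \near x, X y -> f y = g y.

End Analytic.

Definition ell (s : seq rat) (j : nat) : nat :=
  \max_(l < (size s - j).+1 |
        [forall i : 'I_l.+1, ent s (j + i) - ent s j \is a Num.int]) l.

(* b^h is one of the monomials spanning Y(l_j, ..., l_k). *)
Definition in_Y (s : seq rat) (j h : nat) : bool :=
  (h < size s - j)%N ||
  (size s - j <= h)%N &&
    [exists l : 'I_(ell s j), h%:R == \sum_(j <= i < (j + l).+1) p_ s i].

(* A strict bound on all exponents h with in_Y s j h. *)
Definition degY (s : seq rat) : nat :=
  (size s + \sum_(1 <= j < size s) `|Num.floor (p_ s j)|).+1.

(* The row of index j - 1 of g holds the coefficients of S_j.  G(l_1, ..., l_k) is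
   thus a closed affine subspace of the space of matrices, and an analytic subset of
   it, or a holomorphic function, is the same relatively to either space. *)
Definition calG (s : seq rat) : set 'M[C]_((size s).-1, degY s) :=
  [set g | forall r : 'I_(size s).-1,
    g r ord0 = 1 /\ forall h : 'I_(degY s), ~~ in_Y s r.+1 h -> g r h = 0].

Arguments calG : clear implicits.

Definition S_ (s : seq rat) (g : 'M[C]_((size s).-1, degY s)) (r : 'I_(size s).-1) :
    fps C :=
  fun h => if insub h is Some i then g r i else 0.

Definition I_ (s : seq rat) (g : 'M[C]_((size s).-1, degY s)) : lmodType (Atilde C) :=
  cyc (lin C (ent s 1%N) *
       \prod_(r < (size s).-1) (ring_inv (til_ser (S_ g r)) * lin C (ent s r.+2))).

Definition holomorphic_parameter (le : rel QZ) (s : seq rat)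
    (F0 : lmodType (Atilde C) -> Prop) (f : lmodType (Atilde C) -> C) : Prop :=
  [/\ forall E, F0 E -> frescos le s E,
      forall E E', F0 E -> iso E E' -> F0 E' /\ f E = f E' &
      exists (G0 : set 'M[C]_((size s).-1, degY s)) (F : 'M[C]_((size s).-1, degY s) -> C),
      [/\ locally_closed_analytic G0,
          G0 `<=` calG s,
          forall g, calG s g -> F0 (I_ g) -> G0 g,
          holomorphic_on G0 F &
          forall g, G0 g -> F0 (I_ g) -> f (I_ g) = F g]].

End HolomorphicParameters.

Arguments calG {C} s.

(* Main.v *)
(* A normalized word P = (a - lambda_1 b) U_1 ... (a - lambda_k b) U_k, U_j(0) = 1, presents the
   fresco At/At P = At e (U_j = S_j^-1, U_k = 1), and its J-H. sequences correspond to the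
   factorizations of P: F_j is generated by P_(>j) e, the product of the last k - j factors.
   E^sharp is spanned over C[[b]] by the b^-(k-j) P_(>j) e, so the Bernstein polynomial has the
   roots -(lambda_j + j - k); hence the principal J-H. sequence is the one whose lambda_j + j are
   sorted by class and then by value, and it is reached by exchanging adjacent factors.

   If theta_* of the fresco of P is the fresco of P', then Theta(P') W = V P, W(0) <> 0.
   Let both sides act on the generator of Ahat/Ahat(a - rho b). The lowest order terms in b show
   that the lambda_j agree, and the next ones form an identity of polynomials in rho in which
   the coefficients of P and P' multiply the independent polynomials
     A_j = prod_(i <= j) (X - r_i + 1) * prod_(i > j) (X - r_i),   r_i = lambda_i + i - k.
   With chi = theta'(0), it yields constants kappa and c such that
     chi s'_j = s_j + (p_j - 1) (kappa (lambda_j + lambda_(j+1) + j) + c),   s_j = S_j'(0),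
   and therefore
     chi gamma'_h = gamma_h - kappa (p_h - 1) (p_(h+1) - 1) (p_h + p_(h+1) - 1).
   The combination pi_(i,j) is the one that eliminates kappa. *)
From HB Require Import structures.
From mathcomp Require Import all_boot all_order all_algebra.
From mathcomp Require Import boolp classical_sets functions reals.
From mathcomp Require Import topology normedtype derive.
From mathcomp Require Import complex ring zify lra.
Require Import Defs.

Set Implicit Arguments.
Unset Strict Implicit.
Unset Printing Implicit Defensive.

Import Order.TTheory GRing.Theory Num.Theory.
Import numFieldNormedType.Exports.
Local Open Scope ring_scope.

(** * Right division by a - rho b in Ahat *)

(** The numbers gamma are defined by choice ([xget]) over all principal J-H. sequences, and these
    are described through arbitrary witnesses: maximal primitive submodules, Bernstein polynomials.
    Constructing one sorted word is therefore not enough; any sequence that meets the definition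
    must be shown to come from a sorted word. The Bernstein polynomial of an unknown submodule is
    not computed: a valuation argument locates its roots up to an integer, and a wrong order of the
    classes then contradicts maximality. Sorting also makes the A_j independent, since it excludes
    r_j = r_i - 1 for i < j. In gamma_h the constant c cancels, and kappa is left with the
    difference of lambda_j + lambda_(j+1) + j between j = h + 1 and j = h, that is lambda_(h+2) -
    lambda_h + 1 = p_h + p_(h+1) - 1: this is the origin of the third factor in pi. A change of
    variable need not preserve the subalgebra of series with polynomial coefficients, so words live
    in both algebras; division by a letter preserves the subalgebra and so links their left
    ideals. *)

Section Division.
Variable C : numFieldType.
Implicit Types (x y u v w : Ahat C) (S T : fps C) (rho : C).

Lemma mulAE x y m n : (x * y) m n =
  \sum_(s < m.+1) \sum_(v < n.+1) x s v * iter v (@lmulb C) y (m - s)%N n.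
Proof. exact: Ahat_mulE. Qed.

Lemma iter_lmulb_expr (v : nat) x : iter v (@lmulb C) x = hat_b C ^+ v * x.
Proof.
elim: v => [|v IH]; first by rewrite mul1r.
by rewrite iterS IH -hat_bE exprS mulrA.
Qed.

Lemma bexp_a (v : nat) : hat_b C ^+ v * hat_a C = hat_a C * hat_b C ^+ v - hat_b C ^+ v.+1 *+ v.
Proof.
elim: v => [|v IH]; first by rewrite mul1r mulr1 mulr0n subr0.
have ba : hat_b C * hat_a C = hat_a C * hat_b C - hat_b C * hat_b C.
  by rewrite -(hat_ab C) opprB addrC subrK.
rewrite exprS -mulrA IH mulrBr [X in X - _]mulrA ba mulrBl -!mulrA -!exprS mulrnAr -exprS.
by rewrite [in RHS]mulrS opprD addrA.
Qed.

Lemma bexpE (v m n : nat) : (hat_b C ^+ v) m n = ((m == 0) && (n == v))%N%:R.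
Proof. by have := hat_monomial C 0 v m n; rewrite mul1r. Qed.

Lemma mulA_b x m n : (x * hat_b C) m n = if n is n'.+1 then x m n' else 0.
Proof.
rewrite mulAE big_ord_recr /= subnn [X in X + _]big1 ?add0r => [|s _]; last first.
  apply: big1 => v _; rewrite iter_lmulb_expr -exprSr bexpE subn_eq0 leqNgt.
  by rewrite ltn_ord mulr0.
case: n => [|n]; first by rewrite big_ord1 /= /hat_b /ser_b mulr0.
rewrite 2!big_ord_recr !iter_lmulb_expr -!exprSr big1 ?add0r => [|v _]; last first.
  by rewrite iter_lmulb_expr -exprSr bexpE eqSS (gtn_eqF (ltn_ord v)) mulr0.
by rewrite !bexpE !eqxx eqSS ltn_eqF //= mulr1 mulr0 addr0 add0r.
Qed.

Lemma mulA_ser x T m n : (x * ser_b T) m n = \sum_(v < n.+1) x m v * T (n - v)%N.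
Proof.
have it (v s k : nat) : iter v (@lmulb C) (ser_b T) s k =
    if (s == 0%N) && (v <= k)%N then T (k - v)%N else 0.
  elim: v s k => [|v IH] s k; first by rewrite leq0n andbT subn0.
  rewrite iterS; elim: k s => [|k IHk] s /=; first by rewrite andbF.
  by rewrite IH /= IHk /= mulr0 subr0 subSS.
rewrite mulAE big_ord_recr /= subnn [X in X + _]big1 ?add0r => [|s _]; last first.
  by apply: big1 => v _; rewrite it subn_eq0 leqNgt ltn_ord mulr0.
by apply: eq_bigr => v _; rewrite it -ltnS ltn_ord.
Qed.

(** By [bexp_a], a^s b^v a = a^(s+1) b^v - v a^s b^(v+1); the two terms collect these two
    contributions. *)
Lemma mulA_a x m n : (x * hat_a C) m n =
  (if m is m'.+1 then x m' n else 0) - (if n is n'.+1 then n'%:R * x m n' else 0).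
Proof.
have it (v s k : nat) : iter v (@lmulb C) (hat_a C) s k =
    ((s == 1%N) && (k == v))%:R - ((s == 0%N) && (k == v.+1))%:R *+ v.
  rewrite iter_lmulb_expr bexp_a AhatDE AhatNE.
  have -> (z : Ahat C) (d i j : nat) : (z *+ d) i j = z i j *+ d.
    by elim: d => [|d IH]; rewrite ?mulr0n // !mulrS AhatDE IH.
  by rewrite bexpE -[X in X * _]expr1 hat_monomial.
rewrite mulAE.
transitivity (\sum_(s < m.+1) ((m == s.+1)%:R * x s n)
   - \sum_(v < n.+1) (n == v.+1)%:R * (v%:R * x m v)); last first.
  congr (_ - _).
    case: m => [|m]; first by rewrite big_ord1 mul0r.
    rewrite 2!big_ord_recr /= eqxx mul1r eqSS ltn_eqF // mul0r addr0 big1 ?add0r //.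
    by move=> s _; rewrite eqSS (gtn_eqF (ltn_ord s)) mul0r.
  case: n => [|n]; first by rewrite big_ord1 mul0r.
  rewrite 2!big_ord_recr /= eqxx mul1r eqSS ltn_eqF // mul0r addr0 big1 ?add0r //.
  by move=> s _; rewrite eqSS (gtn_eqF (ltn_ord s)) mul0r.
under eq_bigr => s _ do under eq_bigr => v _ do rewrite it mulrBr.
under eq_bigr => s _ do rewrite sumrB.
rewrite sumrB; congr (_ - _).
  apply: eq_bigr => s _; rewrite big_ord_recr /= eqxx andbT big1 ?add0r; last first.
    by move=> v _; rewrite (gtn_eqF (ltn_ord v)) andbF mulr0.
  rewrite mulrC; congr ((nat_of_bool _)%:R * _); have sm : (s <= m)%N by rewrite -ltnS.
  by apply/idP/idP => /eqP E; apply/eqP; lia.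
rewrite big_ord_recr /= subnn big1 ?add0r; last first.
  move=> s _; apply: big1 => v _.
  by rewrite subn_eq0 leqNgt ltn_ord mul0rn mulr0.
by apply: eq_bigr => v _; rewrite mulrnAr -mulr_natl /=; ring.
Qed.

Definition hlin rho : Ahat C := hat_a C - hat_cst rho * hat_b C.

Lemma ser_bE T n : ser_b T 0%N n = T n. Proof. by []. Qed.

Lemma ser_b_inj : injective (@ser_b C).
Proof. by move=> S T /(congr1 (fun f => f 0%N)) ST; exact: ST. Qed.

Definition cmul S T : fps C := fun n => \sum_(v < n.+1) S v * T (n - v)%N.

Lemma ser_bM S T : ser_b S * ser_b T = ser_b (cmul S T).
Proof.
apply: AhatP => m n; rewrite mulA_ser /ser_b; case: eqP => // _.
by rewrite big1 // => v _; rewrite mul0r.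
Qed.

Lemma ser_bD S T : ser_b S + ser_b T = ser_b (S + T).
Proof. by apply: AhatP => m n; rewrite AhatDE /ser_b; case: eqP => //; rewrite addr0. Qed.

Lemma ser_bN S : - ser_b S = ser_b (- S).
Proof. by apply: AhatP => m n; rewrite AhatNE /ser_b; case: eqP => //; rewrite oppr0. Qed.

Lemma ser_b0 : ser_b (0 : fps C) = 0.
Proof. by apply: AhatP => m n; rewrite /ser_b if_same. Qed.

Lemma hat_cst_mul c x m n : (hat_cst c * x) m n = c * x m n.
Proof.
rewrite mulAE big_ord_recl big_ord_recl /= subn0 /hat_cst /ser_b /=.
rewrite big1 ?addr0 => [|v _]; last by rewrite mul0r.
by rewrite big1 ?addr0 // => s _; rewrite big1 // => v _; rewrite mul0r.
Qed.

Lemma mul_hat_cst c x : x * hat_cst c = hat_cst c * x.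
Proof.
apply: AhatP => m n; rewrite hat_cst_mul mulA_ser big_ord_recr /= subnn big1 ?add0r; first exact: mulrC.
by move=> v _; rewrite subn_eq0 leqNgt ltn_ord mulr0.
Qed.

Lemma mulA_hlin x rho m n : (x * hlin rho) m n =
  (if m is m'.+1 then x m' n else 0) -
  (if n is n'.+1 then (n'%:R + rho) * x m n' else 0).
Proof.
rewrite /hlin mulrBr mulrA mul_hat_cst -mulrA AhatDE AhatNE mulA_a hat_cst_mul mulA_b.
by case: n => [|n]; rewrite ?mulr0 ?subr0 // mulrDl opprD addrA.
Qed.

Definition rising rho (i : nat) : C := \prod_(t < i) (rho + t%:R).

(** Let eps be the generator of Ahat/Ahat(a - rho b). From a b^j eps = (rho + j) b^(j+1) eps one
    gets a^i b^j eps = (rho + j) ... (rho + j + i - 1) b^(i+j) eps. So [rem rho u] is the series by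
    which u acts on eps, and [quo] is the closed form of the recursion imposed by u = q (a - rho b)
    + T. *)
Definition rem rho u : fps C := fun n => \sum_(i < n.+1) u i (n - i)%N * rising (rho + (n - i)%:R) i.
Definition quo rho u : Ahat C := fun m n =>
  \sum_(i < n.+1) u (m + i).+1 (n - i)%N * rising (rho + (n - i)%:R) i.

Lemma rising0 rho : rising rho 0 = 1. Proof. by rewrite /rising big_ord0. Qed.

Lemma rising_rec rho (n i : nat) : (i < n.+1)%N ->
  rising (rho + (n - i)%:R) i.+1 = rising (rho + (n - i)%:R) i * (n%:R + rho).
Proof.
rewrite ltnS => le_in; rewrite /rising big_ord_recr /=; congr (_ * _).
by rewrite natrB // -addrA subrK addrC.
Qed.

Lemma quoS rho u m n : quo rho u m n.+1 = u m.+1 n.+1 + (n%:R + rho) * quo rho u m.+1 n.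
Proof.
rewrite /quo big_ord_recl rising0 mulr1 addn0 subn0; congr (_ + _).
rewrite mulr_sumr; apply: eq_bigr => i _; rewrite lift0 subSS addnS addSn.
by rewrite (rising_rec _ (ltn_ord i)) mulrA mulrC.
Qed.

Lemma quo0 rho u m : quo rho u m 0%N = u m.+1 0%N.
Proof. by rewrite /quo big_ord1 rising0 mulr1 addn0. Qed.

Lemma remS rho u n : rem rho u n.+1 = u 0%N n.+1 + (n%:R + rho) * quo rho u 0%N n.
Proof.
rewrite /rem /quo big_ord_recl rising0 mulr1 subn0; congr (_ + _).
rewrite mulr_sumr; apply: eq_bigr => i _; rewrite lift0 subSS add0n.
by rewrite (rising_rec _ (ltn_ord i)) mulrA mulrC.
Qed.

Lemma rem0 rho u : rem rho u 0%N = u 0%N 0%N.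
Proof. by rewrite /rem big_ord1 rising0 mulr1. Qed.

Lemma rem1 rho u : rem rho u 1%N = u 0%N 1%N + rho * u 1%N 0%N.
Proof. by rewrite remS quo0 add0r. Qed.

Lemma divE rho u : u = quo rho u * hlin rho + ser_b (rem rho u).
Proof.
apply: AhatP => m n; rewrite AhatDE mulA_hlin /ser_b; case: m n => [|m] [|n] /=.
- by rewrite subr0 add0r rem0.
- by rewrite sub0r remS addrCA addNr addr0.
- by rewrite quo0 subr0 addr0.
- by rewrite quoS addrK addr0.
Qed.

(** The coefficient of a^(m+1) b^n in the relation expresses v_(m,n) through column n - 1 of v, so v
    vanishes by induction on n. *)
Lemma div_uniq rho v T : v * hlin rho + ser_b T = 0 -> v = 0 /\ T = 0.
Proof.
move=> /(congr1 (fun f : Ahat C => f)) E.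
have v0 : v = 0.
  apply: AhatP => m n; elim: n m => [|n IH] m.
    have /(congr1 (fun f : Ahat C => f m.+1 0%N)) := E.
    by rewrite AhatDE mulA_hlin /ser_b /= subr0 addr0.
  have /(congr1 (fun f : Ahat C => f m.+1 n.+1)) := E.
  by rewrite AhatDE mulA_hlin /ser_b /= IH mulr0 subr0 addr0.
by split=> //; move: E; rewrite v0 mul0r add0r -ser_b0 => /ser_b_inj.
Qed.

Lemma hlin_lreg rho v : v * hlin rho = 0 -> v = 0.
Proof. by move=> E; have [] := @div_uniq rho v 0; rewrite // E ser_b0 addr0. Qed.

Lemma remP rho u v T : u = v * hlin rho + ser_b T -> rem rho u = T.
Proof.
move=> E; have : (v - quo rho u) * hlin rho + ser_b (T - rem rho u) = 0.
  by rewrite mulrBl -ser_bD -ser_bN addrACA -opprD -E -divE subrr.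
by move/div_uniq => [_ /subr0_eq].
Qed.

Lemma rem_eq0 rho u : rem rho u = 0 <-> exists v, u = v * hlin rho.
Proof.
split=> [E|[v ->]]; first by exists (quo rho u); rewrite {1}(divE rho u) E ser_b0 addr0.
by apply: (@remP _ _ v); rewrite ser_b0 addr0.
Qed.

Lemma rem_ser rho T : rem rho (ser_b T) = T.
Proof. by apply: (@remP _ _ 0); rewrite mul0r add0r. Qed.

Lemma remD rho u v : rem rho (u + v) = rem rho u + rem rho v.
Proof.
apply: (@remP _ _ (quo rho u + quo rho v)).
by rewrite mulrDl -ser_bD addrACA -!divE.
Qed.

Lemma remN rho u : rem rho (- u) = - rem rho u.
Proof. by apply: (@remP _ _ (- quo rho u)); rewrite mulNr -ser_bN -opprD -divE. Qed.

(** b^i eps is killed by a - (rho + i) b, so u acts on it as on the generator of the quotient with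
    parameter rho + i. *)
Lemma rem_mul_ser rho u T n :
  rem rho (u * ser_b T) n = \sum_(i < n.+1) T i * rem (rho + i%:R) u (n - i)%N.
Proof.
rewrite /rem.
pose t (i j k : nat) := u i j * T k * rising (rho + (j + k)%:R) i.
transitivity (\sum_(i < n.+1) \sum_(j < (n - i).+1) t i j (n - i - j)%N).
  apply: eq_bigr => i _; rewrite mulA_ser mulr_suml; apply: eq_bigr => j _.
  by rewrite /t; congr (_ * rising (_ + _%:R) _); have := ltn_ord j; lia.
symmetry.
transitivity (\sum_(k < n.+1) \sum_(i < n.+1 | (i + k <= n)%N) t i (n - k - i)%N k).
  apply: eq_bigr => k _; rewrite mulr_sumr.
  rewrite (big_ord_widen_cond n.+1 predT
     (fun i => T k * (u i (n - k - i)%N * rising (rho + k%:R + (n - k - i)%:R) i))).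
    apply: eq_big => [j|j /= jn]; first by rewrite /= ltnS; have := ltn_ord k; lia.
    by rewrite /t natrD [_%:R + k%:R]addrC addrA mulrA [T k * _]mulrC.
  by rewrite ltnS leq_subr.
rewrite (exchange_big_dep predT) //=; apply: eq_bigr => i _.
have le_in : (i <= n)%N by rewrite -ltnS.
rewrite [RHS](reindex_inj (@rev_ord_inj (n - i).+1)) /=.
rewrite (big_ord_widen_cond n.+1 predT
  (fun k => t i ((n - i).+1 - k.+1)%N (n - i - ((n - i).+1 - k.+1))%N)); last by rewrite ltnS leq_subr.
by apply: eq_big => [k|k /= kn]; [rewrite /= ltnS; lia|congr (t _ _ _); lia].
Qed.

(** w eps is the series [rem rho w] applied to eps, which reduces to [rem_mul_ser]. The later
    expansions of products in powers of b rest on this formula. *)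
Lemma remM rho u w n :
  rem rho (u * w) n = \sum_(i < n.+1) rem rho w i * rem (rho + i%:R) u (n - i)%N.
Proof.
rewrite -rem_mul_ser; congr (_ n); apply: (@remP _ _ (u * quo rho w + quo rho (u * ser_b (rem rho w)))).
by rewrite mulrDl -addrA -divE -mulrA -mulrDr -divE.
Qed.

End Division.

(** * Series in b: inversion, commutation with a, conjugation by b *)

Section Series.
Variable C : numFieldType.
Implicit Types (u v w : Ahat C) (S T U V : fps C) (rho : C).

(** The coefficient n depends only on those below n, so iterating F from 0 freezes it after n + 1
    steps. *)
Lemma fps_fixpoint (F : fps C -> nat -> C) :
  (forall S T n, (forall i, (i < n)%N -> S i = T i) -> F S n = F T n) ->
  exists S, forall n, S n = F S n.
Proof.
move=> Floc; pose w k := iter k F (fun=> 0).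
have stab n k : (n < k)%N -> w k n = w n.+1 n.
  elim/ltn_ind: n k => n IH [//|k] nk /=; apply: Floc => i i_n.
  by rewrite IH ?(leq_trans i_n) // [RHS]IH.
exists (fun n => w n.+1 n) => n /=; apply: Floc => i i_n; exact: stab.
Qed.

Lemma ser_b1 : ser_b (fun n => (n == 0%N)%:R) = 1 :> Ahat C.
Proof. by apply: AhatP => m n; rewrite /ser_b /GRing.one /= /Ahat_one; case: m n => [|m] []. Qed.

Lemma cmulC S T : cmul S T = cmul T S.
Proof.
apply/funext => n; rewrite /cmul (reindex_inj rev_ord_inj) /=; apply: eq_bigr => i _.
by rewrite subSS mulrC subKn // -ltnS.
Qed.

Lemma ser_bC S T : ser_b S * ser_b T = ser_b T * ser_b S.
Proof. by rewrite !ser_bM cmulC. Qed.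

Lemma ser_b_unit T : T 0%N != 0 ->
  exists U, [/\ U 0%N = (T 0%N)^-1, ser_b T * ser_b U = 1 & ser_b U * ser_b T = 1].
Proof.
move=> T0.
have [|U HU] := @fps_fixpoint (fun U n => (T 0%N)^-1 *
    ((n == 0%N)%:R - \sum_(i < n) U i * T (n - i)%N)).
  move=> S V n SV; congr (_ * (_ - _)); apply: eq_bigr => i _; by rewrite SV.
have UT : ser_b U * ser_b T = 1.
  rewrite ser_bM -ser_b1; congr ser_b; apply/funext => n.
  rewrite /cmul big_ord_recr /= subnn [U n in X in _ + X]HU mulrC mulrA divff // mul1r.
  by rewrite addrC subrK.
exists U; split=> //; last by rewrite ser_bC.
by rewrite HU big_ord0 subr0 mulr1.
Qed.

(** This is b^2 T', the commutator of a with T. *)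
Definition euler T : fps C := fun n => if n is n'.+1 then n'%:R * T n' else 0.
Definition shift T : fps C := fun n => if n is n'.+1 then T n' else 0.

Lemma hat_a_ser T : hat_a C * ser_b T = ser_b T * hat_a C + ser_b (euler T).
Proof.
apply: AhatP => m n; rewrite AhatDE hat_aE mulA_a /ser_b /euler.
case: m n => [|m] [|n] //=; rewrite ?subr0 ?addr0 ?sub0r ?addNr ?mulr0 ?subr0 //.
Qed.

Lemma hat_b_ser T : hat_b C * ser_b T = ser_b (shift T).
Proof.
rewrite /hat_b ser_bC; apply: AhatP => m n; rewrite mulA_b /ser_b /shift.
by case: m n => [|m] [].
Qed.

Lemma hat_cst_ser c T : hat_cst c * ser_b T = ser_b (fun n => c * T n).
Proof. by apply: AhatP => m n; rewrite hat_cst_mul /ser_b; case: eqP => //; rewrite mulr0. Qed.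

Lemma hat_cst1 : hat_cst 1 = 1 :> Ahat C.
Proof. by rewrite -ser_b1; congr ser_b; apply/funext => -[]. Qed.

Lemma hat_cstM c d : hat_cst c * hat_cst d = hat_cst (c * d) :> Ahat C.
Proof. by rewrite hat_cst_ser; congr ser_b; apply/funext => -[|n] //=; rewrite mulr0. Qed.

Lemma hat_cstD c d : hat_cst c + hat_cst d = hat_cst (c + d) :> Ahat C.
Proof.
rewrite ser_bD; congr ser_b; apply/funext => -[|n]; first by [].
by rewrite [LHS]addr0.
Qed.

Lemma hat_cst0 : hat_cst 0 = 0 :> Ahat C.
Proof. by rewrite -ser_b0; congr ser_b; apply/funext => -[]. Qed.

Lemma hlin_ser rho T : hlin rho * ser_b T =
  ser_b T * hlin rho + ser_b (euler T).
Proof.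
rewrite /hlin mulrBl hat_a_ser mulrBr -addrA [_ + - _ in LHS]addrC addrA; congr (_ - _ + _).
by rewrite -!mulrA [in RHS]mulrA mul_hat_cst -mulrA /hat_b ser_bC.
Qed.

Lemma hlinD rho c : hlin (rho + c) = hlin rho - hat_cst c * hat_b C.
Proof. by rewrite /hlin -hat_cstD mulrDl opprD addrA. Qed.

Lemma euler_b n : ser_b (euler (fun m => (m == n)%:R)) = hat_cst n%:R * hat_b C ^+ n.+1.
Proof.
apply: AhatP => s m; rewrite hat_cst_mul bexpE /ser_b /euler.
case: s m => [|s] [|m] //=; rewrite ?mulr0 // eqSS.
by case: eqP => [->|]; rewrite ?mulr1 ?mulr0.
Qed.

Lemma bexp_ser n : hat_b C ^+ n = ser_b (fun m => (m == n)%:R).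
Proof. by apply: AhatP => s m; rewrite bexpE /ser_b; case: s. Qed.

Lemma hlin_bexp rho n : hlin rho * hat_b C ^+ n = hat_b C ^+ n * hlin (rho - n%:R).
Proof.
rewrite hlinD mulrBr {1}bexp_ser hlin_ser euler_b -bexp_ser mulrA mul_hat_cst.
have -> : hat_cst (- n%:R) = - hat_cst n%:R :> Ahat C.
  by apply/eqP; rewrite -addr_eq0 hat_cstD addNr hat_cst0.
by rewrite !mulNr opprK -mulrA -exprSr.
Qed.

(** Conjugation u -> b u b^-1. Column 0 of b u is zero, so dropping it loses nothing. *)
Definition sigma u : Ahat C := fun m n => lmulb u m n.+1.

Lemma sigmaP u : hat_b C * u = sigma u * hat_b C.
Proof. by apply: AhatP => m n; rewrite hat_bE mulA_b; case: n. Qed.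

Lemma hat_b_rreg u v : u * hat_b C = v * hat_b C -> u = v.
Proof.
move=> E; apply: AhatP => m n.
by move: E => /(congr1 (fun f : Ahat C => f m n.+1)); rewrite !mulA_b.
Qed.

Lemma in_Atilde_coefs u : (forall n, exists d, forall m, (d <= m)%N -> u m n = 0) -> in_Atilde u.
Proof. by move=> H; apply/asboolP. Qed.

(** By [quoS], the degree in a of a column of the quotient is bounded by those of the same column of
    u and of the previous column of the quotient. The same division thus serves in both algebras. *)
Lemma in_Atilde_quo rho u : in_Atilde u -> in_Atilde (quo rho u).
Proof.
move=> /asboolP Hu; apply: in_Atilde_coefs; elim=> [|n [d IH]].
  by have [d Hd] := Hu 0%N; exists d => m dm; rewrite quo0 Hd // ltnW.
have [e He] := Hu n.+1; exists (maxn d e) => m; rewrite geq_max => /andP [dm em].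
by rewrite quoS He ?IH ?mulr0 ?addr0 // ltnW.
Qed.

Lemma in_Atilde_sigma u : in_Atilde u -> in_Atilde (sigma u).
Proof.
move=> /asboolP Hu; apply: in_Atilde_coefs; rewrite /sigma.
elim=> [|n [d IH]].
  by have [d Hd] := Hu 0%N; exists d => m dm /=; rewrite Hd // mulr0 subr0.
have [e He] := Hu n.+1; exists (maxn d e) => m; rewrite geq_max => /andP [dm em] /=.
by have /= -> := IH m.+1 (leqW dm); rewrite He // mulr0 subr0.
Qed.

End Series.

(** * Words in the linear factors *)

Section Words.
Variable C : numFieldType.
Local Notation A := (Atilde C).
Local Notation letter := (rat * fps C)%type.
Implicit Types (u v w : Ahat C) (T : fps C) (x : letter) (l : seq letter).

Fixpoint normalized l : Prop := if l is x :: l' then x.2 0%N = 1 /\ normalized l' else True.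

Lemma normalized_cat l1 l2 : normalized (l1 ++ l2) <-> normalized l1 /\ normalized l2.
Proof. by elim: l1 => [|x l1 IH] /=; [tauto|rewrite IH; tauto]. Qed.

Lemma normalized_take n l : normalized l -> normalized (take n l).
Proof. by rewrite -{1}(cat_take_drop n l) normalized_cat => -[]. Qed.

Lemma normalized_drop n l : normalized l -> normalized (drop n l).
Proof. by rewrite -{1}(cat_take_drop n l) normalized_cat => -[]. Qed.

Definition hblk x : Ahat C := hlin (ratr x.1) * ser_b x.2.
Definition hword l : Ahat C := \prod_(x <- l) hblk x.
Definition blk x : A := lin C x.1 * til_ser x.2.
Definition word l : A := \prod_(x <- l) blk x.

Lemma hword_cons x l : hword (x :: l) = hblk x * hword l.
Proof. by rewrite /hword big_cons. Qed.

Lemma hword0 : hword [::] = 1. Proof. by rewrite /hword big_nil. Qed.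
Lemma word_cons x l : word (x :: l) = blk x * word l.
Proof. by rewrite /word big_cons. Qed.
Lemma word_cat l1 l2 : word (l1 ++ l2) = word l1 * word l2.
Proof. by rewrite /word big_cat. Qed.
Lemma word0 : word [::] = 1. Proof. by rewrite /word big_nil. Qed.
Lemma word1 x : word [:: x] = blk x. Proof. by rewrite /word big_seq1. Qed.

Lemma val_word l : val (word l) = hword l.
Proof.
elim: l => [|x l IH]; first by rewrite word0 hword0.
by rewrite word_cons hword_cons -IH.
Qed.

(** Multiply u by the inverse V of the series of the letter, divide by a - lambda b, and multiply
    back. *)
Lemma hblk_div x u : x.2 0%N = 1 ->
  exists v T, u = v * hblk x + ser_b T /\ (in_Atilde u -> in_Atilde v).
Proof.
move=> x1; have [|V [_ _ Vx]] := @ser_b_unit C x.2; first by rewrite x1 oner_eq0.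
exists (quo (ratr x.1) (u * ser_b V)), (cmul (rem (ratr x.1) (u * ser_b V)) x.2); split.
  by rewrite -ser_bM /hblk mulrA -mulrDl -divE -mulrA Vx mulr1.
move=> uA; apply: in_Atilde_quo.
exact: (rpredM (uA : u \in in_Atilde (C := C)) (ser_b_in_Atilde V)).
Qed.

Lemma hblk_uniq x v T : x.2 0%N = 1 -> v * hblk x + ser_b T = 0 -> v = 0 /\ T = 0.
Proof.
move=> x1 E; have [|V [_ xV _]] := @ser_b_unit C x.2; first by rewrite x1 oner_eq0.
have : v * hlin (ratr x.1) + ser_b (cmul T V) = 0.
  by rewrite -ser_bM -[v * _]mulr1 -xV !mulrA -mulrDl -mulrA E mul0r.
move=> /div_uniq [v0 _]; split=> //.
by move: E; rewrite v0 mul0r add0r -ser_b0 => /ser_b_inj.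
Qed.

(** Divide by the tail, then divide the quotient by the first letter. Together with [hword_uniq]
    this says that the products of the proper suffixes form a basis over C[[b]] of the quotient by
    the left ideal of the word. *)
Lemma hword_div l u : normalized l ->
  exists v (T : nat -> fps C),
    u = v * hword l + \sum_(i < size l) ser_b (T i) * hword (drop i.+1 l) /\
    (in_Atilde u -> in_Atilde v).
Proof.
elim: l => [|x l IH] /= => [_|[x1 /IH [v [T [-> vA]]]]].
  by exists u, (fun=> 0); rewrite hword0 mulr1 big_ord0 addr0.
have [w [S [Ev wA]]] := @hblk_div x v x1.
exists w, (fun i => if i is j.+1 then T j else S); split; last by move=> /vA /wA.
by rewrite big_ord_recl hword_cons mulrA addrA /= drop0 -mulrDl -Ev.
Qed.

Lemma hword_uniq l v (T : nat -> fps C) : normalized l ->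
  v * hword l + \sum_(i < size l) ser_b (T i) * hword (drop i.+1 l) = 0 ->
  v = 0 /\ forall i, (i < size l)%N -> T i = 0.
Proof.
elim: l v T => [|x l IH] v T /=; first by rewrite hword0 mulr1 big_ord0 addr0.
move=> [x1 nl]; rewrite big_ord_recl hword_cons mulrA addrA /= drop0 -mulrDl => E.
have [vx Tl] := IH _ (fun i => T i.+1) nl E.
have [v0 T0] := hblk_uniq x1 vx; split=> // -[//|i]; exact: Tl.
Qed.

Lemma hword_rreg l v : normalized l -> v * hword l = 0 -> v = 0.
Proof.
move=> nl E; have [] // := @hword_uniq l v (fun=> 0) nl.
by rewrite E big1 ?addr0 // => i _; rewrite ser_b0 mul0r.
Qed.

Lemma val_til_sum (n : nat) (F : nat -> A) : val (\sum_(i < n) F i) = \sum_(i < n) val (F i).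
Proof. exact: (raddf_sum (til_val C)). Qed.

Lemma word_div l (u : A) : normalized l ->
  exists (v : A) (T : nat -> fps C),
    u = v * word l + \sum_(i < size l) til_ser (T i) * word (drop i.+1 l).
Proof.
move=> nl; have [v [T [E vA]]] := hword_div (val u) nl.
exists (exist (@in_Atilde C) v (vA (valP u))), T; apply: val_inj.
rewrite [LHS]E rmorphD rmorphM /= val_word; congr (_ + _).
rewrite (val_til_sum _ (fun i => til_ser (T i) * word (drop i.+1 l))).
by apply: eq_bigr => i _; rewrite rmorphM /= val_word.
Qed.

Lemma word_uniq l (v : A) (T : nat -> fps C) : normalized l ->
  v * word l + \sum_(i < size l) til_ser (T i) * word (drop i.+1 l) = 0 ->
  v = 0 /\ forall i, (i < size l)%N -> T i = 0.
Proof.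
move=> nl /(congr1 val); rewrite rmorphD rmorphM /= val_word => E.
have [|v0 T0] := @hword_uniq l (val v) T nl; last by split=> //; exact: val_inj.
rewrite -[RHS]E; congr (_ + _).
rewrite (val_til_sum _ (fun i => til_ser (T i) * word (drop i.+1 l))).
by apply: eq_bigr => i _; rewrite rmorphM /= val_word.
Qed.

Lemma word_rreg l (v : A) : normalized l -> v * word l = 0 -> v = 0.
Proof.
move=> nl /(congr1 val); rewrite rmorphM /= val_word => /(hword_rreg nl) E.
exact: val_inj.
Qed.

Lemma word_rregI l (u v : A) : normalized l -> u * word l = v * word l -> u = v.
Proof.
move=> nl E; apply: subr0_eq; apply: (word_rreg nl).
by rewrite mulrBl E subrr.
Qed.

End Words.

(** * Modules presented by words *)

Section GeneralModules.
Variable A : nzRingType.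
Implicit Types (E : lmodType A) (u v w : A).

Definition generates E (e : E) := forall x : E, exists u : A, x = u *: e.

Lemma quo_class0 E (N : submodClosed E) : quo_class N 0 = 0.
Proof. by have := quo_class_linear N 1 0 0; rewrite !scale1r addr0 => /eqP; rewrite -subr_eq subrr => /eqP. Qed.

Lemma quo_classZ E (N : submodClosed E) u x : u *: quo_class N x = quo_class N (u *: x).
Proof. by rewrite -[u *: x]addr0 quo_class_linear quo_class0 addr0. Qed.

Lemma quo_class_eq0 E (N : submodClosed E) x : quo_class N x = 0 <-> x \in N.
Proof.
rewrite -(quo_class0 N); split=> [/eqP|xN]; first by rewrite quo_classP subr0.
by apply/eqP; rewrite quo_classP subr0.
Qed.

Lemma quo_class_surj E (N : submodClosed E) (y : quomod N) : exists x, y = quo_class N x.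
Proof. by exists (repr (y : Quotient.quot _)); rewrite quo_classK. Qed.

Lemma generates_quo E (N : submodClosed E) e : generates e -> generates (quo_class N e).
Proof.
by move=> ge y; have [x ->] := quo_class_surj y; have [u ->] := ge x; exists u; rewrite quo_classZ.
Qed.

Lemma linear_of E E' (f : E -> E') : linear f -> exists g : {linear E -> E'}, g =1 f.
Proof.
move=> lf.
by exists (HB.pack_for {linear E -> E'} f (GRing.isLinear.Build A E E' *:%R f lf)).
Qed.

Lemma iso_ann E E' (e : E) (e' : E') : generates e -> generates e' ->
  (forall u, u *: e = 0 <-> u *: e' = 0) ->
  exists2 f : {linear E -> E'}, bijective f & f e = e'.
Proof.
move=> ge ge' ann.
have [r re] := choice ge; have [r' re'] := choice ge'.
have wd u v : u *: e = v *: e <-> u *: e' = v *: e'.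
  have := ann (u - v); rewrite !scalerBl => -[H1 H2].
  by split=> E1; apply: subr0_eq; [apply: H1|apply: H2]; rewrite E1 subrr.
have lf : linear (fun x => r x *: e').
  move=> u x y; rewrite scalerA -scalerDl; apply/wd.
  by rewrite -re scalerDl -scalerA -!re.
have [f fE] := linear_of lf; exists f.
  exists (fun y => r' y *: e) => x /=; rewrite ?fE.
    by rewrite [RHS]re; apply/wd; rewrite -re'.
  by rewrite [RHS]re'; apply/wd; rewrite -re.
by rewrite fE -[RHS]scale1r; apply/wd; rewrite -re scale1r.
Qed.

Lemma iso_generates E E' (f : {linear E -> E'}) e : bijective f -> generates e -> generates (f e).
Proof.
move=> [g _ gK] ge y; have [u Eu] := ge (g y); exists u.
by rewrite -linearZ /= -Eu gK.
Qed.

Lemma iso_sym E E' : iso E E' -> iso E' E.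
Proof.
move=> [f [g fK gK]].
have lg : linear g by move=> u x y; apply: (can_inj fK); rewrite linearP !gK.
have [h hE] := linear_of lg; exists h; exists f => x; rewrite hE ?fK ?gK //.
Qed.

Lemma val_submodZ E (F : submodClosed E) u (x : submod F) : val (u *: x) = u *: val x.
Proof. exact: linearZ. Qed.

Lemma submodN E (F : submodClosed E) x : x \in F -> - x \in F.
Proof. by move=> xF; rewrite -scaleN1r rpredZ. Qed.

Lemma submodB E (F : submodClosed E) x y : x \in F -> y \in F -> x - y \in F.
Proof. by move=> xF yF; rewrite rpredD // submodN. Qed.

Lemma val_submodP E (F : submodClosed E) u (x y : submod F) :
  val (u *: x + y) = u *: val x + val y.
Proof. exact: linearP. Qed.

Lemma val_submodD E (F : submodClosed E) (x y : submod F) : val (x + y) = val x + val y.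
Proof. exact: raddfD. Qed.

Lemma val_submodB E (F : submodClosed E) (x y : submod F) : val (x - y) = val x - val y.
Proof. exact: raddfB. Qed.

Lemma submod_inj E (F : submodClosed E) (x y : submod F) : val x = val y -> x = y.
Proof. exact: val_inj. Qed.

Lemma submod_lift E (F : submodClosed E) x : x \in F -> exists y : submod F, val y = x.
Proof. by move=> xF; exists (exist (fun z : E => z \in F) x xF). Qed.

Definition span_pred E (e : E) (w : A) : {pred E} := fun x => `[< exists u, x = (u * w) *: e >].
Lemma span_closed E (e : E) w : submod_closed (span_pred e w).
Proof.
split; first by apply/asboolP; exists 0; rewrite mul0r scale0r.
move=> c x y /asboolP [u ->] /asboolP [v ->]; apply/asboolP; exists (c * u + v).
by rewrite mulrDl scalerDl -mulrA scalerA.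
Qed.
HB.instance Definition _ E (e : E) w :=
  GRing.isSubmodClosed.Build A E (span_pred e w) (span_closed e w).
Definition span E (e : E) (w : A) : submodClosed E :=
  GRing.SubmodClosed.clone A E (span_pred e w) _.

Lemma spanP E (e : E) w x : x \in span e w <-> exists u, x = (u * w) *: e.
Proof. by split=> [/asboolP|H]; [|apply/asboolP]. Qed.

End GeneralModules.

(** * Left ideals of words, flags and J-H. sequences *)

Section Presentations.
Variable C : numFieldType.
Local Notation A := (Atilde C).
Local Notation letter := (rat * fps C)%type.
Implicit Types (E : lmodType A) (u v w : A) (T U : fps C) (x : letter) (l m : seq letter).

Definition mult w u := exists v, u = v * w.

Definition pres E (e : E) l := generates e /\ forall u, u *: e = 0 <-> mult (word l) u.

Definition flags E (e : E) l (F : nat -> submodClosed E) :=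
  forall j, (j <= size l)%N -> forall u, u *: e \in F j <-> mult (word (drop j l)) u.

Lemma iso_pres E E' (f : {linear E -> E'}) e l : bijective f -> pres e l -> pres (f e) l.
Proof.
move=> bf [ge ae]; split; first exact: iso_generates.
move=> u; rewrite -ae -linearZ /=; split=> [|->]; last exact: linear0.
by move=> E0; apply: (bij_inj bf); rewrite E0 linear0.
Qed.

Lemma pres_cyc (w : A) : exists e : cyc w, generates e /\ forall u, u *: e = 0 <-> mult w u.
Proof.
pose I : submodClosed A^o := GRing.SubmodClosed.clone A A^o (left_ideal_pred w) _.
exists (quo_class I (1 : A^o)); split.
  by move=> y; have [x ->] := quo_class_surj y; exists x; rewrite quo_classZ /= [x *: _]mulr1.
move=> u; rewrite quo_classZ [u *: _]mulr1 quo_class_eq0.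
by split=> [/asboolP|H]; last apply/asboolP.
Qed.

Lemma til_serD S T : til_ser S + til_ser T = til_ser (S + T) :> A.
Proof. by apply: val_inj; exact: ser_bD. Qed.
Lemma til_serN S : - til_ser S = til_ser (- S) :> A.
Proof. by apply: val_inj; exact: ser_bN. Qed.
Definition ser1 : fps C := fun n => (n == 0%N)%:R.
Lemma til_ser1 : til_ser ser1 = 1 :> A.
Proof. by apply: val_inj; exact: ser_b1. Qed.
Lemma til_ser0 : til_ser 0 = 0 :> A.
Proof. by apply: val_inj; exact: ser_b0. Qed.
Lemma til_serM S T : til_ser S * til_ser T = til_ser (cmul S T) :> A.
Proof. by apply: val_inj; exact: ser_bM. Qed.
Lemma til_ser_inj : injective (@til_ser C).
Proof. by move=> S T /(congr1 val) /ser_b_inj. Qed.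
Lemma til_serC S T : til_ser S * til_ser T = til_ser T * til_ser S :> A.
Proof. by rewrite !til_serM cmulC. Qed.
Lemma til_ser_unit T : T 0%N != 0 -> exists U,
  [/\ U 0%N = (T 0%N)^-1, til_ser T * til_ser U = 1 :> A & til_ser U * til_ser T = 1 :> A].
Proof.
by move=> /ser_b_unit [U [U0 TU UT]]; exists U; split=> //; apply: val_inj.
Qed.

(** Coordinates in [ab_module] are indexed by ordinals, those of the division lemmas by natural
    numbers; this passes from the former to the latter. *)
Definition expand n (S : 'I_n -> fps C) : nat -> fps C :=
  fun i => if insub i is Some j then S j else 0.
Lemma expandE n (S : 'I_n -> fps C) (i : 'I_n) : expand S i = S i.
Proof. by rewrite /expand valK. Qed.

Lemma word_free E (e : E) l (T : nat -> fps C) : normalized l -> pres e l ->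
  \sum_(i < size l) til_ser (T i) *: (word (drop i.+1 l) *: e) = 0 ->
  forall i, (i < size l)%N -> T i = 0.
Proof.
move=> nl [_ ann]; under eq_bigr do rewrite scalerA.
rewrite -scaler_suml => /ann [v Ev].
have [|_ //] := @word_uniq C l (- v) T nl.
by rewrite Ev mulNr addNr.
Qed.

Lemma word_span E (e : E) l : normalized l -> pres e l -> forall x : E,
  exists T : nat -> fps C, x = \sum_(i < size l) til_ser (T i) *: (word (drop i.+1 l) *: e).
Proof.
move=> nl [ge ann] x; have [u ->] := ge x; have [v [T ->]] := word_div u nl.
exists T; rewrite scalerDl (proj2 (ann _)); last by exists v.
by rewrite add0r scaler_suml; apply: eq_bigr => i _; rewrite scalerA.
Qed.

Lemma pres_ab_module E (e : E) l : normalized l -> pres e l -> ab_module E.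
Proof.
move=> nl pe; exists (size l), (fun i => word (drop i.+1 l) *: e) => x.
have [T ET] := word_span nl pe x; exists (fun i : 'I_(size l) => T i); split=> // S ES.
apply/funext => i; apply: subr0_eq.
have := @word_free E e l (fun i => T i - expand S i) nl pe.
rewrite -(expandE S); apply; last by [].
under eq_bigr do rewrite -til_serD -til_serN scalerBl expandE.
by rewrite sumrB -ET -ES subrr.
Qed.

Lemma pres_quo E (e : E) (N : submodClosed E) m : generates e ->
  (forall u, u *: e \in N <-> mult (word m) u) -> pres (quo_class N e) m.
Proof.
move=> ge HN; split; first exact: generates_quo.
by move=> u; rewrite quo_classZ quo_class_eq0.
Qed.

Lemma mult_cat m1 m2 u : normalized m2 -> mult (word (m1 ++ m2)) (u * word m2) <-> mult (word m1) u.
Proof.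
move=> n2; rewrite word_cat; split=> [[v]|[v ->]]; last by exists v; rewrite mulrA.
by rewrite mulrA => /(word_rregI n2) ->; exists v.
Qed.

Lemma pres_sub E (e : E) (F : submodClosed E) m1 m2 : normalized m2 ->
  pres e (m1 ++ m2) -> (forall u, u *: e \in F <-> mult (word m2) u) ->
  exists f : submod F, val f = word m2 *: e /\ pres f m1.
Proof.
move=> n2 [ge ann] HF; have eF : word m2 *: e \in F by apply/HF; exists 1; rewrite mul1r.
have [f Ef] : exists f : submod F, val f = word m2 *: e by exists (exist (fun x : E => x \in F) _ eF).
exists f; split=> //; split.
  move=> x; have [u Eu] := ge (val x).
  have [v Ev] : mult (word m2) u by apply/HF; rewrite -Eu; exact: (valP x).
  by exists v; apply: val_inj; rewrite val_submodZ Ef Eu Ev scalerA.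
move=> u; rewrite -(mult_cat _ _ n2) -ann -scalerA -Ef -val_submodZ; split=> [->//|E0].
exact: submod_inj.
Qed.

Lemma pres_subquo E (e : E) (F G : submodClosed E) m1 m2 : normalized m2 ->
  generates e -> (forall u, u *: e \in F <-> mult (word m2) u) ->
  (forall u, u *: e \in G <-> mult (word (m1 ++ m2)) u) ->
  exists f : submod F, val f = word m2 *: e /\ pres (quo_class (trace F G) f) m1.
Proof.
move=> n2 ge HF HG; have eF : word m2 *: e \in F by apply/HF; exists 1; rewrite mul1r.
have [f Ef] : exists f : submod F, val f = word m2 *: e by exists (exist (fun x : E => x \in F) _ eF).
exists f; split=> //; split.
  move=> y; have [x ->] := quo_class_surj y; have [u Eu] := ge (val x).
  have [v Ev] : mult (word m2) u by apply/HF; rewrite -Eu; exact: (valP x).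
  exists v; rewrite quo_classZ; congr quo_class.
  by apply: val_inj; rewrite val_submodZ Ef Eu Ev scalerA.
move=> u; rewrite quo_classZ quo_class_eq0 -(mult_cat _ _ n2) -HG.
by rewrite [_ \in _]/(val _ \in G) val_submodZ Ef scalerA.
Qed.

(** Every class is that of its remainder, a series in b, so the module is cyclic over the
    subalgebra; and the quotient of an element of the subalgebra stays in it, which gives the
    annihilator. Taking the class of T instead of 1 as generator accommodates a letter with a
    nontrivial series. *)
Lemma pres_E (r : rat) (T : fps C) : T 0%N != 0 ->
  exists2 e : E_ C r, generates e & forall u, u *: e = 0 <-> mult (lin C r) (u * til_ser T).
Proof.
move=> T0; have [T' [_ TT' T'T]] := til_ser_unit T0.
pose I := GRing.SubmodClosed.clone (Ahat C) (Ahat C)^o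
  (left_ideal_pred (hat_a C - hat_cst (ratr r) * hat_b C)) _.
have memI (z : Ahat C) : z \in I <-> exists v : Ahat C, z = v * hlin (ratr r).
  by split=> [/asboolP|H]; [|apply/asboolP].
have scE (u : A) (z : Ahat C) :
  u *: (quo_class I z : E_ C r) = (quo_class I (val u * z) : E_ C r).
  by rewrite [LHS]quo_classZ.
exists (quo_class I (ser_b T) : E_ C r).
  move=> y; have [x ->] := quo_class_surj (y : quomod I).
  exists (til_ser (rem (ratr r) x) * til_ser T'); rewrite scE /=.
  apply/eqP; rewrite quo_classP; apply/memI; exists (quo (ratr r) x).
  have -> : ser_b (rem (ratr r) x) * ser_b T' * ser_b T = ser_b (rem (ratr r) x).
    by rewrite -mulrA (congr1 val T'T : ser_b T' * ser_b T = 1) mulr1.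
  by rewrite {1}(divE (ratr r) x) addrK.
move=> u; rewrite scE (quo_class_eq0 I) memI; split=> [[v Ev]|[v Ev]]; last first.
  by exists (val v); have := congr1 val Ev.
have uT : in_Atilde (val u * ser_b T) by exact: valP (u * til_ser T).
have vq : v = quo (ratr r) (val u * ser_b T).
  apply: subr0_eq; apply: (@hlin_lreg _ (ratr r)); rewrite mulrBl -Ev.
  rewrite {1}(divE (ratr r) (val u * ser_b T)).
  by rewrite (proj2 (rem_eq0 _ _)) ?ser_b0 ?addr0 ?subrr //; exists v.
have vA : in_Atilde v by rewrite vq; exact: in_Atilde_quo.
by exists (exist _ v vA); apply: val_inj.
Qed.

Lemma mult_blk x u V : til_ser x.2 * til_ser V = 1 :> A -> til_ser V * til_ser x.2 = 1 :> A ->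
  mult (word [:: x]) u <-> mult (lin C x.1) (u * til_ser V).
Proof.
move=> xV Vx; rewrite word1 /blk; split=> -[v].
  by move=> ->; exists v; rewrite -!mulrA xV mulr1.
by move=> E; exists v; rewrite mulrA -E -mulrA Vx mulr1.
Qed.

Lemma pres_E_iso E (e : E) x : x.2 0%N != 0 -> pres e [:: x] -> iso E (E_ C x.1).
Proof.
move=> x0 [ge ann]; have [V [V0 xV Vx]] := til_ser_unit x0.
have V0' : V 0%N != 0 by rewrite V0 invr_eq0.
have [e' ge' ann'] := pres_E x.1 V0'.
have [|f bf _] := iso_ann ge ge'; last by exists f.
by move=> u; rewrite ann ann' (mult_blk _ xV Vx).
Qed.

Lemma normalized_nth l j x0 : normalized l -> (j < size l)%N -> (nth x0 l j).2 0%N = 1.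
Proof. by elim: l j => [//|x l IH] [|j] /= [x1 nl] //; exact: IH. Qed.

Lemma ent_nth l j x0 : (0 < j <= size l)%N -> ent (map fst l) j = (nth x0 l j.-1).1.
Proof. by case: j => // j jl; rewrite /ent (nth_map x0). Qed.

Lemma drop_take_cat l i j : (i <= j)%N -> drop i l = take (j - i) (drop i l) ++ drop j l.
Proof. by move=> ij; rewrite -[in LHS](cat_take_drop (j - i) (drop i l)) drop_drop subnK. Qed.

Lemma flags_JH E (e : E) l (F : nat -> submodClosed E) : normalized l -> generates e ->
  (forall y : E, (y \in F 0%N) = (y == 0)) -> flags e l F -> is_JH (map fst l) F.
Proof.
move=> nl ge F0 HF; split=> //; rewrite ?size_map.
- move=> x; have [u ->] := ge x; apply/HF => //.
  by rewrite drop_size word0; exists u; rewrite mulr1.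
- move=> j jl x; have [u ->] := ge x; move=> /(HF j (ltnW jl)) [v ->].
  apply/HF => //; rewrite (drop_take_cat _ (leqnSn j)) word_cat mulrA.
  by eexists.
- move=> j jl; apply: (@pres_ab_module _ (quo_class (F j) e) (drop j l)).
    exact: normalized_drop.
  by apply: pres_quo => // u; exact: HF.
- case=> // j /= jl; pose x0 : letter := (0, 0).
  have E1 : drop j l = [:: nth x0 l j] ++ drop j.+1 l by rewrite (drop_nth x0).
  have [||u|u|f [_ pf]] := @pres_subquo E e (F j.+1) (F j) [:: nth x0 l j] (drop j.+1 l).
  + exact: normalized_drop.
  + exact: ge.
  + exact: HF.
  + by rewrite -E1; apply: HF; exact: ltnW.
  rewrite (@ent_nth l j.+1 x0) //; apply: pres_E_iso pf.
  by rewrite (normalized_nth x0 nl) // oner_eq0.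
Qed.

(* In F_j / F_(j-1) = E_lambda, the class of a generator f of F_j is T eps with T
   invertible, so that F_(j-1) is generated by (a - lambda b) T^-1 f. *)
Lemma JH_step E (F G : submodClosed E) (f : E) (r : rat) :
  (forall y : E, y \in F <-> exists u, y = u *: f) -> {subset G <= F} ->
  iso (subquo F G) (E_ C r) ->
  exists2 U : fps C, U 0%N = 1 & forall u, u *: f \in G <-> mult (blk (r, U)) u.
Proof.
move=> HF GF [phi bphi].
have fF : f \in F by apply/HF; exists 1; rewrite scale1r.
have [f' Ef] : exists f' : submod F, val f' = f by exists (exist (fun x : E => x \in F) f fF).
have T1 : ser1 0%N != 0 by rewrite oner_eq0.
have [eps geps aeps] := pres_E r T1.
have t1 := til_ser1.
have {}aeps z : z *: eps = 0 <-> mult (lin C r) z by rewrite aeps t1 mulr1.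
have [w Ew] := geps (phi (quo_class (trace F G) f')).
have [v Ev] : exists v, eps = v *: phi (quo_class (trace F G) f').
  have [g phiK gK] := bphi; have [y Ey] := quo_class_surj (g eps).
  have [v Ev] := (HF (val y)).1 (valP y); exists v.
  rewrite -linearZ /= quo_classZ -[LHS]gK; congr (phi _); rewrite Ey; congr quo_class.
  by apply: val_inj; rewrite val_submodZ Ef Ev.
have ann u : u *: f \in G <-> mult (lin C r) (u * w).
  rewrite -aeps -scalerA -Ew.
  rewrite -linearZ /= quo_classZ; split=> [fG|].
    by rewrite (proj2 (quo_class_eq0 _ _)) ?linear0 //; rewrite [_ \in _]/(val _ \in G) val_submodZ Ef.
  move=> E0; suff /quo_class_eq0 : quo_class (trace F G) (u *: f') = 0.
    by rewrite [_ \in _]/(val _ \in G) val_submodZ Ef.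
  by apply: (bij_inj bphi); rewrite linear0.
have nlx : @normalized C [:: (r, ser1)] by [].
have [w1 [T ET]] := word_div w nlx.
have {ET} ET : w = w1 * lin C r + til_ser (T 0%N).
  by move: ET; rewrite big_ord1 /= word0 mulr1 word1 /blk t1 mulr1.
have [v1 [S ES]] := word_div v nlx.
have {ES} ES : v = v1 * lin C r + til_ser (S 0%N).
  by move: ES; rewrite big_ord1 /= word0 mulr1 word1 /blk t1 mulr1.
have linT u : mult (lin C r) (u * w) <-> mult (lin C r) (u * til_ser (T 0%N)).
  rewrite ET mulrDr mulrA; split=> [[z Ez]|[z ->]].
    by exists (z - u * w1); rewrite mulrBl -Ez addrC addKr.
  by exists (u * w1 + z); rewrite mulrDl.
(* eps = v w eps, so v w - 1 is a left multiple of a - r b and has zero constant term. *)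
have T0 : T 0%N 0%N != 0.
  have : mult (lin C r) (v * w - 1).
    apply/aeps.
    by rewrite scalerBl scale1r -scalerA -Ew -Ev subrr.
  move=> [z /(congr1 val)]; rewrite rmorphB rmorphM /= => Ez.
  have := congr1 (fun x : Ahat C => x 0%N 0%N) Ez; rewrite AhatDE AhatNE mulA_hlin subr0.
  have -> : (val v * val w) 0%N 0%N = val v 0%N 0%N * T 0%N 0%N.
    rewrite mulAE !big_ord1 /=; congr (_ * _).
    have -> : val w = val w1 * hlin (ratr r) + ser_b (T 0%N) by rewrite ET.
    by rewrite AhatDE mulA_hlin subr0 add0r.
  move=> /eqP; rewrite subr_eq0 => /eqP E1; apply/eqP => T0.
  by move/eqP: E1; rewrite T0 mulr0 eq_sym oner_eq0.
have [V [V0 TV VT]] := til_ser_unit T0.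
(* The factor T(0) turns T^-1 into a series with constant term 1 without changing the left ideal. *)
pose c := T 0%N 0%N; pose U : fps C := fun n => c * V n.
exists U; first by rewrite /U V0 divff.
have cU : til_ser U = til_cst c * til_ser V.
  by apply: val_inj; rewrite /= -hat_cst_ser.
have cc d : d != 0 -> til_cst d * til_cst d^-1 = 1 :> A.
  by move=> d0; apply: val_inj; rewrite /= -[LHS]/(hat_cst d * hat_cst d^-1) hat_cstM divff // hat_cst1.
have ccomm d z : z * til_cst d = til_cst d * z by apply: val_inj; exact: mul_hat_cst.
have key : lin C r * (til_cst c * til_ser V) = til_cst c * (lin C r * til_ser V).
  by rewrite mulrA ccomm mulrA.
move=> u; rewrite ann linT /blk /= cU key; split=> -[z Ez].
  exists (z * til_cst c^-1); rewrite -[u]mulr1 -TV mulrA Ez -!mulrA; congr (z * _).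
  by rewrite mulrA -ccomm cc // mul1r.
exists (z * til_cst c); rewrite Ez -!mulrA VT mulr1; congr (z * _).
Qed.

(** Descend from F_k = E, generated by e: [JH_step] turns a generator of F_j into one of F_(j-1), so
    the word grows on the left. Reaching F_0 = 0 identifies the annihilator of e with the left ideal
    of the whole word. *)
Theorem JH_flags E (e : E) s (F : nat -> submodClosed E) : generates e -> is_JH s F ->
  exists l, [/\ normalized l, map fst l = s, pres e l & flags e l F].
Proof.
move=> ge [F0 Fk Finc _ Fiso].
have step j : (j <= size s)%N -> exists l, [/\ normalized l, map fst l = drop (size s - j) s &
    forall i, (i <= j)%N -> forall u, u *: e \in F (size s - j + i)%N <-> mult (word (drop i l)) u].
  elim: j => [_|j IH js].
    exists [::]; split=> //; first by rewrite subn0 drop_size.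
    move=> i; rewrite leqn0 => /eqP -> u; rewrite subn0 addn0 drop0 word0 Fk.
    by split=> // _; exists u; rewrite mulr1.
  have [l [nl ml Hl]] := IH (ltnW js).
  have Sj : (size s - j)%N = (size s - j.+1).+1 by rewrite subnSK.
  have Hj := Hl 0%N isT; rewrite addn0 drop0 Sj in Hj.
  have [x|x xF||U U1 HU] := @JH_step E (F (size s - j.+1).+1) (F (size s - j.+1)%N) (word l *: e)
    (ent s (size s - j.+1).+1).
  - split=> [xF|[u ->]]; last by rewrite scalerA; apply/Hj; exists u.
    have [u Eu] := ge x; move: xF; rewrite Eu => /Hj [v ->]; exists v; by rewrite scalerA.
  - by apply: Finc => //; rewrite -Sj leq_subr.
  - by apply: Fiso; rewrite -Sj leq_subr andbT Sj.
  exists ((ent s (size s - j.+1).+1, U) :: l); split=> //.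
    rewrite /= ml Sj [RHS](drop_nth 0); last by rewrite -Sj leq_subr.
    by [].
  case=> [_ u|i ij u]; last by rewrite addnS -addSn -Sj Hl.
  rewrite addn0 drop0 word_cons; split=> [uG|[v ->]]; last first.
    by rewrite mulrA -scalerA; apply/HU; exists v.
  have /Hj [v Ev] : u *: e \in F (size s - j.+1).+1.
    by apply: Finc uG; rewrite -Sj leq_subr.
  move: uG; rewrite Ev -scalerA => /HU [w ->]; exists w; by rewrite mulrA.
have [l [nl ml Hl]] := step _ (leqnn (size s)); rewrite subnn drop0 in ml.
have sl : size l = size s by rewrite -ml size_map.
exists l; split=> //; last first.
  by move=> j jl u; rewrite -(Hl j) ?subnn // -sl.
split=> // u; rewrite -[l]drop0 -(Hl 0%N) // subnn F0.
by split=> /eqP.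
Qed.

End Presentations.

(** * Commutation rules in the subalgebra *)

Section TildeRules.
Variable C : numFieldType.
Local Notation A := (Atilde C).
Local Notation a := (til_a C).
Local Notation b := (til_b C).
Implicit Types (u v : A) (T : fps C).

Definition theta_op T : fps C := fun n => n%:R * T n.

Lemma til_b_ser T : b * til_ser T = til_ser (shift T).
Proof. by apply: val_inj; exact: hat_b_ser. Qed.

Lemma til_a_ser T : a * til_ser T = til_ser T * a + b * til_ser (theta_op T).
Proof.
by rewrite til_b_ser; apply: val_inj; rewrite [LHS](hat_a_ser T); congr (_ + ser_b _).
Qed.

Lemma til_ab : a * b = b * a + b * b.
Proof. by apply: val_inj; apply/eqP; rewrite addrC -subr_eq; apply/eqP; exact: hat_ab. Qed.

Definition til_sigma u : A := exist (@in_Atilde C) _ (in_Atilde_sigma (valP u)).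

Lemma til_sigmaP u : b * u = til_sigma u * b.
Proof. by apply: val_inj; exact: sigmaP. Qed.

Lemma til_b_rreg u v : u * b = v * b -> u = v.
Proof. by move=> /(congr1 val) /hat_b_rreg E; exact: val_inj. Qed.

Lemma til_sigmaD u v : til_sigma (u + v) = til_sigma u + til_sigma v.
Proof. by apply: til_b_rreg; rewrite mulrDl -!til_sigmaP mulrDr. Qed.

Lemma til_sigmaM u v : til_sigma (u * v) = til_sigma u * til_sigma v.
Proof. by apply: til_b_rreg; rewrite -mulrA -!til_sigmaP !mulrA -til_sigmaP. Qed.

Lemma til_sigma1 : til_sigma 1 = 1.
Proof. by apply: til_b_rreg; rewrite -til_sigmaP mulr1 mul1r. Qed.

Lemma til_bexp_sigma n u : b ^+ n * u = iter n til_sigma u * b ^+ n.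
Proof.
elim: n => [|n IH]; first by rewrite mul1r mulr1.
by rewrite exprS -mulrA IH mulrA til_sigmaP -mulrA -exprS.
Qed.

Lemma til_bexp_ser n T : b ^+ n * til_ser T = til_ser T * b ^+ n.
Proof.
elim: n => [|n IH]; first by rewrite mul1r mulr1.
by rewrite exprS -mulrA IH mulrA til_serC -mulrA.
Qed.

Lemma lin_bexp r n : lin C r * b ^+ n = b ^+ n * lin C (r - n%:R).
Proof.
have bn : val (b ^+ n) = hat_b C ^+ n by exact: (rmorphXn (til_val C)).
apply: val_inj; transitivity (hlin (ratr r) * hat_b C ^+ n); first by rewrite -bn.
by rewrite hlin_bexp -bn -(ratr_nat C n) -rmorphB.
Qed.

Lemma til_cstD (c d : C) : til_cst (c + d) = til_cst c + til_cst d.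
Proof. by apply: val_inj; rewrite [RHS]hat_cstD. Qed.
Lemma til_cstM (c d : C) : til_cst (c * d) = til_cst c * til_cst d.
Proof. by apply: val_inj; rewrite [RHS]hat_cstM. Qed.
Lemma til_cst0 : til_cst 0 = 0 :> A.
Proof. by apply: val_inj; exact: hat_cst0. Qed.
Lemma til_cst1 : til_cst 1 = 1 :> A.
Proof. by apply: val_inj; exact: hat_cst1. Qed.
Lemma til_cstN (c : C) : til_cst (- c) = - til_cst c.
Proof. by apply/eqP; rewrite -addr_eq0 -til_cstD addNr til_cst0. Qed.
Lemma til_cstC (c : C) u : til_cst c * u = u * til_cst c.
Proof. by apply: val_inj; rewrite [RHS]mul_hat_cst. Qed.

Lemma til_ser_split T : til_ser T = til_cst (T 0%N) + b * til_ser (fun n => T n.+1).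
Proof.
rewrite til_b_ser til_serD; congr til_ser; apply/funext => -[|n]; first by rewrite [RHS]addr0.
by rewrite [RHS]add0r.
Qed.

End TildeRules.

(* E[b^-1] is the module of germs at infinity of sequences (x_n) with x_(n+1) = b x_n,
   where (x_n) stands for b^-n x_n. *)
Section Localization.
Variable C : numFieldType.
Local Notation A := (Atilde C).
Local Notation b := (til_b C).
Variable E : lmodType A.

Definition twisted : Type := nat -> E.
HB.instance Definition _ := GRing.Zmodule.copy twisted (nat -> E).

(** The n-th term stands for b^-n x_n, and u b^-n = b^-n sigma^n(u). *)
Definition twisted_scale (u : A) (x : twisted) : twisted :=
  fun n => iter n (@til_sigma C) u *: x n.

Lemma iter_sigmaD n (u v : A) : iter n (@til_sigma C) (u + v) =
  iter n (@til_sigma C) u + iter n (@til_sigma C) v.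
Proof. by elim: n => // n IH; rewrite !iterS IH til_sigmaD. Qed.
Lemma iter_sigmaM n (u v : A) : iter n (@til_sigma C) (u * v) =
  iter n (@til_sigma C) u * iter n (@til_sigma C) v.
Proof. by elim: n => // n IH; rewrite !iterS IH til_sigmaM. Qed.
Lemma iter_sigma1 n : iter n (@til_sigma C) 1 = 1.
Proof. by elim: n => // n IH; rewrite !iterS IH til_sigma1. Qed.
Lemma iter_sigma_b n : iter n (@til_sigma C) b = b.
Proof. by elim: n => // n IH; rewrite iterS IH; apply: til_b_rreg; rewrite -til_sigmaP. Qed.

Lemma twisted_scaleA u v x : twisted_scale u (twisted_scale v x) = twisted_scale (u * v) x.
Proof. by apply/funext => n; rewrite /twisted_scale scalerA iter_sigmaM. Qed.
Lemma twisted_scale1 : left_id 1 twisted_scale.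
Proof. by move=> x; apply/funext => n; rewrite /twisted_scale iter_sigma1 scale1r. Qed.
Lemma twisted_scaleDr : right_distributive twisted_scale +%R.
Proof. by move=> u x y; apply/funext => n; rewrite /twisted_scale scalerDr. Qed.
Lemma twisted_scaleDl x : {morph twisted_scale^~ x : u v / u + v}.
Proof. by move=> u v; apply/funext => n; rewrite /twisted_scale iter_sigmaD scalerDl. Qed.
HB.instance Definition _ := GRing.Zmodule_isLmodule.Build A twisted
  twisted_scaleA twisted_scale1 twisted_scaleDr twisted_scaleDl.

Definition coherent_pred : {pred twisted} :=
  fun x => `[< exists n0, forall n, (n0 <= n)%N -> x n.+1 = b *: x n >].
Lemma coherent_closed : submod_closed coherent_pred.
Proof.
split; first by apply/asboolP; exists 0%N => n _; rewrite [RHS]scaler0.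
move=> u x y /asboolP [n1 H1] /asboolP [n2 H2]; apply/asboolP.
exists (maxn n1 n2) => n; rewrite geq_max => /andP [l1 l2].
have sE z m : (u *: z : twisted) m = iter m (@til_sigma C) u *: z m by [].
have dE (z z' : twisted) m : (z + z') m = z m + z' m by [].
rewrite !dE !sE H1 // H2 // scalerDr !scalerA iterS -til_sigmaP; reflexivity.
Qed.
HB.instance Definition _ :=
  GRing.isSubmodClosed.Build A twisted coherent_pred coherent_closed.
Definition coherent : submodClosed twisted :=
  GRing.SubmodClosed.clone A twisted coherent_pred _.

Definition null_pred : {pred submod coherent} :=
  fun x => `[< exists n0, forall n, (n0 <= n)%N -> val x n = 0 >].
Lemma null_closed : submod_closed null_pred.
Proof.
split; first by apply/asboolP; exists 0%N.
move=> u x y /asboolP [n1 H1] /asboolP [n2 H2]; apply/asboolP.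
exists (maxn n1 n2) => n; rewrite geq_max => /andP [l1 l2].
have sE (z : submod coherent) m : (val (u *: z) : twisted) m = iter m (@til_sigma C) u *: val z m by [].
have dE (z z' : submod coherent) m : val (z + z') m = val z m + val z' m by [].
by rewrite dE sE H1 // H2 // scaler0 addr0.
Qed.
HB.instance Definition _ :=
  GRing.isSubmodClosed.Build A (submod coherent) null_pred null_closed.
Definition null : submodClosed (submod coherent) :=
  GRing.SubmodClosed.clone A (submod coherent) null_pred _.

Definition localized : lmodType A := quomod null.

Hypothesis b_inj : forall x : E, b *: x = 0 -> x = 0.

Lemma bexp_inj n (x : E) : b ^+ n *: x = 0 -> x = 0.
Proof.
elim: n => [|n IH]; first by rewrite scale1r.
by rewrite exprS -scalerA => /b_inj.
Qed.

Lemma constant_coherent (x : E) : (fun n => b ^+ n *: x : E) \in coherent.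
Proof. by apply/asboolP; exists 0%N => n _; rewrite scalerA exprS. Qed.

Lemma localization_exists : exists (iota : {linear E -> localized}), is_b_localization iota.
Proof.
pose cst x : submod coherent := exist (fun z : twisted => z \in coherent) _ (constant_coherent x).
have scE u (z : submod coherent) n : val (u *: z) n = iter n (@til_sigma C) u *: val z n by [].
have lin_i : linear (fun x => quo_class null (cst x) : localized).
  move=> u x y; rewrite -quo_class_linear; congr quo_class; apply: val_inj.
  apply/funext => n; rewrite /= scalerDr scalerA til_bexp_sigma.
  by rewrite [RHS]/(iter n (@til_sigma C) u *: (b ^+ n *: x) + b ^+ n *: y) scalerA.
have [iota iE] := linear_of lin_i; exists iota.
have nullP z : quo_class null z = 0 <-> exists n0, forall n, (n0 <= n)%N -> val z n = 0.
  by rewrite quo_class_eq0; split=> [/asboolP|H]; [|apply/asboolP].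
split.
- move=> x y; rewrite !iE => E1; apply/subr0_eq.
  have : quo_class null (cst x - cst y) = 0.
    rewrite addrC; have := quo_class_linear null (- 1) (cst y) (cst x).
    by rewrite !scaleN1r => ->; rewrite E1 addNr.
  move=> /nullP [n0 /(_ n0 (leqnn _)) H].
  by apply: (@bexp_inj n0); rewrite scalerBr -[RHS]H.
- have binj (y : localized) : b *: y = 0 -> y = 0.
    have [z ->] := quo_class_surj y; rewrite quo_classZ => /nullP [n0 H].
    by apply/nullP; exists n0 => n nn; apply: b_inj; rewrite -[RHS](H n nn) scE iter_sigma_b.
  have bsurj (y : localized) : exists y', b *: y' = y.
    have [z ->] := quo_class_surj y.
    (* Delaying the sequence by one step divides it by b; its value at 0 does not affect the
       germ. *)
    have zc : (fun n => if n is n'.+1 then val z n' else 0 : E) \in coherent.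
      have /asboolP [n0 H] := valP z; apply/asboolP; exists n0.+1 => -[//|n]; exact: H.
    pose z' : submod coherent := exist (fun z : twisted => z \in coherent) _ zc.
    exists (quo_class null z'); rewrite quo_classZ; apply/subr0_eq.
    rewrite -scaleN1r quo_classZ -quo_classD; apply/nullP.
    have /asboolP [n0 H] := valP z; exists n0.+1 => -[//|n] nn.
    have -> (z1 z2 : submod coherent) m : val (z1 + z2) m = val z1 m + val z2 m by [].
    rewrite scaleN1r.
    have -> (z1 : submod coherent) m : val (- z1) m = - val z1 m by [].
    by rewrite scE iter_sigma_b H // subrr.
  have [g gK] := choice bsurj; exists g => // y.
  by apply: subr0_eq; apply: binj; rewrite scalerBr gK subrr.
- move=> y; have [z ->] := quo_class_surj y.
  have /asboolP [n0 H] := valP z; exists n0, (val z n0).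
  rewrite iE quo_classZ; apply/subr0_eq; rewrite -[- _]scaleN1r quo_classZ -quo_classD.
  apply/nullP; exists n0 => n nn.
  have -> (z1 z2 : submod coherent) m : val (z1 + z2) m = val z1 m + val z2 m by [].
  rewrite scaleN1r.
  have -> (z1 : submod coherent) m : val (- z1) m = - val z1 m by [].
  have bs m : iter m (@til_sigma C) (b ^+ n0) = b ^+ n0.
    elim: m => // m IH; rewrite iterS IH; apply: til_b_rreg; rewrite -til_sigmaP.
    by rewrite -exprS exprSr.
  rewrite scE bs [val (cst _) n]/(b ^+ n *: _).
  have -> : val z n = b ^+ (n - n0) *: val z n0.
    rewrite -{1}(subnK nn); elim: (n - n0)%N => [|m IH]; first by rewrite scale1r.
    by rewrite addSn H ?leq_addl // IH scalerA exprS.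
  by rewrite scalerA -exprD subnKC // subrr.
Qed.

End Localization.

(** * Polynomials in an operator *)

Section PolyOperator.
Variable C : numFieldType.
Local Notation A := (Atilde C).
Variables (L : lmodType A) (D : L -> L).
Hypothesis D_add : forall x y, D (x + y) = D x + D y.
Hypothesis D_cst : forall c x, D (til_cst c *: x) = til_cst c *: D x.

Definition act (Q : {poly C}) (y : L) : L := \sum_(i < size Q) til_cst Q`_i *: iter i D y.

Lemma act_wide n (Q : {poly C}) y : (size Q <= n)%N ->
  act Q y = \sum_(i < n) til_cst Q`_i *: iter i D y.
Proof.
move=> sn; rewrite /act (big_ord_widen n (fun i => til_cst Q`_i *: iter i D y) sn) big_mkcond.
apply: eq_bigr => i _; case: ltnP => // /(nth_default 0) ->.
by rewrite til_cst0 scale0r.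
Qed.

Lemma actD_poly P Q y : act (P + Q) y = act P y + act Q y.
Proof.
pose n := maxn (size P) (size Q).
rewrite (@act_wide n) ?size_polyD // (@act_wide n P) ?leq_maxl // (@act_wide n Q) ?leq_maxr //.
by rewrite -big_split; apply: eq_bigr => i _; rewrite coefD til_cstD scalerDl.
Qed.

Lemma actZ c Q y : act (c *: Q) y = til_cst c *: act Q y.
Proof.
rewrite (@act_wide (size Q)) ?size_scale_leq // /act scaler_sumr.
by apply: eq_bigr => i _; rewrite coefZ til_cstM scalerA.
Qed.

Lemma act_mulX Q y : act (Q * 'X) y = act Q (D y).
Proof.
rewrite (@act_wide (size Q).+1); last first.
  by rewrite (leq_trans (size_polyMleq _ _)) // size_polyX addn2.
rewrite big_ord_recl coefMX til_cst0 scale0r add0r; apply: eq_bigr => i _.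
by rewrite coefMX /= -iterSr.
Qed.

Lemma actC c y : act c%:P y = til_cst c *: y.
Proof. by rewrite (@act_wide 1) ?size_polyC_leq1 // big_ord1 coefC. Qed.

Lemma iterD_add i x y : iter i D (x + y) = iter i D x + iter i D y.
Proof. by elim: i => // i IH; rewrite !iterS IH D_add. Qed.

Lemma iterD_cst i c x : iter i D (til_cst c *: x) = til_cst c *: iter i D x.
Proof. by elim: i => // i IH; rewrite !iterS IH D_cst. Qed.

Lemma act_add Q x y : act Q (x + y) = act Q x + act Q y.
Proof. by rewrite -big_split; apply: eq_bigr => i _; rewrite iterD_add scalerDr. Qed.

Lemma act_cst Q c x : act Q (til_cst c *: x) = til_cst c *: act Q x.
Proof.
rewrite /act scaler_sumr; apply: eq_bigr => i _.
by rewrite iterD_cst !scalerA til_cstC.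
Qed.

(** Meant for c = [mu i] and y = U_i Y_i: there D y + c y is the previous basis vector of E^sharp up
    to sign ([D_rel]), which allows an induction on the basis. *)
Lemma act_mulXaddC Q c d y : act (Q * ('X + c%:P) + d%:P) y =
  act Q (D y + til_cst c *: y) + til_cst d *: y.
Proof.
rewrite actD_poly actC; congr (_ + _).
by rewrite mulrDr actD_poly act_mulX mulrC mul_polyC actZ act_add act_cst.
Qed.

Lemma act_stable (S : L -> Prop) Q y : S 0 -> (forall x z, S x -> S z -> S (x + z)) ->
  (forall c x, S x -> S (til_cst c *: x)) -> (forall x, S x -> S (D x)) ->
  S y -> S (act Q y).
Proof.
move=> S0 SD Sc SDop Sy; rewrite /act; elim/big_rec: _ => // i x _ Sx.
by apply: SD => //; apply: Sc; elim: (i : nat) => //= j; exact: SDop.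
Qed.

End PolyOperator.

Lemma simple_pole_sub (C : numFieldType) (L : lmodType (Atilde C)) (N : submodClosed L) :
  simple_pole (submod N) <->
  forall y, y \in N -> exists2 z, z \in N & til_a C *: y = til_b C *: z.
Proof.
split=> [sp y yN|H y].
  have [y' Ey] := submod_lift yN; have [z Ez] := sp y'.
  by exists (val z); [exact: (valP z)|rewrite -Ey -!val_submodZ Ez].
have [z zN Ez] := H _ (valP y); have [z' Ez'] := submod_lift zN.
by exists z'; apply: submod_inj; rewrite !val_submodZ Ez'.
Qed.

(** * Bernstein polynomial of a word *)

Section Sharp.
Variable C : numFieldType.
Local Notation A := (Atilde C).
Local Notation a := (til_a C).
Local Notation b := (til_b C).
Local Notation letter := (rat * fps C)%type.
Variables (E : lmodType A) (e : E) (l : seq letter) (L : lmodType A) (iota : {linear E -> L}).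
Hypothesis nl : normalized l.
Hypothesis pe : pres e l.
Hypothesis loc : is_b_localization iota.
Let x0 : letter := (0, 0).
Let k := size l.
Let lam i := (nth x0 l i).1.
Let mu i : rat := lam i - (k - i.+1)%:R.
Let U i : A := til_ser (nth x0 l i).2.
Let ee i := word (drop i l) *: e.

Lemma loc_b_inj (x : L) : b *: x = 0 -> x = 0.
Proof. by move: loc => [_ bb _] E0; apply: (bij_inj bb); rewrite E0 scaler0. Qed.

Lemma loc_bexp_inj n (x y : L) : b ^+ n *: x = b ^+ n *: y -> x = y.
Proof.
move=> Exy; apply: subr0_eq; apply: (@bexp_inj _ _ loc_b_inj n).
by rewrite scalerBr Exy subrr.
Qed.

Lemma loc_div n (y : L) : exists x, b ^+ n *: x = y.
Proof.
move: loc => [_ [g gK bK] _]; elim: n y => [|n IH] y; first by exists y; rewrite scale1r.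
by have [x Ex] := IH (g y); exists x; rewrite exprS -scalerA Ex bK.
Qed.

Lemma Y_ex : exists Y : nat -> L, forall i, b ^+ (k - i.+1) *: Y i = iota (ee i.+1).
Proof.
have [Y HY] := choice (fun i => loc_div (k - i.+1) (iota (ee i.+1))).
by exists Y => i.
Qed.

Let Y := sval (cid Y_ex).
Let Y_def i : b ^+ (k - i.+1) *: Y i = iota (ee i.+1).
Proof. exact: (svalP (cid Y_ex)). Qed.

Definition sharp_pred : {pred L} :=
  fun y => `[< exists T : nat -> fps C, y = \sum_(i < k) til_ser (T i) *: Y i >].

Lemma sharp_predP y : y \in sharp_pred <->
  exists T : nat -> fps C, y = \sum_(i < k) til_ser (T i) *: Y i.
Proof. by split=> [/asboolP|H]; [|apply/asboolP]. Qed.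

Lemma sharp_Y (i : nat) T : (i < k)%N -> til_ser T *: Y i \in sharp_pred.
Proof.
move=> ik; apply/sharp_predP; exists (fun j => if j == i then T else 0).
rewrite (bigD1 (Ordinal ik)) //= eqxx big1 ?addr0 // => j ji.
rewrite ifN ?til_ser0 ?scale0r //; apply: contra ji => /eqP E1; exact/eqP/val_inj.
Qed.

Lemma sharp_D x y : x \in sharp_pred -> y \in sharp_pred -> x + y \in sharp_pred.
Proof.
move=> /sharp_predP [T ->] /sharp_predP [S ->]; apply/sharp_predP.
exists (fun i => T i + S i); rewrite -big_split; apply: eq_bigr => i _.
by rewrite -til_serD scalerDl.
Qed.

Lemma sharp_0 : 0 \in sharp_pred.
Proof.
by apply/sharp_predP; exists (fun=> 0); rewrite big1 // => i _; rewrite til_ser0 scale0r.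
Qed.

Lemma sharp_sum (n : nat) (F : 'I_n -> L) :
  (forall i, F i \in sharp_pred) -> \sum_(i < n) F i \in sharp_pred.
Proof. by move=> H; elim/big_rec: _ => [|i x _ Hx]; [exact: sharp_0|exact: sharp_D]. Qed.

(** As b^n u = sigma^n(u) b^n, it suffices to divide sigma^n(u) by the first i + 1 letters. The
    remainders multiply the suffixes following the letters j <= i, and b^-n turns these into b^(i-j)
    Y_j. *)
Lemma sharp_scale_Y (u : A) i : (i < k)%N -> u *: Y i \in sharp_pred.
Proof.
move=> ik; pose n := (k - i.+1)%N; pose u' := iter n (@til_sigma C) u.
have ne : normalized (take i.+1 l) by exact: normalized_take.
have [v [T ET]] := word_div u' ne; rewrite size_takel // in ET.
have Eu : u' *: ee i.+1 = \sum_(j < i.+1) til_ser (T j) *: ee j.+1.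
  rewrite /ee scalerA ET mulrDl scalerDl -mulrA -word_cat cat_take_drop.
  rewrite (proj2 (pe.2 (v * word l))); last by exists v.
  rewrite add0r mulr_suml scaler_suml; apply: eq_bigr => j _.
  rewrite scalerA -mulrA -word_cat; congr ((_ * word _) *: _).
  rewrite -[in RHS](cat_take_drop i.+1 l) drop_cat size_takel //.
  have [ji|ij] := ltnP j.+1 i.+1; first by [].
  have -> : j.+1 = i.+1 by apply/eqP; rewrite eqn_leq ij ltn_ord.
  by rewrite subnn drop0 drop_oversize // size_takel.
have -> : u *: Y i = \sum_(j < i.+1) (til_ser (T j) * b ^+ (i - j)) *: Y j.
  apply: (@loc_bexp_inj n); rewrite scalerA til_bexp_sigma -scalerA Y_def -linearZ /= Eu.
  rewrite linear_sum scaler_sumr; apply: eq_bigr => j _.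
  rewrite linearZ /= -Y_def !scalerA mulrA til_bexp_ser -mulrA -exprD.
  by congr ((_ * b ^+ _) *: _); rewrite /n; have := ltn_ord j; lia.
apply: sharp_sum => j; have -> : b ^+ (i - j) = til_ser (fun m => (m == (i - j)%N)%:R).
  by apply: val_inj; rewrite [RHS]/= -bexp_ser; exact: (rmorphXn (til_val C)).
rewrite til_serM; apply: sharp_Y; exact: leq_trans (ltn_ord j) ik.
Qed.

Lemma sharp_closed : submod_closed sharp_pred.
Proof.
split; first exact: sharp_0.
move=> u x y /sharp_predP [T ->] Hy; apply: sharp_D => //; rewrite scaler_sumr.
by apply: sharp_sum => i; rewrite scalerA; exact: sharp_scale_Y.
Qed.
HB.instance Definition _ := GRing.isSubmodClosed.Build A L sharp_pred sharp_closed.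
Definition sharp : submodClosed L := GRing.SubmodClosed.clone A L sharp_pred _.

Lemma sharpP y : y \in sharp <-> exists T : nat -> fps C, y = \sum_(i < k) til_ser (T i) *: Y i.
Proof. exact: sharp_predP. Qed.

Lemma Y_sharp i : (i < k)%N -> Y i \in sharp.
Proof. by move=> ik; rewrite -[Y i]scale1r -til_ser1; exact: sharp_Y. Qed.

Lemma sharp_iota x : iota x \in sharp.
Proof.
have [T ->] := word_span nl pe x; rewrite linear_sum; apply: rpred_sum => i _.
rewrite linearZ /= -[word _ *: e]/(ee i.+1) -Y_def !rpredZ //; exact: Y_sharp.
Qed.

(** b^k Y_j is b^(j+1) times the image of a suffix applied to e, so multiplication by b^k brings the
    relation back to E and merely shifts the coefficients. *)
Lemma Y_free (T : nat -> fps C) : \sum_(i < k) til_ser (T i) *: Y i = 0 ->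
  forall i, (i < k)%N -> T i = 0.
Proof.
move=> /(congr1 (fun y => b ^+ k *: y)); rewrite scaler0 scaler_sumr => E0 i ik.
pose S (j : nat) := iter j.+1 (@shift C) (T j).
have bS j : b ^+ j.+1 * til_ser (T j) = til_ser (S j).
  rewrite /S; move: j.+1 (T j) => n V.
  by elim: n => [|n IH]; rewrite ?mul1r // exprS -mulrA IH til_b_ser.
have /(_ i ik) : forall j, (j < size l)%N -> S j = 0.
  apply: (word_free nl pe); move: loc => [ii _ _]; apply: ii.
  rewrite linear0 -[RHS]E0 linear_sum; apply: eq_bigr => j _.
  rewrite linearZ /= -[word _ *: e]/(ee j.+1) -Y_def -bS !scalerA.
  rewrite til_bexp_ser -mulrA -exprD til_bexp_ser; congr ((_ * b ^+ _) *: _).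
  by have := ltn_ord j; rewrite /k; lia.
move=> Si; apply/funext => n; have := congr1 (fun f => f (n + i.+1)%N) Si.
rewrite /S; elim: (i.+1) => [|m IH]; first by rewrite addn0.
by rewrite addnS.
Qed.

Lemma sharp_ab_module : ab_module (submod sharp).
Proof.
have Yi (i : 'I_k) : Y i \in sharp by exact: Y_sharp.
exists k, (fun i => exist (fun y : L => y \in sharp) _ (Yi i)) => x.
have vs (S : 'I_k -> fps C) :
    val (\sum_i til_ser (S i) *: (exist (fun y : L => y \in sharp) _ (Yi i) : submod sharp))
    = \sum_i til_ser (S i) *: Y i.
  by rewrite raddf_sum; apply: eq_bigr => i _; exact: val_submodZ.
have [T ET] := (sharpP _).1 (valP x).
exists (fun i : 'I_k => T i); split; first by apply: submod_inj; rewrite vs.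
move=> S /(congr1 val); rewrite vs ET => ES; apply/funext => i; apply: subr0_eq.
rewrite -[S i]expandE; apply: (Y_free (T := fun j => T j - expand S j)) => //.
under eq_bigr do rewrite -til_serD -til_serN scalerBl expandE.
by rewrite sumrB ES subrr.
Qed.

Let Yp i := if i is j.+1 then Y j else 0.

(** Letter i sends the vector of the suffix after it to that of the suffix starting at it;
    conjugation by b^(k-i-1) shifts lambda_i to [mu i]. For i = 0 the result is the whole word
    applied to e, which is 0. *)
Lemma Y_rel i : (i < k)%N -> lin C (mu i) *: (U i *: Y i) = b *: Yp i.
Proof.
move=> ik; apply: (@loc_bexp_inj (k - i.+1)).
have step : (lin C (lam i) * U i) *: ee i.+1 = ee i.
  by rewrite scalerA /U /ee (drop_nth x0 ik) word_cons.
have -> : b ^+ (k - i.+1) *: (lin C (mu i) *: (U i *: Y i)) = iota (ee i).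
  rewrite scalerA -lin_bexp -scalerA [b ^+ _ *: _]scalerA til_bexp_ser -scalerA Y_def.
  by rewrite -2!linearZ /= scalerA step.
case: i ik step => [|i] ik step.
  rewrite /Yp scaler0 scaler0 /ee drop0 (proj2 (pe.2 _)) ?linear0 //.
  by exists 1; rewrite mul1r.
rewrite /Yp scalerA -exprSr -Y_def; congr (b ^+ _ *: _); lia.
Qed.

Lemma U_inv i : (i < k)%N -> exists2 V, V 0%N = 1 & til_ser V * U i = 1.
Proof.
move=> ik; have u1 := normalized_nth x0 nl ik.
have [|V [V0 _ VU]] := @til_ser_unit C (nth x0 l i).2; first by rewrite u1 oner_eq0.
by exists V => //; rewrite V0 u1 invr1.
Qed.

Lemma Yp_sharp i : (i <= k)%N -> Yp i \in sharp.
Proof. by case: i => [|i] ik; [rewrite rpred0|exact: Y_sharp]. Qed.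

Lemma sharp_simple_pole (y : L) : y \in sharp -> exists2 z, z \in sharp & a *: y = b *: z.
Proof.
move=> /sharpP [T ->]; rewrite scaler_sumr.
suff H (i : 'I_k) : exists2 z, z \in sharp & a *: (til_ser (T i) *: Y i) = b *: z.
  have H' (i : 'I_k) : exists z, z \in sharp /\ a *: (til_ser (T i) *: Y i) = b *: z.
    by have [z zs Ez] := H i; exists z.
  have [z Hz] := choice H'.
  exists (\sum_i z i); first by apply: rpred_sum => i _; case: (Hz i).
  by rewrite scaler_sumr; apply: eq_bigr => i _; case: (Hz i).
have ik := ltn_ord i; have [V _ VU] := U_inv ik.
pose S := cmul (T i) V.
have -> : til_ser (T i) *: Y i = til_ser S *: (U i *: Y i).
  by rewrite -til_serM !scalerA -mulrA VU mulr1.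
exists (til_ser (theta_op S) *: (U i *: Y i)
   + til_ser S *: (til_cst (ratr (mu i)) *: (U i *: Y i) + Yp i)).
  by rewrite !(rpredD, rpredZ) ?Y_sharp ?Yp_sharp // ltnW.
rewrite scalerA til_a_ser scalerDl addrC scalerDr; congr (_ + _).
  by rewrite -scalerA.
rewrite -scalerA; have -> : b *: (til_ser S *: (til_cst (ratr (mu i)) *: (U i *: Y i) + Yp i)) =
    til_ser S *: (b *: (til_cst (ratr (mu i)) *: (U i *: Y i) + Yp i)).
  by rewrite !scalerA til_serC.
congr (_ *: _).
have -> : a = lin C (mu i) + til_cst (ratr (mu i)) * b by rewrite subrK.
by rewrite scalerDl Y_rel // scalerDr addrC til_cstC -scalerA.
Qed.

(** Minimality: a simple pole module containing E contains Y_(k-1), the image of e, and [Y_rel]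
    divided by b yields Y_(i-1) from Y_i. *)
Lemma sharp_is_sharp : is_sharp iota sharp.
Proof.
split; first split.
- exact: sharp_ab_module.
- exact/simple_pole_sub/sharp_simple_pole.
- exact: sharp_iota.
move=> N [_ sp iN] y /sharpP [T ->]; apply: rpred_sum => i _; rewrite rpredZ //.
have H j : (j < k)%N -> Y (k - j.+1) \in N.
  elim: j => [|j IH] jk.
    have := iN (ee k); rewrite -{1}(ltn_predK jk) -Y_def subn1 prednK ?subnn ?scale1r //.
  have kj : (k - j.+1)%N = (k - j.+2).+1 by rewrite subnSK.
  have ik : (k - j.+1 < k)%N by rewrite ltn_subrL /= (leq_trans _ jk).
  have UN : U (k - j.+1) *: Y (k - j.+1) \in N by rewrite rpredZ // IH // ltnW.
  have := Y_rel ik; set z := U _ *: _ in UN *.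
  have [w wN Ew] := (simple_pole_sub _).1 sp z UN.
  rewrite kj /Yp /lin scalerBl Ew => Eb.
  have -> : Y (k - j.+2) = w - til_cst (ratr (mu (k - j.+1))) *: z.
    apply: (@loc_bexp_inj 1); rewrite expr1 -Eb scalerBr -kj; congr (_ - _).
    by rewrite !scalerA til_cstC.
  by rewrite submodB // rpredZ.
have := H (k - i.+1)%N; have ik := ltn_ord i.
have -> : (k - (k - i.+1).+1)%N = i by lia.
by apply; lia.
Qed.

Lemma Dop_ex : exists D : L -> L, forall y, b *: D y = - (a *: y).
Proof.
have [D HD] := choice (fun y => loc_div 1 (- (a *: y))).
by exists D => y; have := HD y; rewrite expr1.
Qed.

Section BernsteinOperator.
Variable D : L -> L.
Hypothesis HD : forall y, b *: D y = - (a *: y).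

Lemma Dop_unique x y : b *: x = - (a *: y) -> D y = x.
Proof. by move=> E1; apply: (@loc_bexp_inj 1); rewrite expr1 HD E1. Qed.

Lemma Dop_add x y : D (x + y) = D x + D y.
Proof. by apply: Dop_unique; rewrite !scalerDr !HD opprD. Qed.

Lemma Dop_cst c x : D (til_cst c *: x) = til_cst c *: D x.
Proof.
by apply: Dop_unique; rewrite !scalerA -til_cstC -scalerA HD scalerN scalerA til_cstC.
Qed.

Lemma Dop_b z : D (b *: z) = b *: (D z - z).
Proof.
apply: Dop_unique; rewrite scalerBr HD -opprD scalerN; congr (- _).
by rewrite scalerDr !scalerA til_ab scalerDl.
Qed.

Lemma Dop_sharp y : y \in sharp -> D y \in sharp.
Proof.
move=> ys; have [z zs Ez] := sharp_simple_pole ys.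
by rewrite (@Dop_unique (- z)) ?submodN // scalerN Ez.
Qed.

Let bN (y : L) : Prop := exists2 z, z \in sharp & y = b *: z.

Lemma bN0 : bN 0. Proof. by exists 0; rewrite ?rpred0 // scaler0. Qed.
Lemma bND x y : bN x -> bN y -> bN (x + y).
Proof. by move=> [x' xs ->] [y' ys ->]; exists (x' + y'); rewrite ?rpredD // scalerDr. Qed.
Lemma bN_ser (T : fps C) x : bN x -> bN (til_ser T *: x).
Proof.
move=> [x' xs ->]; exists (til_ser T *: x'); rewrite ?rpredZ // !scalerA.
by rewrite til_serC.
Qed.
Lemma bND_l x y : bN x -> (bN (x + y) <-> bN y).
Proof.
move=> Hx; split=> [Hxy|Hy]; last exact: bND.
have -> : y = til_cst (-1) *: x + (x + y).
  by rewrite til_cstN til_cst1 scaleN1r addKr.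
by apply: bND => //; exact: bN_ser.
Qed.
Lemma bN_D x : bN x -> bN (D x).
Proof.
move=> [x' xs ->]; rewrite Dop_b; exists (D x' - x') => //.
by rewrite submodB // Dop_sharp.
Qed.
Lemma bN_act Q x : bN x -> bN (act D Q x).
Proof.
apply: act_stable; [exact: bN0|exact: bND|by move=> c y; exact: bN_ser|exact: bN_D].
Qed.

Lemma D_rel i : (i < k)%N -> D (U i *: Y i) + til_cst (ratr (mu i)) *: (U i *: Y i) = - Yp i.
Proof.
move=> ik; apply: (@loc_bexp_inj 1); rewrite expr1 scalerDr HD scalerN -Y_rel //.
rewrite /lin scalerBl opprB addrC; congr (_ - _).
by rewrite !scalerA til_cstC.
Qed.

Lemma U_mod i : (i < k)%N -> bN (U i *: Y i - Y i).
Proof.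
move=> ik; rewrite /U til_ser_split (normalized_nth x0 nl ik) til_cst1 scalerDl scale1r.
rewrite addrC addKr -scalerA; eexists; last reflexivity.
by rewrite rpredZ // Y_sharp.
Qed.

(** Filtration of E^sharp / b E^sharp by the spans of the first basis vectors; D is triangular in
    this basis and preserves it. *)
Let lev j (y : L) : Prop := exists (t : nat -> C) (z : L),
  z \in sharp /\ y = \sum_(i < j) til_cst (t i) *: Y i + b *: z.

Lemma lev0 j : lev j 0.
Proof.
exists (fun=> 0), 0; split; first exact: rpred0.
by rewrite scaler0 addr0 big1 // => i _; rewrite til_cst0 scale0r.
Qed.

Lemma levD j x y : lev j x -> lev j y -> lev j (x + y).
Proof.
move=> [t [z [zs ->]]] [t' [z' [zs' ->]]]; exists (fun i => t i + t' i), (z + z').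
rewrite rpredD //; split=> //; rewrite scalerDr addrACA -big_split; congr (_ + _).
by apply: eq_bigr => i _; rewrite til_cstD scalerDl.
Qed.

Lemma lev_cst j c x : lev j x -> lev j (til_cst c *: x).
Proof.
move=> [t [z [zs ->]]]; exists (fun i => c * t i), (til_cst c *: z); rewrite rpredZ //.
split=> //; rewrite scalerDr scaler_sumr !scalerA til_cstC; congr (_ + _).
by apply: eq_bigr => i _; rewrite scalerA til_cstM.
Qed.

Lemma lev_bN j x : bN x -> lev j x.
Proof.
move=> [z zs ->]; exists (fun=> 0), z; split=> //.
by rewrite big1 ?add0r // => i _; rewrite til_cst0 scale0r.
Qed.

Lemma lev_Y j i : (i < j)%N -> lev j (Y i).
Proof.
move=> ij; exists (fun m => if m == i then 1 else 0), 0; split; first exact: rpred0.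
rewrite scaler0 addr0 (bigD1 (Ordinal ij)) //= eqxx til_cst1 scale1r big1 ?addr0 // => m mi.
rewrite ifN ?til_cst0 ?scale0r //; apply: contra mi => /eqP E1; exact/eqP/val_inj.
Qed.

Lemma lev_Dop j x : (j <= k)%N -> lev j x -> lev j (D x).
Proof.
move=> jk [t [z [zs ->]]]; rewrite Dop_add; apply: levD; last first.
  by apply: lev_bN; apply: bN_D; exists z.
elim/big_rec: _ => [|i y _ Hy].
  rewrite (@Dop_unique 0) ?scaler0 ?oppr0 //; exact: lev0.
rewrite Dop_add Dop_cst; apply: levD => //; apply: lev_cst.
have ij := ltn_ord i; have ik := leq_trans ij jk.
have -> : Y i = U i *: Y i + til_cst (-1) *: (U i *: Y i - Y i).
  by rewrite til_cstN til_cst1 scaleN1r opprB addrC subrK.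
rewrite Dop_add Dop_cst; apply: levD; last first.
  by apply: lev_cst; apply: lev_bN; apply: bN_D; exact: U_mod.
have -> : D (U i *: Y i) = til_cst (-1) *: Yp i + til_cst (- ratr (mu i)) *: (U i *: Y i).
  have := D_rel ik; rewrite til_cstN til_cst1 scaleN1r til_cstN scaleNr => <-.
  by rewrite addrK.
apply: levD; apply: lev_cst.
  rewrite /Yp; case: (i : nat) ij => [|m] mj; [exact: lev0|apply: lev_Y; exact: ltnW].
rewrite -[U i *: Y i](subrK (Y i)); apply: levD; last exact: lev_Y.
by apply: lev_bN; exact: U_mod.
Qed.

Lemma lev_free j c : (j < k)%N -> lev j (til_cst c *: Y j) -> c = 0.
Proof.
move=> jk [t [z [/sharpP [T ->] E1]]].
pose S i := if (i < j)%N then fun n => if n == 0%N then t i else 0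
            else if i == j then fun n => if n == 0%N then - c else 0 else 0 : fps C.
have E2 : \sum_(i < k) til_ser (S i) *: Y i = \sum_(i < j) til_cst (t i) *: Y i - til_cst c *: Y j.
  rewrite (bigID (fun i : 'I_k => (i < j)%N)) /=; congr (_ + _).
    rewrite (big_ord_widen k (fun i => til_cst (t i) *: Y i) (ltnW jk)).
    by apply: eq_bigr => i ij; rewrite /S ij.
  rewrite (bigD1 (Ordinal jk)) /=; last by rewrite ltnn.
  rewrite /S ltnn eqxx big1 ?addr0.
    by rewrite -[X in X *: _]/(til_cst (- c)) til_cstN scaleNr.
  move=> i /andP [ij ji]; by rewrite (negbTE ij) ifN ?til_ser0 ?scale0r.
have : \sum_(i < k) til_ser (S i + shift (T i)) *: Y i = 0.
  under eq_bigr do rewrite -til_serD scalerDl -til_b_ser -scalerA.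
  by rewrite big_split /= E2 -scaler_sumr addrAC -E1 subrr.
move=> /(@Y_free (fun i => S i + shift (T i))) /(_ j jk) /(congr1 (fun f => f 0%N)).
rewrite -[LHS]/(S j 0%N + 0) addr0 /S ltnn eqxx /= => /eqP; rewrite oppr_eq0 => /eqP //.
Qed.

(** Modulo b, D + [mu j] sends Y_j to - Y_(j-1). The last vector is therefore cyclic for D, and the
    minimal polynomial is the full product of the X + [mu i], even when some of the [mu i]
    coincide. *)
Lemma act_Yp j Q : (j <= k)%N ->
  bN (act D Q (Yp j)) <-> \prod_(i < j) ('X + (ratr (mu i))%:P) %| Q.
Proof.
elim: j Q => [|j IH] Q jk.
  rewrite big_ord0 dvd1p; split=> // _; rewrite /Yp.
  have -> : act D Q 0 = 0; last exact: bN0.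
  by have := act_cst Dop_cst Q 0 0; rewrite til_cst0 !scale0r.
rewrite big_ord_recr /=; set B := \prod_(i < j) _.
have XN : 'X + (ratr (mu j))%:P = 'X - (- ratr (mu j))%:P :> {poly C}.
  by rewrite polyCN opprK.
pose q := Q %/ ('X + (ratr (mu j))%:P); pose c := Q.[- ratr (mu j)].
have EQ : Q = q * ('X + (ratr (mu j))%:P) + c%:P.
  by rewrite {1}(divp_eq Q ('X + (ratr (mu j))%:P)) [X in _ + X = _](_ : _ = c%:P) // XN modp_XsubC.
have Ez : act D Q (U j *: Y j) = til_cst (-1) *: act D q (Yp j) + til_cst c *: (U j *: Y j).
  rewrite {1}EQ (act_mulXaddC Dop_add Dop_cst) D_rel //.
  by rewrite -(act_cst Dop_cst) til_cstN til_cst1 scaleN1r.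
have bNY : bN (act D Q (Y j)) <-> bN (act D Q (U j *: Y j)).
  rewrite -[U j *: Y j](subrK (Y j)) (act_add Dop_add) bND_l //.
  by apply: bN_act; exact: U_mod.
have dvE : (B * ('X + (ratr (mu j))%:P) %| Q) <-> c = 0 /\ B %| q.
  split=> [dv|[c0 dq]]; last by rewrite EQ c0 addr0 dvdp_mul2r // XN polyXsubC_eq0.
  have c0 : c = 0.
    apply/eqP; rewrite -/(root Q _) root_factor_theorem; apply: dvdp_trans dv.
    by rewrite -XN dvdp_mulIr.
  by split=> //; move: dv; rewrite {1}EQ c0 addr0 dvdp_mul2r // XN polyXsubC_eq0.
rewrite dvE /Yp bNY Ez; split=> [H|[-> /IH H]]; last first.
  rewrite til_cst0 scale0r addr0; apply: bN_ser; apply: H; exact: ltnW.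
(* In Q(D) U_j Y_j = - q(D) Y_(j-1) + c U_j Y_j, the first term involves only Y_0, ..., Y_(j-1)
   modulo b. *)
have c0 : c = 0.
  apply: (@lev_free j) => //.
  have -> : til_cst c *: Y j = (til_cst (-1) *: act D q (Yp j) + til_cst c *: (U j *: Y j))
      + (act D q (Yp j) + til_cst (- c) *: (U j *: Y j - Y j)).
    rewrite [til_cst (-1)]til_cstN til_cst1 scaleN1r til_cstN scaleNr scalerBr opprB.
    by rewrite addrACA addNr add0r addrC subrK.
  apply: levD; first exact: lev_bN.
  apply: levD; last by apply: lev_cst; apply: lev_bN; exact: U_mod.
  apply: act_stable; [exact: lev0|exact: levD|exact: lev_cst|move=> x; exact: lev_Dop (ltnW jk)|].
  by rewrite /Yp; case: (j) => [|m]; [exact: lev0|exact: lev_Y].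
split=> //; apply/IH; first exact: ltnW.
move: H; rewrite c0 til_cst0 scale0r addr0 => /(bN_ser (fun n => if n == 0%N then -1 else 0)).
rewrite -[til_ser _]/(til_cst (-1)) scalerA -til_cstM mulrNN mul1r til_cst1 scale1r; exact.
Qed.

Lemma act_sharp Q : (forall y, y \in sharp -> exists2 z, z \in sharp & act D Q y = b *: z) <->
  \prod_(i < k) ('X + (ratr (mu i))%:P) %| Q.
Proof.
split=> [H|H].
  apply/act_Yp => //; apply: H; exact: Yp_sharp.
have bY (i : 'I_k) : bN (act D Q (Y i)).
  apply/(@act_Yp i.+1) => //; apply: dvdp_trans H.
  rewrite -(big_mkord predT (fun i => 'X + (ratr (mu i))%:P)).
  rewrite -(big_mkord predT (fun i => 'X + (ratr (mu i))%:P)).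
  by rewrite (@big_cat_nat _ _ _ i.+1 0%N k) //= dvdp_mulIl.
move=> y /sharpP [T ->]; rewrite -/(bN _); elim/big_rec: _ => [|i x _ Hx].
  have -> : act D Q 0 = 0; last exact: bN0.
  by have := act_cst Dop_cst Q 0 0; rewrite til_cst0 !scale0r.
rewrite (act_add Dop_add); apply: bND => //.
rewrite til_ser_split scalerDl (act_add Dop_add) (act_cst Dop_cst); apply: bND.
  exact: bN_ser.
apply: bN_act; rewrite -scalerA; eexists; last reflexivity.
by rewrite rpredZ // Y_sharp.
Qed.

End BernsteinOperator.

End Sharp.

Section BernsteinOfWords.
Variable C : numFieldType.
Local Notation A := (Atilde C).
Local Notation b := (til_b C).
Implicit Types (E : lmodType A) (l : seq (rat * fps C)).

Definition mu_ l (i : nat) : rat := (nth (0, 0) l i).1 - (size l - i.+1)%:R.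

Definition bernstein_word l : {poly C} := \prod_(i < size l) ('X + (ratr (mu_ l i))%:P).

Lemma pres_b_inj E (e : E) l : normalized l -> pres e l -> forall x : E, b *: x = 0 -> x = 0.
Proof.
move=> nl pe x; have [T ->] := word_span nl pe x.
rewrite scaler_sumr => E0; apply: big1 => i _.
suff -> : T i = 0 by rewrite til_ser0 scale0r.
have /(_ i (ltn_ord i)) H : forall i, (i < size l)%N -> shift (T i) = 0.
  apply: (word_free nl pe); rewrite -[RHS]E0; apply: eq_bigr => j _.
  by rewrite -til_b_ser -scalerA.
by apply/funext => n; have := congr1 (fun f => f n.+1) H.
Qed.

Lemma pres_loc E (e : E) l : normalized l -> pres e l ->
  exists (L : lmodType A) (iota : {linear E -> L}), is_b_localization iota.
Proof.
move=> nl pe; have [iota H] := localization_exists (pres_b_inj nl pe).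
by exists (localized E), iota.
Qed.

Theorem pres_bernstein E (e : E) l : normalized l -> pres e l -> is_bernstein E (bernstein_word l).
Proof.
move=> nl pe; have [L [iota loc]] := pres_loc nl pe.
have [D HD] := Dop_ex loc.
exists L, iota, (sharp nl pe loc), D; split=> //.
- exact: sharp_is_sharp.
- apply: monic_prod => i _; rewrite -[_%:P]opprK -polyCN; exact: monicXsubC.
- by move=> Q; apply: act_sharp.
Qed.

Theorem pres_regular E (e : E) l : normalized l -> pres e l -> regular E.
Proof.
move=> nl pe; have [L [iota loc]] := pres_loc nl pe.
split; first exact: pres_ab_module nl pe.
have [[abN spN iN] _] := sharp_is_sharp nl pe loc.
exists (submod (sharp nl pe loc)); split=> //.
have [f fE] := choice (fun x => submod_lift (iN x)).
have lf : linear f by move=> u x y; apply: submod_inj; rewrite val_submodP !fE linearP.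
have [g gE] := linear_of lf; exists g => x y; rewrite !gE => /(congr1 val); rewrite !fE.
by have [ii _ _] := loc; exact: ii.
Qed.

Lemma root_bernstein_word l (c : C) : root (bernstein_word l) c ->
  exists2 i, (i < size l)%N & c = - ratr (mu_ l i).
Proof.
have -> : bernstein_word l = \prod_(i < size l) ('X - (- ratr (mu_ l i))%:P).
  by apply: eq_bigr => i _; rewrite polyCN opprK.
by rewrite rootE horner_prod => /prodf_eq0 [i _]; rewrite hornerXsubC subr_eq0 => /eqP; exists i.
Qed.

Lemma bernstein_word_root l i : (i < size l)%N -> root (bernstein_word l) (- ratr (mu_ l i)).
Proof.
move=> il; rewrite /bernstein_word (bigD1 (Ordinal il)) //= rootE hornerM hornerD hornerX hornerC.
by rewrite addNr mul0r.
Qed.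

End BernsteinOfWords.

(** * Roots of a Bernstein polynomial located by valuations *)

Section RootFromValuation.
Variable C : numFieldType.
Local Notation A := (Atilde C).
Local Notation a := (til_a C).
Local Notation b := (til_b C).
Variables (E L : lmodType A) (iota : {linear E -> L}) (N : submodClosed L) (D : L -> L).
Variables (B : {poly C}) (F : submodClosed E) (f : E -> fps C) (la : rat).
Hypothesis loc : is_b_localization iota.
Hypothesis Npole : simple_pole_over iota N.
Hypothesis HD : forall y, b *: D y = - (a *: y).
Hypothesis HB : forall y, y \in N -> exists2 z, z \in N & act D B y = b *: z.
Hypothesis Fsat : forall x, b *: x \in F -> x \in F.
Hypothesis f_add : forall x y, x \in F -> y \in F -> f (x + y) = f x + f y.
Hypothesis f_cst : forall c x, x \in F -> f (til_cst c *: x) = (fun n => c * f x n).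
Hypothesis f_b : forall x, x \in F -> f (b *: x) = shift (f x).
Hypothesis f_a : forall x n, x \in F -> f (a *: x) n.+1 = (ratr la + n%:R) * f x n.

Let ii : injective iota. Proof. by case: loc. Qed.

(** N has finite rank, so the sum of the exponents that clear the denominators of a basis serves for
    all of N. *)
Lemma bounded_denominators K : exists n0, (K <= n0)%N /\
  forall y, y \in N -> exists x, iota x = b ^+ n0 *: y.
Proof.
have [[r [e He]] _ _] := Npole; have [_ _ den] := loc.
have [n Hn] := choice (fun i : 'I_r => den (val (e i))).
exists (K + \sum_i n i)%N; split=> [|y yN]; first exact: leq_addr.
have [y' Ey] := submod_lift yN; have [S [ES _]] := He y'.
have {ES Ey} -> : y = \sum_i til_ser (S i) *: val (e i).
  by rewrite -Ey ES raddf_sum; apply: eq_bigr => i _; exact: val_submodZ.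
have [x Hx] := choice Hn.
exists (\sum_i til_ser (S i) *: (b ^+ (K + \sum_i n i - n i) *: x i)).
rewrite linear_sum scaler_sumr; apply: eq_bigr => i _.
rewrite !linearZ /= -Hx !scalerA til_bexp_ser -mulrA -exprD subnK //.
by rewrite (leq_trans _ (leq_addl _ _)) // (bigD1 i) //= leq_addr.
Qed.

(** The map f takes F to a copy of E_la. Among the elements of b^n0 N lying in F, let m be the least
    index of a nonzero coefficient of f. On that coefficient D acts as the scalar - (la + m - n0),
    because b^n0 a = (a - n0 b) b^n0. But B(D) maps N into b N, where the coefficient m is zero by
    minimality, so the scalar is a root of B. The inequality is minimality of m compared with the
    given y. *)
Theorem root_of_valuation (y : L) (x : E) (n v : nat) : y \in N -> x \in F ->
  b ^+ n *: y = iota x -> f x v != 0 ->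
  exists m n0, (m + n <= v + n0)%N /\ root B (- ratr (la + m%:R - n0%:R)).
Proof.
move=> yN xF Ey fxv; have [n0 [n_n0 Hn0]] := bounded_denominators n.
pose good m := `[< exists y x, [/\ y \in N, x \in F, iota x = b ^+ n0 *: y & f x m != 0] >].
have f_bexp i z j : z \in F -> f (b ^+ i *: z) (j + i)%N = f z j.
  move=> zF; elim: i => [|i IH]; first by rewrite scale1r addn0.
  by rewrite exprS -scalerA f_b ?rpredZ // addnS.
have gv : good (v + (n0 - n))%N.
  apply/asboolP; exists y, (b ^+ (n0 - n) *: x); split=> //; first exact: rpredZ.
    by rewrite linearZ /= -Ey scalerA -exprD subnK.
  by rewrite f_bexp.
have [m gm minm] := ex_minnP (ex_intro good _ gv).
exists m, n0; split.
  have := minm _ gv; rewrite -(leq_add2r n) => /leq_trans; apply.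
  by rewrite -addnA subnK.
have {minm} f0 y' x' j : y' \in N -> x' \in F -> iota x' = b ^+ n0 *: y' -> (j < m)%N -> f x' j = 0.
  move=> yN' xF' E' jm; apply/eqP/negP => /negP nz.
  have : good j by apply/asboolP; exists y', x'.
  by move=> /minm; rewrite leqNgt jm.
clear y x yN xF Ey fxv gv; move: gm => /asboolP [y [x [yN xF Ey fm]]].
pose c : C := - ratr (la + m%:R - n0%:R).
have DN z : z \in N -> D z \in N.
  move=> zN; have [_ /simple_pole_sub sp _] := Npole; have [w wN Ew] := sp _ zN.
  suff -> : D z = - w by exact: submodN.
  by apply: (loc_bexp_inj loc (n := 1)); rewrite expr1 HD Ew scalerN.
have stepD z x' : z \in N -> x' \in F -> iota x' = b ^+ n0 *: z ->
    exists x'', [/\ x'' \in F, iota x'' = b ^+ n0 *: D z & f x'' m = c * f x' m].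
  move=> zN xF' Ez; have [x'' Ex''] := Hn0 _ (DN _ zN).
  have bx : b *: x'' = til_cst (-1) *: (a *: x' + til_cst (- n0%:R) *: (b *: x')).
    apply: ii; have -> : iota (b *: x'') = b ^+ n0 *: (b *: D z) by rewrite linearZ /= Ex'' !scalerA -exprS exprSr.
    have -> : iota (til_cst (-1) *: (a *: x' + til_cst (- n0%:R) *: (b *: x'))) =
        - (a *: (b ^+ n0 *: z) + til_cst (- n0%:R) *: (b *: (b ^+ n0 *: z))).
      by rewrite [til_cst (-1)]til_cstN til_cst1 scaleN1r -Ez -!linearZ -linearD -linearN.
    rewrite HD scalerN; congr (- _).
    rewrite !scalerA -scalerDl; congr (_ *: _).
    have := lin_bexp C n0%:R n0; rewrite subrr /lin raddf0 til_cst0 mul0r subr0 => <-.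
    by rewrite mulrBl ratr_nat til_cstN !mulNr; reflexivity.
  have bxF : b *: x'' \in F by rewrite bx !(rpredZ, rpredD).
  exists x''; split=> //; first exact: Fsat.
  have := congr1 (fun g => g m.+1) (f_b (Fsat bxF)).
  rewrite /shift => <-; rewrite bx.
  rewrite f_cst ?rpredD ?rpredZ // f_add ?rpredZ // [f (til_cst _ *: _)]f_cst ?rpredZ // f_b //.
  transitivity (-1 * (f (a *: x') m.+1 + - n0%:R * f x' m)); first by [].
  by rewrite f_a // /c rmorphB rmorphD /= !ratr_nat; ring.
have iterDs i : exists x', [/\ x' \in F, iota x' = b ^+ n0 *: iter i D y & f x' m = c ^+ i * f x m].
  elim: i => [|i [x' [xF' E' f']]]; first by exists x; rewrite expr0 mul1r.
  have yiN : iter i D y \in N by elim: (i) => //= j; exact: DN.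
  have [x'' [xF'' E'' f'']] := stepD _ _ yiN xF' E'.
  by exists x''; split=> //; rewrite f'' f' mulrA exprS.
have [x' Hx'] := choice iterDs.
have [xB [xBF EB fB]] : exists xB, [/\ xB \in F, iota xB = b ^+ n0 *: act D B y & f xB m = B.[c] * f x m].
  exists (\sum_(i < size B) til_cst B`_i *: x' i); split.
  - by apply: rpred_sum => i _; rewrite rpredZ //; case: (Hx' i).
  - rewrite linear_sum /act scaler_sumr; apply: eq_bigr => i _.
    rewrite linearZ /=; have [_ -> _] := Hx' i.
    by rewrite !scalerA til_cstC.
  - rewrite horner_coef mulr_suml.
    have : \sum_(i < size B) til_cst B`_i *: x' i \in F /\
       f (\sum_(i < size B) til_cst B`_i *: x' i) m = \sum_(i < size B) B`_i * c ^+ i * f x m.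
      elim/big_rec2: _ => [|i s z _ [zF fz]].
        split; first exact: rpred0.
        have := f_cst 0 (rpred0 F); rewrite til_cst0 scale0r => ->; exact: mul0r.
      have [xiF _ fi] := Hx' i; split; first by rewrite rpredD // rpredZ.
      rewrite f_add ?rpredZ // f_cst //; transitivity (B`_i * f (x' i) m + f z m); first by [].
      by rewrite fi fz mulrA.
    by case.
have [z zN Ez] := HB yN; have [xz Exz] := Hn0 _ zN.
have xBz : xB = b *: xz.
  by apply: ii; rewrite EB Ez linearZ /= Exz !scalerA -exprS exprSr.
have xzF : xz \in F by apply: Fsat; rewrite -xBz.
have : f xB m = 0.
  rewrite xBz f_b // /shift; case E1: m => [//|m'].
  by apply: (f0 z) => //; rewrite E1.
by rewrite fB => /eqP; rewrite mulf_eq0 (negbTE fm) orbF.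
Qed.

End RootFromValuation.

Section WordValuation.
Variable C : numFieldType.
Local Notation A := (Atilde C).
Local Notation a := (til_a C).
Local Notation b := (til_b C).
Local Notation letter := (rat * fps C)%type.
Implicit Types (E : lmodType A) (l : seq letter).

Lemma rem_b rho (w : Ahat C) : rem rho (hat_b C * w) = shift (rem rho w).
Proof.
apply: (@remP _ _ _ (hat_b C * quo rho w)).
by rewrite -hat_b_ser -mulrA -mulrDr -divE.
Qed.

Lemma rem_a rho (w : Ahat C) n : rem rho (hat_a C * w) n.+1 = (rho + n%:R) * rem rho w n.
Proof.
have -> : rem rho (hat_a C * w) = euler (rem rho w) + shift (fun m => rho * rem rho w m).
  apply: (@remP _ _ _ (hat_a C * quo rho w + ser_b (rem rho w))).
  have Ta T : ser_b T * hat_a C = ser_b T * hlin rho + ser_b (shift (fun m => rho * T m)).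
    have -> : ser_b (shift (fun m => rho * T m)) = ser_b T * (hat_cst rho * hat_b C).
      by rewrite mulrA mul_hat_cst -hat_b_ser hat_cst_ser /hat_b ser_bC.
    by rewrite -mulrDr subrK.
  rewrite {1}(divE rho w) mulrDr hat_a_ser Ta mulrDl -ser_bD mulrA -!addrA.
  by congr (_ + (_ + _)); exact: addrC.
transitivity (n%:R * rem rho w n + rho * rem rho w n); first by [].
by rewrite -mulrDl addrC.
Qed.

Lemma rem_cst rho c (w : Ahat C) : rem rho (hat_cst c * w) = fun n => c * rem rho w n.
Proof.
apply: (@remP _ _ _ (hat_cst c * quo rho w)).
by rewrite -hat_cst_ser -mulrA -mulrDr -divE.
Qed.

Lemma mult_linP r (u : A) : mult (lin C r) u <-> rem (ratr r) (val u) = 0.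
Proof.
rewrite rem_eq0; split=> [[v ->]|[v Ev]]; first by exists (val v).
have vq : v = quo (ratr r) (val u).
  apply: subr0_eq; apply: (@hlin_lreg _ (ratr r)); rewrite mulrBl -Ev.
  rewrite {1}(divE (ratr r) (val u)).
  by rewrite (proj2 (rem_eq0 _ _)) ?ser_b0 ?addr0 ?subrr //; exists v.
have vA : in_Atilde v by rewrite vq; apply: in_Atilde_quo; exact: valP.
by exists (exist _ v vA); apply: val_inj.
Qed.

Variables (E : lmodType A) (e : E) (l : seq letter).
Hypothesis nl : normalized l.
Hypothesis pe : pres e l.
Variable j : nat.
Hypothesis jl : (j < size l)%N.
Let x0 : letter := (0, 0).
Let la := (nth x0 l j).1.
Let F := span e (word (drop j.+1 l)).

Lemma Vj_ex : exists V, [/\ V 0%N = 1, til_ser (nth x0 l j).2 * til_ser V = 1 :> A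
  & til_ser V * til_ser (nth x0 l j).2 = 1 :> A].
Proof.
have u1 := normalized_nth x0 nl jl.
have [|V [V0 UV VU]] := @til_ser_unit C (nth x0 l j).2; first by rewrite u1 oner_eq0.
by exists V; split=> //; rewrite V0 u1 invr1.
Qed.
Let V := sval (cid Vj_ex).

(** Coordinate of the class of x in F_(j+1) / F_j, a copy of E_la. By [quot_coordE] it does not
    depend on the chosen u. *)
Definition quot_coord (x : E) : fps C :=
  rem (ratr la) (val (xget 0 [set u : A | x = (u * word (drop j.+1 l)) *: e] * til_ser V)).

Lemma mult_letter (u : A) : mult (word (drop j l)) (u * word (drop j.+1 l)) <->
  mult (lin C la) (u * til_ser V).
Proof.
have [_ UV VU] := svalP (cid Vj_ex).
rewrite (drop_nth x0 jl) -cat1s mult_cat; last exact: normalized_drop.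
exact: mult_blk.
Qed.

Lemma quot_coordE u : quot_coord ((u * word (drop j.+1 l)) *: e) = rem (ratr la) (val (u * til_ser V)).
Proof.
rewrite /quot_coord; set S := (X in xget 0 X); have Su : S u by [].
have /= := xgetPex 0 (ex_intro S u Su); set u' := xget 0 S => Eu'.
apply/subr0_eq; rewrite -remN -remD.
have -> : val (u' * til_ser V) - val (u * til_ser V) = val ((u' - u) * til_ser V).
  by rewrite mulrBl.
apply/mult_linP/mult_letter; rewrite mulrBl.
have : mult (word l) (u' * word (drop j.+1 l) - u * word (drop j.+1 l)).
  by apply/pe.2; rewrite scalerBl -Eu' subrr.
move=> [v ->]; exists (v * word (take j l)).
by rewrite -mulrA -word_cat cat_take_drop.
Qed.

Lemma quot_coord0 x : x \in F -> quot_coord x = 0 -> x \in span e (word (drop j l)).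
Proof.
move=> /spanP [u ->]; rewrite quot_coordE => /mult_linP /mult_letter [v ->].
by apply/spanP; exists v.
Qed.

Lemma quot_coord_add x y : x \in F -> y \in F -> quot_coord (x + y) = quot_coord x + quot_coord y.
Proof.
move=> /spanP [u ->] /spanP [v ->].
by rewrite -scalerDl -mulrDl !quot_coordE -remD mulrDl.
Qed.

Lemma quot_coord_cst c x : x \in F -> quot_coord (til_cst c *: x) = (fun n => c * quot_coord x n).
Proof.
move=> /spanP [u ->]; rewrite scalerA mulrA !quot_coordE -rem_cst.
by rewrite -mulrA.
Qed.

Lemma quot_coord_b x : x \in F -> quot_coord (b *: x) = shift (quot_coord x).
Proof. by move=> /spanP [u ->]; rewrite scalerA mulrA !quot_coordE -rem_b -mulrA. Qed.

Lemma quot_coord_a x n : x \in F ->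
  quot_coord (a *: x) n.+1 = (ratr la + n%:R) * quot_coord x n.
Proof. by move=> /spanP [u ->]; rewrite scalerA mulrA !quot_coordE -rem_a -mulrA. Qed.

(** The quotient by this submodule is presented by the suffix, so b acts injectively on it. *)
Lemma span_saturated i x : b *: x \in span e (word (drop i l)) -> x \in span e (word (drop i l)).
Proof.
pose N := span e (word (drop i l)) => bx.
have pq : pres (quo_class N e) (drop i l).
  apply: pres_quo; first by case: pe.
  move=> u; split=> [/spanP [v Ev]|[v ->]]; last by apply/spanP; exists v.
  have [w Ew] : mult (word l) (u - v * word (drop i l)).
    by apply/pe.2; rewrite scalerBl Ev subrr.
  exists (v + w * word (take i l)); rewrite mulrDl -mulrA -word_cat cat_take_drop -Ew.
  by rewrite addrC subrK.
apply/(quo_class_eq0 N); apply: (pres_b_inj (normalized_drop i nl) pq).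
by rewrite quo_classZ; apply/quo_class_eq0.
Qed.

Lemma quot_coord_gen : quot_coord (word (drop j.+1 l) *: e) 0%N != 0.
Proof.
have [V0 _ _] := svalP (cid Vj_ex).
rewrite -[word _]mul1r quot_coordE mul1r rem_ser /V.
by rewrite V0 oner_eq0.
Qed.

(** B may come from any witness of [is_bernstein], so the valuation argument is applied to F_(j+1) /
    F_j instead of comparing B with [bernstein_word]. The inequality comes from the fact that a
    simple pole module containing E contains b^-(k-j-1) times the vector of the suffix after letter
    j; it is what gives positivity in [frescosP]. *)
Lemma bernstein_root B : is_bernstein E B ->
  exists m n0, (m + (size l - j.+1) <= n0)%N /\ root B (- ratr (la + m%:R - n0%:R)).
Proof.
move=> [L [iota [N [D [loc [Npole _] HD _ HB]]]]].
have H i : (i < size l)%N ->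
    exists2 y, y \in N & b ^+ i *: y = iota (word (drop (size l - i) l) *: e).
  have [_ /simple_pole_sub sp iN] := Npole.
  elim: i => [|i IH] il; first by exists (iota e); [exact: iN|rewrite subn0 drop_size word0 !scale1r].
  have [y yN Ey] := IH (ltnW il); set j' := (size l - i.+1)%N.
  have j'l : (j' < size l)%N by rewrite ltn_subrL /= (leq_trans _ il).
  have Ej : (size l - i = j'.+1)%N by rewrite /j' subnSK // ltnW.
  pose U : A := til_ser (nth x0 l j').2.
  have UyN : U *: y \in N by rewrite rpredZ.
  have [w wN Ew] := sp _ UyN.
  exists (w - til_cst (ratr ((nth x0 l j').1 - i%:R)) *: (U *: y)).
    by rewrite submodB // !rpredZ.
  rewrite (drop_nth x0 j'l) word_cons /blk -/U -scalerA [in RHS]linearZ /= -Ej -Ey exprSr -scalerA.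
  rewrite [in RHS]scalerA -[_ * U * _]mulrA -til_bexp_ser mulrA lin_bexp -[_ * _ * U]mulrA -[in RHS]scalerA.
  congr (_ *: _); rewrite -scalerA /lin scalerBl Ew scalerBr; congr (_ - _).
  by rewrite til_cstC -!scalerA.
have [|y yN Ey] := H (size l - j.+1)%N; first by rewrite ltn_subrL /= (leq_trans _ jl).
rewrite subKn // in Ey.
have [||m [n0 [mn rt]]] := @root_of_valuation C E L iota N D B F quot_coord la loc Npole HD
   _ (@span_saturated j.+1) quot_coord_add quot_coord_cst quot_coord_b quot_coord_a y
   (word (drop j.+1 l) *: e) (size l - j.+1) 0 yN _ Ey quot_coord_gen.
- move=> y' yN'; exact: (proj2 (HB B) (dvdpp B)).
- by apply/spanP; exists 1; rewrite mul1r.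
by exists m, n0; rewrite add0n in mn.
Qed.

End WordValuation.

(** Take the least index j + 1 with F' contained in F_(j+1). Then j >= d, F' has a nonzero image in
    F_(j+1) / F_j, and the coordinate of that quotient, restricted to F', meets the hypotheses of
    [root_of_valuation]. *)
Lemma submod_root (C : numFieldType) (E : lmodType (Atilde C)) (e : E)
    (l : seq (rat * fps C)) d (F' : submodClosed E) B :
  normalized l -> pres e l -> (d <= size l)%N -> is_bernstein (submod F') B ->
  ~ {subset F' <= span e (word (drop d l))} ->
  exists j m n0, (d <= j < size l)%N /\
    root B (- ratr ((nth (0, 0) l j).1 + m%:R - n0%:R)).
Proof.
move=> nl pe dl [L [iota [N [D [loc [Npole _] HD _ HB]]]]] nsub.
pose sub j := `[< {subset F' <= span e (word (drop j l))} >].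
have sl : sub (size l).
  apply/asboolP => x _; have [u ->] := pe.1 x; apply/spanP; exists u.
  by rewrite drop_size word0 mulr1.
have [j sj minj] := ex_minnP (ex_intro sub _ sl).
have dj : (d < j)%N.
  rewrite ltnNge; apply/negP => jd; apply: nsub => x xF.
  have /asboolP /(_ _ xF) /spanP [u ->] := sj; apply/spanP.
  have E1 : drop j l = take (d - j) (drop j l) ++ drop d l by exact: drop_take_cat.
  by exists (u * word (take (d - j) (drop j l))); rewrite -mulrA -word_cat -E1.
case: j sj minj dj => // j sj minj dj.
have jl : (j < size l)%N by apply: (minj (size l)).
have [x [xF nx]] : exists x, x \in F' /\ x \notin span e (word (drop j l)).
  have : ~~ sub j by apply/negP => /minj; rewrite ltnn.
  move=> /asboolPn H; apply: contrapT => H'; apply: H => x xF.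
  by apply: contrapT => nx; apply: H'; exists x; split=> //; exact/negP.
have inF y : y \in F' -> y \in span e (word (drop j.+1 l)) by move: sj => /asboolP; apply.
pose f (y : submod F') := quot_coord e nl jl (val y).
have fx : f (exist (fun z : E => z \in F') x xF) <> 0.
  by move=> f0; move/negP: nx; apply; apply: (quot_coord0 pe (inF _ xF)) f0.
have [v fv] : exists v, f (exist (fun z : E => z \in F') x xF) v != 0.
  apply: contrapT => H; apply: fx; apply/funext => v; apply: contrapT => fv.
  by apply: H; exists v; exact/eqP.
pose FF := trace F' (span e (word (drop j.+1 l))).
have inFF y : y \in FF := inF _ (valP y).
have [||y z _ _|c y _|y _|y n _|||m [n0 [_ rt]]] := @root_of_valuation C _ L iota N D B FF f
   (nth (0, 0) l j).1 loc Npole HD _ _ _ _ _ _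
   (iota (exist (fun z : E => z \in F') x xF)) _ 0 v _ (inFF _) _ fv.
- by move=> y yN; exact: (proj2 (HB B) (dvdpp B)).
- by [].
- rewrite /f val_submodD.
  refine (@quot_coord_add C E e l nl pe j jl (val y) (val z) (inF _ (valP y)) (inF _ (valP z))).
- rewrite /f val_submodZ.
  refine (@quot_coord_cst C E e l nl pe j jl c (val y) (inF _ (valP y))).
- rewrite /f val_submodZ.
  refine (@quot_coord_b C E e l nl pe j jl (val y) (inF _ (valP y))).
- rewrite /f val_submodZ.
  refine (@quot_coord_a C E e l nl pe j jl (val y) n (inF _ (valP y))).
- by have [_ _] := Npole; apply.
- by rewrite expr0 scale1r.
by exists j, m, n0; split=> //; rewrite jl andbT -ltnS.
Qed.

(** * Principal Jordan-Hoelder sequence *)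

Section Order.
Variable le : rel QZ.
Hypothesis le_tot : total_order le.

Lemma qz_classP' x y : qz_class x = qz_class y <-> x - y \is a Num.int.
Proof. by rewrite -qz_classP; split=> [->//|/eqP]. Qed.

Lemma qz_class_int x (n : rat) : n \is a Num.int -> qz_class (x + n) = qz_class x.
Proof. by move=> ni; apply/qz_classP'; rewrite addrC addKr. Qed.

Lemma qz_class_nat x (n : nat) : qz_class (x + n%:R) = qz_class x.
Proof. by apply: qz_class_int; rewrite intr_nat. Qed.

Lemma qz_class_subnat x (n : nat) : qz_class (x - n%:R) = qz_class x.
Proof. by apply: qz_class_int; rewrite rpredN intr_nat. Qed.

Definition ple : rel rat := fun x y =>
  if qz_class x == qz_class y then x <= y else le (qz_class x) (qz_class y).

Lemma ple_class x y : ple x y -> le (qz_class x) (qz_class y).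
Proof. by case: le_tot => r _ _ _; rewrite /ple; case: eqP => // ->. Qed.

Lemma ple_anti : antisymmetric ple.
Proof.
case: le_tot => _ anti _ _ x y; rewrite /ple [qz_class y == _]eq_sym.
case: eqP => [_|ne]; first by move=> xy; apply/le_anti.
by move=> /anti.
Qed.

Lemma ple_trans : transitive ple.
Proof.
case: le_tot => r anti tr _ y x z xy yz; rewrite /ple.
have lxz : le (qz_class x) (qz_class z) by apply: tr (ple_class xy) (ple_class yz).
case: eqP => // Exz; move: xy yz; rewrite /ple.
case: eqP => [Exy|ne]; first by rewrite -Exy Exz eqxx; exact: le_trans.
move=> lxy; case: eqP => [Eyz|_ lyz]; first by case: ne; rewrite Exz Eyz.
by case: ne; apply: anti; rewrite lxy Exz lyz.
Qed.

(** Indices start at 0 here and at 1 in [is_principal_primitive_JH]; the common shift does not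
    affect comparisons. *)
Definition keys (s : seq rat) : seq rat := mkseq (fun i => nth 0 s i + i%:R) (size s).

Definition principal_order (s : seq rat) := pairwise ple (keys s).

Lemma size_keys s : size (keys s) = size s. Proof. exact: size_mkseq. Qed.

Lemma principal_orderP s : reflect (forall i j, (i < j)%N -> (j < size s)%N ->
  ple (nth 0 s i + i%:R) (nth 0 s j + j%:R)) (principal_order s).
Proof.
apply: (iffP (pairwiseP 0)); rewrite size_keys => H i j.
  move=> ij jl; have il := ltn_trans ij jl.
  by have := H i j il jl ij; rewrite !nth_mkseq.
by move=> il jl ij; rewrite !nth_mkseq //; exact: H.
Qed.

Lemma keys_inj s t : keys s = keys t -> s = t.
Proof.
move=> E; have sz : size s = size t by rewrite -size_keys E size_keys.
apply: (@eq_from_nth _ 0) => // i il.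
have := congr1 (fun u => nth 0 u i) E; rewrite !nth_mkseq -?sz //.
exact: addIr.
Qed.

Lemma principal_order_uniq s t : principal_order s -> principal_order t ->
  perm_eq (keys s) (keys t) -> s = t.
Proof.
move=> Hs Ht /(sorted_eq ple_trans ple_anti); rewrite /principal_order in Hs Ht.
by move=> H; apply: keys_inj; apply: H; apply: pairwise_sorted.
Qed.

Lemma principal_order_class s i j : principal_order s -> (i < j)%N -> (j < size s)%N ->
  le (qz_class (nth 0 s i)) (qz_class (nth 0 s j)).
Proof.
move=> /principal_orderP H ij jl; have := ple_class (H _ _ ij jl).
by rewrite !qz_class_nat.
Qed.

Lemma principal_order_le s i j : principal_order s -> (i < j)%N -> (j < size s)%N ->
  qz_class (nth 0 s i) = qz_class (nth 0 s j) -> nth 0 s i + i%:R <= nth 0 s j + j%:R.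
Proof.
move=> /principal_orderP H ij jl E; have := H _ _ ij jl.
by rewrite /ple !qz_class_nat E eqxx.
Qed.

End Order.

(** * Sorted words give principal sequences *)

Section Construction.
Variable C : numFieldType.
Local Notation A := (Atilde C).
Local Notation letter := (rat * fps C)%type.
Implicit Types (E : lmodType A) (l : seq letter).
Variable le : rel QZ.
Hypothesis le_tot : total_order le.

Lemma primitive_word (Lam : set QZ) E (e : E) l : normalized l -> pres e l ->
  (forall i, (i < size l)%N -> Lam (qz_class (nth (0, 0) l i).1)) -> primitive Lam E.
Proof.
move=> nl pe H; split; first exact: (pres_regular nl pe).
exists (bernstein_word l); split; first exact: (pres_bernstein nl pe).
move=> r /root_bernstein_word [i il ->]; exists (mu_ l i); last by rewrite opprK.
by rewrite /mu_ qz_class_subnat; exact: H.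
Qed.

(** By [bernstein_root], any Bernstein polynomial has a root that differs from - lambda_i by an
    integer. *)
Lemma primitive_entry (Lam : set QZ) E (e : E) l i : normalized l -> pres e l ->
  primitive Lam E -> (i < size l)%N -> Lam (qz_class (nth (0, 0) l i).1).
Proof.
move=> nl pe [_ [B [HB rB]]] il; have [m [n0 [_ rt]]] := bernstein_root nl pe il HB.
have [q Lq] := rB _ rt; rewrite opprK => /(fmorph_inj (ratr : {rmorphism rat -> C})) Eq.
by rewrite -(qz_class_nat _ m) -(qz_class_subnat _ n0) Eq.
Qed.

Lemma primitive_submod_span (Lam : set QZ) E (e : E) l d (F' : submodClosed E) :
  normalized l -> pres e l -> (d <= size l)%N -> primitive Lam (submod F') ->
  (forall i, (d <= i < size l)%N -> ~ Lam (qz_class (nth (0, 0) l i).1)) ->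
  {subset F' <= span e (word (drop d l))}.
Proof.
move=> nl pe dl [_ [B [HB rB]]] H; apply: contrapT => nsub.
have [j [m [n0 [djl rt]]]] := submod_root nl pe dl HB nsub.
have [q Lq] := rB _ rt; rewrite opprK => /(fmorph_inj (ratr : {rmorphism rat -> C})) Eq.
apply: (H j djl); move: Lq.
by rewrite -Eq qz_class_subnat qz_class_nat.
Qed.

Lemma flags_subquo E (e : E) l (F : nat -> submodClosed E) (d d' : nat) :
  normalized l -> pres e l -> flags e l F -> (d <= d' <= size l)%N ->
  exists f : subquo (F d') (F d), let m := take (d' - d) (drop d l) in
    [/\ pres f m, (forall y, (y \in induced (F d') (F d) (F (d + 0)%N)) = (y == 0))
      & flags f m (fun j => induced (F d') (F d) (F (d + j)%N))].
Proof.
move=> nl pe HF /andP [dd' d'l]; have dl := leq_trans dd' d'l.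
have nd : normalized (drop d' l) by exact: normalized_drop.
have [||u|u|f [Ef pf]] := @pres_subquo C E e (F d') (F d) (take (d' - d) (drop d l)) (drop d' l).
- exact: nd.
- exact: pe.1.
- exact: HF.
- by rewrite -drop_take_cat //; exact: HF.
have szm : size (take (d' - d) (drop d l)) = (d' - d)%N.
  by rewrite size_takel // size_drop leq_sub2r.
have sub j : (j <= d' - d)%N -> {subset F d <= F (d + j)%N}.
  move=> jd y; have [u ->] := pe.1 y => /(HF _ dl) [v ->]; apply/HF.
    by rewrite (leq_trans _ d'l) // -(subnKC dd') leq_add2l.
  by rewrite (drop_take_cat _ (leq_addr j d)) word_cat mulrA; eexists.
have indP j u : (j <= d' - d)%N -> u *: quo_class (trace (F d') (F d)) f \in
    induced (F d') (F d) (F (d + j)%N) <-> u *: val f \in F (d + j)%N.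
  move=> jd; split=> [/asboolP [x [xF]]|uF].
    rewrite quo_classZ => /eqP; rewrite quo_classP => xf.
    have {}xf : u *: val f - val x \in F d.
      by move: xf; rewrite [_ \in _]/(val _ \in F d) val_submodB val_submodZ.
    by rewrite -[u *: val f](subrK (val x)) rpredD // (sub _ jd).
  by apply/asboolP; exists (u *: f); rewrite val_submodZ quo_classZ.
exists (quo_class _ f); split=> //.
- move=> y; have [u ->] := pf.1 y; apply/idP/eqP.
    move=> /(indP _ _ (leq0n _)); rewrite addn0 => H.
    by rewrite quo_classZ; apply/quo_class_eq0; rewrite [_ \in _]/(val _ \in F d) val_submodZ.
  move=> ->; exact: rpred0.
- move=> j; rewrite szm => jd u; rewrite indP // Ef scalerA HF; last first.
    by rewrite (leq_trans _ d'l) // -(subnKC dd') leq_add2l.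
  have djd' : (d + j <= d')%N by rewrite -(subnKC dd') leq_add2l.
  rewrite (drop_take_cat _ djd') mult_cat // subnDA.
  suff -> : take (d' - d - j) (drop (d + j) l) = drop j (take (d' - d) (drop d l)) by [].
  by rewrite -{2}(subnK jd) -take_drop drop_drop addnC.
Qed.

(** The mu_h are the classes of the word without repetition, and G_h is the flag just before the
    first letter whose class is not among the first h. Since the word is sorted, no later letter has
    one of these classes, so [primitive_submod_span] makes G_h maximal. *)
Theorem word_principal E (e : E) l (F : nat -> submodClosed E) :
  normalized l -> pres e l -> flags e l F -> (forall y, (y \in F 0%N) = (y == 0)) ->
  principal_order le (map fst l) -> is_principal_JH le (map fst l) F.
Proof.
move=> nl pe HF F0 so; split; first exact: (flags_JH nl pe.1 F0 HF).
case: (le_tot) => lr lanti ltr _.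
pose s := map fst l; pose cs := map qz_class s; pose mu := undup cs.
have sz : size s = size l by rewrite size_map.
have nths i : (nth (0, 0) l i).1 = nth 0 s i.
  have [il|il] := ltnP i (size l); first by rewrite (nth_map (0, 0)).
  by rewrite !nth_default ?sz.
have pmu : pairwise (fun x y => le x y && (x != y)) mu.
  have -> : pairwise (fun x y => le x y && (x != y)) mu = pairwise le mu && uniq mu.
    by rewrite uniq_pairwise pairwise_relI.
  rewrite undup_uniq andbT; apply: (subseq_pairwise (undup_subseq _)).
  apply/(pairwiseP (qz_class 0)) => i j; rewrite size_map => il jl ij; rewrite !inE in il jl.
  rewrite /cs (nth_map 0 _ _ il) (nth_map 0 _ _ jl); exact: (principal_order_class le_tot so ij jl).
pose d h := find (fun q => qz_class q \notin take h mu) s.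
have dsz h : (d h <= size s)%N by exact: find_size.
have d_in h i : (i < d h)%N -> qz_class (nth 0 s i) \in take h mu.
  by move=> /(before_find 0) /negbT; rewrite negbK.
have d_out h i : (d h <= i < size s)%N -> qz_class (nth 0 s i) \notin take h mu.
  move=> /andP [di il]; have dl := leq_ltn_trans di il.
  have nd : qz_class (nth 0 s (d h)) \notin take h mu.
    by apply: (nth_find 0 (a := fun q => qz_class q \notin take h mu)); rewrite has_find.
  move: di; rewrite leq_eqVlt => /orP [/eqP <- //|di]; apply/negP => ci.
  have dmu : qz_class (nth 0 s (d h)) \in drop h mu.
    have : qz_class (nth 0 s (d h)) \in mu by rewrite mem_undup map_f // mem_nth.
    by rewrite -{1}(cat_take_drop h mu) mem_cat (negbTE nd).
  move: pmu; rewrite -(cat_take_drop h mu) pairwise_cat => /andP [/allrelP H _].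
  have /andP [le1 /eqP ne] := H _ _ ci dmu.
  by apply: ne; apply: lanti; rewrite le1 (principal_order_class le_tot so di il).
have Fspan h : F (d h) =i span e (word (drop (d h) l)).
  move=> y; have [u ->] := pe.1 y; apply/idP/idP.
    by move=> /HF; rewrite -sz => /(_ (dsz h)) [v ->]; apply/spanP; exists v.
  move=> /spanP [v ->]; apply/HF; first by rewrite -sz.
  by exists v.
have memG h u : u *: e \in F (d h) <-> mult (word (drop (d h) l)) u by apply: HF; rewrite -sz.
have cat_d h : l = take (d h) l ++ drop (d h) l by rewrite cat_take_drop.
exists (bernstein_word l), mu, (fun h => F (d h)), d; split.
- exact: (pres_bernstein nl pe).
- split; first exact: pairwise_sorted.
  move=> c; rewrite mem_undup; split=> [/mapP [q qs ->]|[q <- /root_bernstein_word [i il]]].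
    have [i il Ei] := nthP 0 qs; rewrite sz in il.
    exists (mu_ l i); last exact: bernstein_word_root.
    by rewrite /mu_ qz_class_subnat nths Ei.
  move=> /oppr_inj /(fmorph_inj (ratr : {rmorphism rat -> C})) ->.
  by rewrite /mu_ qz_class_subnat nths map_f // mem_nth // sz.
- move=> h hmu; split.
    have [|||f [_ pf]] := @pres_sub C E e (F (d h)) (take (d h) l) (drop (d h) l).
    + exact: normalized_drop.
    + by rewrite -cat_d.
    + exact: memG.
    apply: (primitive_word (normalized_take _ nl) pf) => i; rewrite size_takel -?sz // => id.
    by rewrite nth_take // nths; exact: d_in.
  move=> F' HF' y yF'; rewrite Fspan.
  apply: (primitive_submod_span nl pe _ HF') => //; first by rewrite -sz.
  move=> i; rewrite -sz nths => /d_out /negP; exact.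
- by move=> h hmu; split=> //; exact: dsz.
- move=> h hmu.
  have dd : (d h <= d h.+1)%N.
    rewrite leqNgt; apply/negP => lt; have := d_in h _ lt.
    have nd : (d h.+1 <= d h.+1 < size s)%N by rewrite leqnn (leq_trans lt (dsz h)).
    have := d_out _ _ nd => /negP H1 H2; apply: H1.
    by rewrite (take_nth (qz_class 0)) // mem_rcons in_cons H2 orbT.
  have ddl : (d h <= d h.+1 <= size l)%N by rewrite dd -sz dsz.
  have [f [pf f0 ff]] := flags_subquo nl pe HF ddl.
  have Em : drop (d h) (take (d h.+1) s) = map fst (take (d h.+1 - d h) (drop (d h) l)).
    by rewrite map_take map_drop take_drop subnK.
  rewrite Em; split.
    apply: (flags_JH _ pf.1 f0 ff).
    by apply: normalized_take; exact: normalized_drop.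
  move=> j; rewrite -Em size_drop size_takel ?dsz // => /andP [j1 jd].
  have jd' : (d h + j < d h.+1)%N by rewrite -ltn_subRL.
  have nthE i : (i <= j)%N -> nth 0 (drop (d h) (take (d h.+1) s)) i = nth 0 s (d h + i)%N.
    by move=> ij; rewrite nth_drop nth_take // (leq_ltn_trans _ jd') // leq_add2l.
  rewrite /ent /= !nthE ?leq_pred //.
  have lt1 : (d h + j.-1 < d h + j)%N by rewrite ltn_add2l ltn_predL.
  have cl i : (i <= j)%N -> qz_class (nth 0 s (d h + i)%N) = nth (qz_class 0) mu h.
    move=> ij; have i1 : (d h + i < d h.+1)%N by rewrite (leq_ltn_trans _ jd') // leq_add2l.
    have := d_in _ _ i1; rewrite (take_nth (qz_class 0)) // mem_rcons in_cons => /orP [/eqP //|H].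
    have : (d h <= d h + i < size s)%N by rewrite leq_addr (leq_trans i1 (dsz _)).
    by move=> /d_out; rewrite H.
  have := principal_order_le so lt1 (leq_trans jd' (dsz _)).
  have Ej : j%:R = j.-1%:R + 1 :> rat by rewrite natr1 prednK.
  by rewrite !cl ?leq_pred // => /(_ erefl); rewrite !natrD -natr1 Ej; lra.
Qed.

End Construction.

(** * Exchange of adjacent letters *)

Section Swap.
Variable C : numFieldType.
Local Notation A := (Atilde C).
Local Notation a := (til_a C).
Local Notation b := (til_b C).
Local Notation letter := (rat * fps C)%type.
Implicit Types (T U V W X Y G : fps C) (l m : seq letter).

(** For n > 0 the equation b G' = G Y gives n G_n in terms of lower coefficients; at n = 0 it reads
    0 = 0, so that G(0) = 1 may be imposed. *)
Lemma theta_solve Y : Y 0%N = 0 -> exists G, G 0%N = 1 /\ theta_op G = cmul G Y.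
Proof.
move=> Y0; have [|G HG] := @fps_fixpoint C (fun G n =>
    if n == 0%N then 1 else n%:R^-1 * \sum_(i < n) G i * Y (n - i)%N).
  move=> S T n ST; case: eqP => // _; congr (_ * _); apply: eq_bigr => i _; by rewrite ST.
exists G; split; first by rewrite HG.
apply/funext => n; rewrite /theta_op /cmul big_ord_recr /= subnn Y0 mulr0 addr0.
case: n => [|n]; first by rewrite big_ord0 mul0r.
by rewrite [G n.+1 in LHS]HG /= mulrA divff ?mul1r // pnatr_eq0.
Qed.

Lemma lin_ser r T : lin C r * til_ser T =
  til_ser T * a + b * (til_ser (theta_op T) - til_cst (ratr r) * til_ser T).
Proof.
rewrite /lin mulrBl til_a_ser -addrA; congr (_ + _).
by rewrite mulrBr mulrA til_cstC.
Qed.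

Lemma til_b_comm T : b * til_ser T = til_ser T * b.
Proof. by have := til_bexp_ser 1 T; rewrite expr1. Qed.

Lemma swap_lin (r s : rat) U : U 0%N != 0 -> r - s \isn't a Num.int ->
  exists X W V, [/\ X 0%N != 0, W 0%N != 0, V 0%N != 0 &
    til_ser X * lin C r * til_ser U * lin C s =
    lin C (s + 1) * til_ser W * lin C (r - 1) * til_ser V].
Proof.
move=> U0 rs; have [Ui [Ui0 UUi UiU]] := til_ser_unit U0.
pose c : C := ratr (r - s - 1).
have cn n : n%:R + c != 0.
  have -> : n%:R + c = ratr (n%:R + (r - s - 1)) by rewrite rmorphD /= ratr_nat.
  rewrite fmorph_eq0; apply: contra rs => /eqP E.
  have -> : r - s = 1 - n%:R by apply/eqP; rewrite -subr_eq0; apply/eqP; rewrite -[RHS]E; ring.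
  by rewrite rpredB ?rpred1 // intr_nat.
pose X : fps C := fun n => - Ui n / (n%:R + c).
have c0 : c != 0 by have := cn 0%N; rewrite add0r.
have X0 : X 0%N != 0 by rewrite /X mulf_neq0 ?oppr_eq0 ?invr_eq0 // Ui0 invr_eq0.
have EX : til_ser (theta_op X) + til_cst c * til_ser X = - til_ser Ui :> A.
  have -> : til_cst c * til_ser X = til_ser (fun n => c * X n).
    by apply: val_inj; rewrite [LHS]hat_cst_ser.
  rewrite til_serD til_serN; congr til_ser; apply/funext => n.
  transitivity (n%:R * X n + c * X n); first by [].
  by rewrite -mulrDl /X mulrC divfK.
have XUr : til_ser X * lin C r * til_ser U = lin C (s + 1) * til_ser X * til_ser U + b.
  have -> : til_ser X * lin C r = lin C (s + 1) * til_ser X + b * til_ser Ui.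
    rewrite lin_ser -[til_ser Ui]opprK -EX /lin mulrBr -addrA; congr (_ + _).
    rewrite -mulrDr.
    have -> : til_ser X * (til_cst (ratr r) * b) = b * (til_cst (ratr r) * til_ser X).
      by rewrite mulrA -til_cstC -mulrA -til_b_comm !mulrA til_cstC.
    rewrite -mulrN; congr (b * _).
    rewrite opprD addrACA subrr add0r -opprD -mulrDl -til_cstD.
    by congr (- (til_cst _ * _)); rewrite /c -rmorphD; congr ratr; ring.
  by rewrite mulrDl -[b * _ * _]mulrA UiU mulr1.
have XU0 : cmul X U 0%N = X 0%N * U 0%N by rewrite /cmul big_ord1.
have XU0n : cmul X U 0%N != 0 by rewrite XU0 mulf_neq0.
have [Z [Z0 XUZ ZXU]] := til_ser_unit XU0n.
have Z0E : Z 0%N = - c.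
  rewrite Z0 XU0 /X add0r Ui0.
  by rewrite mulrAC mulNr mulVf // mulN1r invrN invrK.
pose Y : fps C := fun n => (if n == 0%N then Z 0%N else 0) - Z n.
have [|G [G0 EG]] := @theta_solve Y; first by rewrite /Y /= subrr.
have G0n : G 0%N != 0 by rewrite G0 oner_eq0.
have [Gi [Gi0 GGi GiG]] := til_ser_unit G0n.
have EY : til_ser Y = til_cst (Z 0%N) - til_ser Z :> A by rewrite til_serN til_serD.
have linG : (lin C s + til_ser Z * b) * til_ser G = til_ser G * lin C (r - 1).
  rewrite mulrDl lin_ser EG -til_serM EY -addrA /lin [RHS]mulrBr; congr (_ + _).
  have -> : til_ser G * (til_cst (ratr (r - 1)) * b) = b * (til_cst (ratr (r - 1)) * til_ser G).
    by rewrite mulrA -til_cstC -mulrA -til_b_comm !mulrA til_cstC.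
  have -> : til_ser Z * b * til_ser G = b * (til_ser Z * til_ser G).
    by rewrite -til_b_comm mulrA.
  rewrite -mulrDr -[RHS]mulrN; congr (b * _); rewrite mulrBr [til_ser G * til_ser Z]til_serC.
  rewrite [X in X + _]addrAC subrK -til_cstC -mulrBl -til_cstN -til_cstD -[RHS]mulNr -til_cstN.
  congr (til_cst _ * _); rewrite Z0E /c -opprD -rmorphD; congr (- ratr _); ring.
exists X, (cmul (cmul X U) G), Gi; split=> //.
- by rewrite /cmul big_ord1 mulf_neq0.
- by rewrite Gi0 invr_eq0.
rewrite XUr mulrDl.
have -> : b * lin C s = lin C (s + 1) * b.
  by have := lin_bexp C (s + 1) 1; rewrite !expr1 addrK => ->.
rewrite -!mulrA -mulrDr; congr (_ * _).
have -> : til_ser X * (til_ser U * lin C s) + b = til_ser (cmul X U) * (lin C s + til_ser Z * b).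
  by rewrite [RHS]mulrDr [til_ser (cmul X U) * (til_ser Z * b)]mulrA XUZ mul1r mulrA til_serM.
rewrite -(til_serM (cmul X U) G) -mulrA; congr (_ * _).
by rewrite [RHS]mulrA -linG -mulrA GGi mulr1.
Qed.

(** Such u and v generate the same left ideal ([mult_unit_equiv]), hence present the same module. *)
Definition unit_equiv (u v : A) := exists T, T 0%N != 0 /\ u = til_ser T * v.

Lemma mult_unit_equiv (u v w : A) : unit_equiv u v -> mult u w <-> mult v w.
Proof.
move=> [T [T0 ->]]; have [V [_ TV VT]] := til_ser_unit T0; split=> -[z ->].
  by exists (z * til_ser T); rewrite mulrA.
by exists (z * til_ser V); rewrite mulrA -[z * _ * _]mulrA VT mulr1.
Qed.

Lemma unit_equiv_trans (u v w : A) : unit_equiv u v -> unit_equiv v w -> unit_equiv u w.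
Proof.
move=> [T [T0 ->]] [S [S0 ->]]; exists (cmul T S); split; last by rewrite -til_serM mulrA.
by rewrite /cmul big_ord1 mulf_neq0.
Qed.

Lemma unit_equivMr (u v w : A) : unit_equiv u v -> unit_equiv (u * w) (v * w).
Proof. by move=> [T [T0 ->]]; exists T; rewrite mulrA. Qed.

Lemma unit_equiv_cst c (u v : A) : c != 0 -> u = til_cst c * v -> unit_equiv u v.
Proof. by move=> c0 ->; exists (fun n => if n == 0%N then c else 0). Qed.

Lemma normalize_blk r U : U 0%N != 0 -> exists V, V 0%N = 1 /\
  lin C r * til_ser U = til_cst (U 0%N) * blk (r, V).
Proof.
move=> U0; exists (fun n => (U 0%N)^-1 * U n); split; first by rewrite mulVf.
rewrite /blk /= til_cstC -mulrA; congr (_ * _); rewrite -til_cstC.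
apply: val_inj; rewrite [RHS]hat_cst_ser; congr ser_b; apply/funext => n.
by rewrite mulrA divff // mul1r.
Qed.

Lemma word_rcons l x : word (rcons l x) = word l * blk x.
Proof. by rewrite -cats1 word_cat word1. Qed.

Lemma normalized_rcons l x : normalized (rcons l x) <-> normalized l /\ x.2 0%N = 1.
Proof. by rewrite -cats1 normalized_cat /=; tauto. Qed.

Lemma word_absorb l T : T 0%N != 0 -> normalized l ->
  exists l', [/\ normalized l', map fst l' = map fst l & unit_equiv (word l * til_ser T) (word l')].
Proof.
move=> T0; case/lastP: l => [_|l [r U]].
  by exists [::]; split=> //; exists T; rewrite word0 mul1r mulr1.
move=> /normalized_rcons [nl U1]; rewrite /= in U1.
have UT0 : cmul U T 0%N != 0 by rewrite /cmul big_ord1 U1 mul1r.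
have [V [V1 EV]] := normalize_blk r UT0; exists (rcons l (r, V)); split.
- by apply/normalized_rcons.
- by rewrite !map_rcons.
apply: (unit_equiv_cst UT0).
by rewrite !word_rcons /blk /= -!mulrA til_serM EV mulrA -til_cstC mulrA.
Qed.

Lemma swap_letters (x y : letter) : x.2 0%N = 1 -> y.2 0%N = 1 ->
  qz_class x.1 != qz_class y.1 ->
  exists V W, [/\ V 0%N = 1, W 0%N = 1 &
    unit_equiv (blk x * blk y) (blk (y.1 + 1, V) * blk (x.1 - 1, W))].
Proof.
move=> x1 y1; rewrite qz_classP => ni.
have x0 : x.2 0%N != 0 by rewrite x1 oner_eq0.
have [X [W [V [X0 W0 V0 E]]]] := swap_lin x0 ni.
have Vy0 : cmul V y.2 0%N != 0 by rewrite /cmul big_ord1 y1 mulr1.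
have [W' [W1 EW]] := normalize_blk (y.1 + 1) W0.
have [V' [V1 EV]] := normalize_blk (x.1 - 1) Vy0.
exists W', V'; split=> //.
have [Xi [Xi0 XXi XiX]] := til_ser_unit X0.
have {E} E : til_ser X * (blk x * blk y) =
    til_cst (W 0%N * cmul V y.2 0%N) * (blk (y.1 + 1, W') * blk (x.1 - 1, V')).
  have -> : til_ser X * (blk x * blk y) =
      (lin C (y.1 + 1) * til_ser W) * (lin C (x.1 - 1) * til_ser (cmul V y.2)).
    by rewrite -til_serM /blk !mulrA E.
  rewrite EW EV til_cstM; move: (blk (_, W')) (blk (_, V')) => p q.
  by rewrite -!mulrA; congr (_ * _); rewrite !mulrA til_cstC.
have c0 : W 0%N * cmul V y.2 0%N != 0 by rewrite mulf_neq0.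
apply: unit_equiv_trans (unit_equiv_cst c0 E).
exists Xi; split; first by rewrite Xi0 invr_eq0.
by rewrite mulrA XiX mul1r.
Qed.

(** First move x in front of the tail of m, then exchange it with the head, whose class differs. The
    unit produced by the first move stands right after the head and is absorbed into its series. *)
Lemma bubble (Lam : set QZ) m x : normalized (rcons m x) -> Lam (qz_class x.1) ->
  (forall i, (i < size m)%N -> ~ Lam (qz_class (nth (0, 0) m i).1)) ->
  exists y m', [/\ normalized (y :: m'), Lam (qz_class y.1) &
    unit_equiv (word (rcons m x)) (word (y :: m'))].
Proof.
elim: m => [|z m IH] /= [x1 nm] Lx Hm.
  exists x, [::]; split=> //=; exists (ser1 C); split; first by rewrite oner_eq0.
  by rewrite til_ser1 mul1r.
have [|y [m' [[y1 nm'] Ly [T [T0 ET]]]]] := IH nm Lx; first by move=> i im; exact: (Hm i.+1).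
have nz : normalized [:: z] by [].
have [[|z' [|? ?]] [//= [z1 _] [Ez] Hz]] := word_absorb T0 nz.
have ne : qz_class z'.1 != qz_class y.1.
  by apply/eqP => E; apply: (Hm 0%N isT); rewrite /= -Ez E.
have [V [W [V1 W1 Hs]]] := swap_letters z1 y1 ne.
exists (y.1 + 1, V), ((z'.1 - 1, W) :: m'); split=> //.
  by have := qz_class_nat y.1 1 => /= ->.
rewrite word_cons ET !word_cons mulrA mulrA; apply: unit_equiv_trans.
  apply: unit_equivMr; apply: unit_equivMr; move: Hz; rewrite !word1; exact.
by rewrite mulrA; apply: unit_equivMr.
Qed.

End Swap.

(** * Principal sequences come from sorted words *)

Section PrincipalAnalysis.
Variable C : numFieldType.
Local Notation A := (Atilde C).
Local Notation letter := (rat * fps C)%type.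
Implicit Types (E : lmodType A) (l : seq letter).
Variable le : rel QZ.
Hypothesis le_tot : total_order le.

(* A letter of class in Lam lying above the maximal Lam-primitive submodule could be moved
   down to produce a larger Lam-primitive submodule. *)
Lemma primitive_part_maximal (Lam : set QZ) E (e : E) l (G : submodClosed E) d :
  normalized l -> pres e l -> (d <= size l)%N ->
  (forall u, u *: e \in G <-> mult (word (drop d l)) u) -> is_primitive_part Lam G ->
  forall j, (d <= j < size l)%N -> ~ Lam (qz_class (nth (0, 0) l j).1).
Proof.
move=> nl pe dl HG [pG maxG] j0 /andP [dj0 j0l] Lj0.
pose bad j := [&& (d <= j)%N, (j < size l)%N & `[< Lam (qz_class (nth (0, 0) l j).1) >]].
have bj0 : bad j0 by rewrite /bad dj0 j0l; apply/asboolP.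
(* For the first such letter, the letters between d and j have classes outside Lam, so [bubble] can
   bring it to position d. *)
have [j /and3P [dj jl /asboolP Lj] minj] := ex_minnP (ex_intro bad _ bj0).
pose m := take (j - d) (drop d l); pose x := nth (0, 0) l j; pose l2 := drop j.+1 l.
have szm : size m = (j - d)%N by rewrite size_takel // size_drop leq_sub2r // ltnW.
have Ed : drop d l = rcons m x ++ l2.
  by rewrite cat_rcons -drop_nth // -drop_take_cat.
have nd : normalized (rcons m x ++ l2) by rewrite -Ed; exact: normalized_drop.
have [nmx nl2] := (normalized_cat _ _).1 nd.
have [|y [m' [nym' Ly [T [T0 ET]]]]] := @bubble C Lam m x nmx Lj.
  move=> i; rewrite szm => im Li.
  have := minj (d + i)%N; rewrite leqNgt -ltn_subRL im => /(_ _)/negP; apply=> //.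
  apply/and3P; split; first exact: leq_addr.
    by rewrite (leq_trans _ (ltnW jl)) // -ltn_subRL.
  by apply/asboolP; move: Li; rewrite /m nth_take // nth_drop.
have [y1 nm'] := nym'.
have nm2 : normalized (m' ++ l2) by apply/normalized_cat.
have [l1 [nl1 El1 Hl1]] := word_absorb T0 (normalized_take d nl).
have Ew : unit_equiv (word l) (word ((l1 ++ [:: y]) ++ (m' ++ l2))).
  have -> : word l = word (take d l) * til_ser T * word ([:: y] ++ m' ++ l2).
    by rewrite -{1}(cat_take_drop d l) Ed !word_cat ET -cat1s word_cat !mulrA.
  by rewrite -catA [word (l1 ++ _)]word_cat; exact: unit_equivMr.
have pe' : pres e ((l1 ++ [:: y]) ++ (m' ++ l2)).
  by split; [exact: pe.1|move=> u; rewrite pe.2; exact: mult_unit_equiv].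
pose F' := span e (word (m' ++ l2)).
have memF' u : u *: e \in F' <-> mult (word (m' ++ l2)) u.
  split=> [/spanP [v Ev]|[v ->]]; last by apply/spanP; exists v.
  have [w Ew'] : mult (word ((l1 ++ [:: y]) ++ (m' ++ l2))) (u - v * word (m' ++ l2)).
    by apply/pe'.2; rewrite scalerBl Ev subrr.
  exists (v + w * word (l1 ++ [:: y])); rewrite mulrDl -mulrA -word_cat -Ew'.
  by rewrite addrC subrK.
have [|||f [_ pf]] := @pres_sub C E e F' (l1 ++ [:: y]) (m' ++ l2).
- exact: nm2.
- exact: pe'.
- exact: memF'.
have ped : pres e (take d l ++ drop d l) by rewrite cat_take_drop.
have [f' [_ pf']] := pres_sub (normalized_drop d nl) ped HG.
have nl1y : normalized (l1 ++ [:: y]) by apply/normalized_cat.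
have szl1 : size l1 = d by rewrite -(size_map fst) El1 size_map size_takel.
have pF' : primitive Lam (submod F').
  apply: (primitive_word nl1y pf) => i; rewrite size_cat addn1 ltnS nth_cat leq_eqVlt.
  case/orP => [/eqP ->|il]; first by rewrite ltnn subnn.
  rewrite il -(nth_map _ 0) // El1 (nth_map (0, 0)); last by rewrite size_takel // -szl1.
  by apply: (primitive_entry (normalized_take d nl) pf' pG); rewrite size_takel // -szl1.
have : word (m' ++ l2) *: e \in G by apply: maxG pF' _ _; apply/memF'; exists 1; rewrite mul1r.
have Edw : word (drop d l) = til_ser T * blk y * word (m' ++ l2).
  by rewrite Ed !word_cat ET word_cons !mulrA.
move=> /HG [v]; rewrite Edw -{1}[word (m' ++ l2)]mul1r mulrA => /(word_rregI nm2).
rewrite mulrA => E1.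
(* Here 1 is a left multiple of the letter y, against the uniqueness of remainders. *)
have ny : normalized [:: y] by [].
have [|_ /(_ 0%N isT) /(congr1 (fun f => f 0%N)) /eqP] :=
    @word_uniq C [:: y] (- (v * til_ser T)) (fun=> ser1 C) ny.
  by rewrite big_ord1 /= word0 word1 til_ser1 mulr1 mulNr -E1 addNr.
by rewrite oner_eq0.
Qed.

(** The letters below d_h are exactly those whose class is among the first h: primitivity of G_h
    gives one inclusion ([A1]), its maximality the other ([A2]). Hence the classes are in order, and
    inside a block of one class the values are ordered by [is_principal_primitive_JH]. *)
Theorem principal_JH_word E (e : E) s (F : nat -> submodClosed E) :
  generates e -> is_principal_JH le s F ->
  exists l, [/\ normalized l, map fst l = s, pres e l, flags e l F & principal_order le s].
Proof.
move=> ge [JH [B [mu [G [d [HB [smu Hmu] HG HF Hprim]]]]]].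
have [l [nl El pe ff]] := JH_flags ge JH; exists l; split=> //.
case: (le_tot) => lr lanti ltr _.
have sz : size l = size s by rewrite -El size_map.
have nths i : (nth (0, 0) l i).1 = nth 0 s i.
  rewrite -El; have [il|il] := ltnP i (size l); first by rewrite (nth_map (0, 0)).
  by rewrite !nth_default ?size_map.
have memG h u : (h <= size mu)%N -> u *: e \in G h <-> mult (word (drop (d h) l)) u.
  by move=> hm; have [dh <-] := HF h hm; apply: ff; rewrite sz.
have A1 h i : (h <= size mu)%N -> (i < d h)%N -> qz_class (nth 0 s i) \in take h mu.
  move=> hm id; have [dh _] := HF h hm; have [pG _] := HG h hm.
  have pe' : pres e (take (d h) l ++ drop (d h) l) by rewrite cat_take_drop.
  have [f [_ pf]] := pres_sub (normalized_drop (d h) nl) pe' (fun u => memG h u hm).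
  have := primitive_entry (normalized_take (d h) nl) pf pG (i := i).
  by rewrite size_takel ?sz // nth_take // nths; apply.
have A2 h i : (h <= size mu)%N -> (d h <= i < size s)%N -> qz_class (nth 0 s i) \notin take h mu.
  move=> hm; rewrite -sz => di; have [dh _] := HF h hm.
  have := @primitive_part_maximal _ E e l (G h) (d h) nl pe _ (fun u => memG h u hm) (HG h hm) i di.
  by rewrite sz nths => H; apply/negP; exact: H.
have A3 i : (i < size s)%N -> qz_class (nth 0 s i) \in mu.
  rewrite -sz => il; have [m [n0 [_ rt]]] := bernstein_root nl pe il HB.
  apply/Hmu; eexists; last exact: rt.
  by rewrite qz_class_subnat qz_class_nat nths.
pose hh i := index (qz_class (nth 0 s i)) mu.
have hm i : (i < size s)%N -> (hh i < size mu)%N by move=> il; rewrite index_mem A3.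
have lo i : (i < size s)%N -> (d (hh i) <= i)%N.
  move=> il; rewrite leqNgt; apply/negP => /(A1 _ _ (ltnW (hm i il))) /index_ltn.
  by rewrite ltnn.
have hi i : (i < size s)%N -> (i < d (hh i).+1)%N.
  move=> il; rewrite ltnNge; apply/negP => H.
  have H1 : (d (hh i).+1 <= i < size s)%N by rewrite H.
  have := A2 _ _ (hm i il) H1; rewrite in_take ?ltnS ?leqnn //; exact: A3.
have str : transitive (fun x y => le x y && (x != y)).
  move=> y x z /andP [xy nxy] /andP [yz nyz]; rewrite (ltr _ _ _ xy yz) /=.
  apply/eqP => xz; move/eqP: nxy; apply; apply: lanti; rewrite xy /=.
  by rewrite xz.
have pmu : pairwise (fun x y => le x y && (x != y)) mu by rewrite -sorted_pairwise.
have block h i j : (h < size mu)%N -> (d h <= i)%N -> (i <= j)%N -> (j < d h.+1)%N ->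
    nth 0 s i + i%:R <= nth 0 s j + j%:R.
  move=> hmu di; elim: j => [|j IH]; first by rewrite leqn0 => /eqP ->.
  rewrite leq_eqVlt => /orP [/eqP <- //|]; rewrite ltnS => ij jd.
  apply: le_trans (IH ij (ltnW jd)) _.
  have [_ Hs] := Hprim h hmu; have [dh1 _] := HF h.+1 hmu.
  have dj := leq_trans di ij.
  have := Hs (j.+1 - d h)%N; rewrite size_drop size_takel // subn_gt0 ltnS dj /=.
  rewrite ltn_sub2r ?(leq_ltn_trans dj (ltnW jd)) // => /(_ isT).
  rewrite /ent subSn //= !nth_drop subnKC // addnS subnKC // !nth_take ?(ltnW jd) //.
  by rewrite -!natr1 natrB //; lra.
apply/principal_orderP => i j ij jl; have il := ltn_trans ij jl.
rewrite /ple !qz_class_nat; case: eqP => [Eq|ne].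
  apply: (@block (hh i)); rewrite ?hm ?lo ?(ltnW ij) //.
  by rewrite /hh Eq hi.
have hne : hh i != hh j.
  apply/eqP => Eh; apply: ne.
  by rewrite -(nth_index (qz_class 0) (A3 i il)) -(nth_index (qz_class 0) (A3 j jl)) -/(hh i) Eh.
have hij : (hh i < hh j)%N.
  rewrite ltn_neqAle hne leqNgt; apply/negP => hji.
  have := A1 (hh j).+1 i (hm j jl) (ltn_trans ij (hi j jl)) => /index_ltn.
  by rewrite ltnS leqNgt -/(hh i) hji.
have /pairwiseP /(_ (hh i) (hh j)) := pmu => /(_ (qz_class 0)).
rewrite !inE !hm // => /(_ isT isT hij) /andP [+ _].
by rewrite !nth_index ?A3.
Qed.

End PrincipalAnalysis.

(** * First order terms *)

Section ShiftedProducts.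
Variable C : numFieldType.
Implicit Types (r : seq C) (p : {poly C}).

(* prod_(i < j) (X - r_i + 1) * prod_(i >= j) (X - r_i) *)
Fixpoint shifted_prod r (j : nat) : {poly C} :=
  if r is r0 :: r' then
    if j is j'.+1 then ('X - (r0 - 1)%:P) * shifted_prod r' j'
    else ('X - r0%:P) * shifted_prod r' 0
  else 1.

Lemma shifted_prod0 r : shifted_prod r 0 = \prod_(z <- r) ('X - z%:P).
Proof. by elim: r => [|z r IH] /=; rewrite ?big_nil // big_cons IH. Qed.

Lemma shifted_prod_full r rho : (shifted_prod r (size r)).[rho] = (shifted_prod r 0).[rho + 1].
Proof.
elim: r => [|z r IH] /=; first by rewrite !hornerC.
by rewrite !hornerM IH !hornerXsubC; congr (_ * _); ring.
Qed.

Lemma size_shifted_prod r j : (j <= size r)%N -> size (shifted_prod r j) = (size r).+1.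
Proof.
elim: r j => [|z r IH] [|j] //=; rewrite ?size_poly1 // => jr;
by rewrite size_mul ?polyXsubC_eq0 -?size_poly_eq0 ?size_XsubC ?IH.
Qed.

Lemma monic_shifted_prod0 r : shifted_prod r 0 \is monic.
Proof. by rewrite shifted_prod0 monic_prod_XsubC. Qed.

(** This is (X - r_i) A_(i+1) = (X - r_i + 1) A_i, arranged so as to reduce every X A_j to X A_0 and
    multiples of the A_i. *)
Lemma shifted_prodS r i : (i < size r)%N ->
  'X * shifted_prod r i.+1 = 'X * shifted_prod r i + shifted_prod r i
    + (nth 0 r i)%:P * (shifted_prod r i.+1 - shifted_prod r i).
Proof.
elim: r i => [|z r IH] [|i] //= ir.
  set p := (X in ('X - z%:P) * X); rewrite [X in ('X - (z - 1)%:P) * X](_ : _ = p); last by [].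
  rewrite polyCB polyC1; ring.
have := IH i ir; set p := shifted_prod r i.+1; set q := shifted_prod r i; set c := _%:P => E.
transitivity (('X - (z - 1)%:P) * ('X * p)); first by ring.
by rewrite E; ring.
Qed.

Definition non_resonant r := forall i j, (i < j)%N -> (j < size r)%N ->
  nth 0 r j - nth 0 r i + 1 != 0.

(** At X = z - 1, with z the first root, every A_j with j > 0 vanishes, while A_0 does not by
    non-resonance; so c_0 = 0. The other terms share the factor X - (z - 1), which is cancelled
    before the induction. *)
Lemma shifted_prod_free r (c : nat -> C) : non_resonant r ->
  \sum_(j < (size r).+1) (c j)%:P * shifted_prod r j = 0 ->
  forall j, (j <= size r)%N -> c j = 0.
Proof.
elim: r c => [|z r IH] c nr /=.
  rewrite big_ord1 mulr1 => /polyC_inj; rewrite -/(c 0%N) => c0 j; rewrite leqn0 => /eqP -> //.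
rewrite big_ord_recl /= => E.
have nz : (shifted_prod r 0).[z - 1] != 0.
  rewrite shifted_prod0 horner_prod prodf_seq_neq0; apply/allP => x xr /=.
  have [i ir <-] := nthP 0 xr; rewrite hornerXsubC.
  have := nr 0%N i.+1 isT ir; apply: contra => /eqP E1 /=.
  by rewrite -oppr_eq0; apply/eqP; rewrite -[RHS]E1; ring.
have c0 : c 0%N = 0.
  move: E => /(congr1 (fun p => p.[z - 1])).
  rewrite hornerD horner0 horner_sum big1 ?addr0; last first.
    by move=> i _; rewrite !hornerM hornerXsubC subrr mul0r mulr0.
  move=> /eqP; rewrite !hornerM hornerXsubC hornerC !mulf_eq0 (negbTE nz) orbF.
  by rewrite addrAC subrr add0r oppr_eq0 oner_eq0 orbF => /eqP.
case=> [//|j]; rewrite ltnS => jr.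
have nr' : non_resonant r by move=> i k ik kr; exact: (nr i.+1 k.+1).
apply: (IH (fun i => c i.+1) nr' _ j jr).
have X0 : 'X - (z - 1)%:P != 0 :> {poly C} by rewrite polyXsubC_eq0.
apply: (mulfI X0); rewrite mulr0 -[RHS]E c0 mul0r add0r mulr_sumr.
by apply: eq_bigr => i _; rewrite mulrCA.
Qed.

(** The additional term is the only one of degree [(size r).+1]. *)
Lemma shifted_prod_freeX r (c : nat -> C) d : non_resonant r ->
  \sum_(j < (size r).+1) (c j)%:P * shifted_prod r j + d%:P * ('X * shifted_prod r 0) = 0 ->
  d = 0 /\ forall j, (j <= size r)%N -> c j = 0.
Proof.
move=> nr E; have d0 : d = 0.
  move: E => /(congr1 (fun p : {poly C} => p`_(size r).+1)).
  rewrite coefD coef_sum big1 ?add0r; last first.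
    move=> i _; rewrite coefCM nth_default ?mulr0 // size_shifted_prod //.
    by rewrite -ltnS.
  rewrite coefCM coefXM /= coef0.
  have -> : (shifted_prod r 0)`_(size r) = 1.
    by have /monicP := monic_shifted_prod0 r; rewrite /lead_coef size_shifted_prod.
  by rewrite mulr1.
split=> //; apply: shifted_prod_free => //.
by rewrite -[RHS]E d0 mul0r addr0.
Qed.

(** Only the interior relations are kept: those of A_0 and of the last A_j also contain the unknowns
    [be'] and [be]. *)
Lemma shifted_prod_rel r (x y : nat -> C) be be' d : non_resonant r ->
  \sum_(i < size r) ((x i)%:P * shifted_prod r i.+1 + (y i)%:P * shifted_prod r i)
    + be%:P * shifted_prod r (size r) - be'%:P * shifted_prod r 0
    + d%:P * ('X * shifted_prod r 0) = 0 ->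
  forall i, (i.+1 < size r)%N -> x i + y i.+1 = 0.
Proof.
move=> nr E i ir.
pose c j := (if j is j'.+1 then x j' else - be') + (if j == size r then be else y j).
have [_ /(_ i.+1 (ltnW ir))] : d = 0 /\ forall j, (j <= size r)%N -> c j = 0.
  apply: (shifted_prod_freeX nr); rewrite -[RHS]E; congr (_ + _).
  under eq_bigr do rewrite polyCD mulrDl.
  rewrite big_split big_ord_recl /= polyCN mulNr big_ord_recr /= eqxx big_split /=.
  rewrite [X in _ + (X + _)](_ : _ = \sum_(i < size r) (y i)%:P * shifted_prod r i); last first.
    by apply: eq_bigr => j _; rewrite ltn_eqF.
  by ring.
by rewrite /c ltn_eqF.
Qed.

Lemma poly_fun_eq0 p : (forall rho, p.[rho] = 0) -> p = 0.
Proof.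
move=> p0; apply/eqP/negP => /negP np.
have := max_poly_roots (rs := [seq i%:R | i <- iota 0 (size p)]) np.
rewrite size_map size_iota ltnn => H; suff : false by []; apply: H.
  by apply/allP => x _; rewrite rootE p0.
rewrite map_inj_uniq ?iota_uniq // => i j /eqP; rewrite eqr_nat => /eqP //.
Qed.

Lemma poly_funE p q : (forall rho, p.[rho] = q.[rho]) -> p = q.
Proof.
move=> E; apply/eqP; rewrite -subr_eq0; apply/eqP/poly_fun_eq0 => rho.
by rewrite hornerD hornerN E subrr.
Qed.

End ShiftedProducts.

(* Modulo higher order, the letter (lambda_i, U_i) in position i contributes u_i A_(i+1) with
   u_i = U_i'(0) and A_j = shifted_prod r j; a change of variable a -> chi a + t a^2 adds
   (X - r_i) A_(i+1) - lambda_i (lambda_i - 1) (A_(i+1) - A_i), times t / chi. *)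
Section FirstOrderIdentity.
Variable C : numFieldType.
Variables (r u u' la : nat -> C) (k : nat) (chi kap al al' be be' : C).
Let rs := mkseq r k.
Let A j : {poly C} := shifted_prod rs j.
Hypothesis nr : non_resonant rs.
Hypothesis HE :
  \sum_(i < k) ((chi * u' i)%:P * A i.+1 + kap%:P * (('X - (r i)%:P) * A i.+1
     - (la i * (la i - 1))%:P * (A i.+1 - A i))) + (al%:P * 'X + be%:P) * A k
  = \sum_(i < k) (u i)%:P * A i.+1 + (al'%:P * 'X + be'%:P) * A 0%N.

Lemma first_order_identity : exists K, forall i, (i.+1 < k)%N ->
  r i.+1 = r i + (la i.+1 - la i + 1) ->
  chi * u' i = u i - (la i.+1 - la i) * (kap * (la i + la i.+1 + i%:R) - K).
Proof.
have szr : size rs = k by rewrite size_mkseq.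
have AS i : (i < k)%N -> 'X * A i.+1 = 'X * A i + A i + (r i)%:P * (A i.+1 - A i).
  by move=> ik; rewrite /A shifted_prodS ?szr // nth_mkseq.
have XA m : (m <= k)%N -> 'X * A m = 'X * A 0%N + \sum_(i < m) (A i + (r i)%:P * (A i.+1 - A i)).
  elim: m => [|m IH] mk; first by rewrite big_ord0 addr0.
  by rewrite big_ord_recr /= AS // IH ?(ltnW mk) // !addrA.
(* Summation by parts; the increments X A_(i+1) - X A_i are given by [AS]. *)
have sumXA m : (m <= k)%N -> \sum_(i < m) 'X * A i.+1 =
    m%:R * ('X * A m) - \sum_(i < m) (i%:R)%:P * (A i + (r i)%:P * (A i.+1 - A i)).
  elim: m => [|m IH] mk; first by rewrite !big_ord0 mul0r subrr.
  rewrite !big_ord_recr /= IH ?(ltnW mk) // AS //.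
  by rewrite -natr1 -[m%:R in RHS]polyC_natr polyC_natr; ring.
(* The total coefficient of X A_k: [al] is already there, and [k%:R * kap] comes from [sumXA]. *)
pose K := al + k%:R * kap.
pose x i := chi * u' i - u i - kap * r i - kap * (la i * (la i - 1)) - kap * i%:R * r i + K * r i.
pose y i := kap * (la i * (la i - 1)) - kap * i%:R * (1 - r i) + K * (1 - r i).
have key : forall i, (i.+1 < size rs)%N -> x i + y i.+1 = 0.
  apply: (@shifted_prod_rel _ rs x y be be' (K - al') nr); rewrite szr -!/(A _).
  pose S1 : {poly C} := \sum_(i < k) (chi * u' i)%:P * A i.+1.
  pose S2 := \sum_(i < k) 'X * A i.+1.
  pose S3 : {poly C} := \sum_(i < k) (r i)%:P * A i.+1.
  pose S4 := \sum_(i < k) (la i * (la i - 1))%:P * (A i.+1 - A i).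
  pose S5 := \sum_(i < k) (u i)%:P * A i.+1.
  pose S6 := \sum_(i < k) (i%:R)%:P * (A i + (r i)%:P * (A i.+1 - A i)).
  pose S7 := \sum_(i < k) (A i + (r i)%:P * (A i.+1 - A i)).
  have HE' : S1 + kap%:P * (S2 - S3 - S4) + (al%:P * 'X + be%:P) * A k
      = S5 + (al'%:P * 'X + be'%:P) * A 0%N.
    rewrite -HE; congr (_ + _); rewrite big_split /= -mulr_sumr; congr (_ + _ * _).
    by rewrite -!sumrB; apply: eq_bigr => i _; rewrite mulrBl.
  have E2 : S2 = k%:R * ('X * A k) - S6 by exact: sumXA.
  have EX : 'X * A k = 'X * A 0%N + S7 by exact: XA.
  have -> : \sum_(i < k) ((x i)%:P * A i.+1 + (y i)%:P * A i) =
      S1 - S5 - kap%:P * S3 - kap%:P * S4 - kap%:P * S6 + K%:P * S7.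
    rewrite /S1 /S3 /S4 /S5 /S6 /S7 !mulr_sumr -!sumrB -big_split; apply: eq_bigr => i _ /=.
    rewrite /x /y !(polyCD, polyCB, polyCM, polyCN, polyC1); ring.
  have -> : S1 = S5 + (al'%:P * 'X + be'%:P) * A 0%N - kap%:P * (S2 - S3 - S4)
     - (al%:P * 'X + be%:P) * A k by rewrite -HE'; ring.
  have -> : S7 = 'X * A k - 'X * A 0%N by rewrite EX; ring.
  rewrite E2 /K !(polyCD, polyCB, polyCM) polyC_natr; ring.
exists K => i ik Er.
have := key i; rewrite szr => /(_ ik); rewrite /x /y -natr1 Er => E0.
by apply/eqP; rewrite -subr_eq0; apply/eqP; rewrite -[RHS]E0; ring.
Qed.

End FirstOrderIdentity.

(** * The two lowest orders of the action of a word *)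

Section TwoTerms.
Variable C : numFieldType.
Local Notation letter := (rat * fps C)%type.
Implicit Types (x w : Ahat C) (l : seq letter) (f g : C -> C).

(* In Ahat/Ahat(a - rho b), x is congruent to f(rho) b^d + g(rho) b^(d+1) + O(b^(d+2)). *)
Definition two_terms x d f g := forall rho,
  [/\ forall N, (N < d)%N -> rem rho x N = 0, rem rho x d = f rho & rem rho x d.+1 = g rho].

(** By [remM], x acts on the term b^i of w eps with the parameter rho + i; only i = d' and i = d' +
    1 contribute to the two lowest orders. *)
Lemma two_terms_mul x w d d' f g f' g' : two_terms x d f g -> two_terms w d' f' g' ->
  two_terms (x * w) (d + d') (fun rho => f (rho + d'%:R) * f' rho)
    (fun rho => f (rho + d'.+1%:R) * g' rho + g (rho + d'%:R) * f' rho).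
Proof.
move=> Hx Hw rho; have [w0 wf wg] := Hw rho; split.
- move=> N Nd; rewrite remM big1 // => i _.
  have [id|di] := ltnP i d'; first by rewrite w0 // mul0r.
  by have [x0 _ _] := Hx (rho + i%:R); rewrite x0 ?mulr0 //; have := ltn_ord i; lia.
- have [_ xf _] := Hx (rho + d'%:R).
  have dd : (d' < (d + d').+1)%N by rewrite ltnS leq_addl.
  rewrite remM (bigD1 (Ordinal dd)) //= addnK xf wf mulrC big1 ?addr0 // => i ni.
  have [id|di] := ltnP i d'; first by rewrite w0 // mul0r.
  have {ni di} di : (d' < i)%N.
    by rewrite ltn_neqAle di andbT; apply: contra ni => /eqP E; apply/eqP/val_inj.
  have [x0 _ _] := Hx (rho + i%:R); rewrite x0 ?mulr0 //.
  by have := ltn_ord i; lia.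
- have [_ xf _] := Hx (rho + d'.+1%:R); have [_ _ xg] := Hx (rho + d'%:R).
  have dd : (d' < (d + d').+2)%N by rewrite !ltnS (leq_trans (leq_addl d d')).
  have dd1 : (d'.+1 < (d + d').+2)%N by rewrite !ltnS leq_addl.
  rewrite remM (bigD1 (Ordinal dd1)) //= (bigD1 (Ordinal dd)) /=; last first.
    by rewrite -val_eqE /= ltn_eqF.
  rewrite subSS addnK subSn ?leq_addl // addnK xf xg wf wg mulrC [f' _ * _]mulrC.
  rewrite big1 ?addr0 // => i /andP [n1 n0].
  have [id|di] := ltnP i d'; first by rewrite w0 // mul0r.
  have {n1 n0 di} di : (d'.+1 < i)%N.
    rewrite -!val_eqE /= in n1 n0; have := ltn_ord i; lia.
  have [x0 _ _] := Hx (rho + i%:R); rewrite x0 ?mulr0 //.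
  by have := ltn_ord i; lia.
Qed.

Lemma two_terms_any x : two_terms x 0 (fun=> x 0 0)%N (fun rho => x 0%N 1%N + rho * x 1%N 0%N).
Proof. by move=> rho; split=> //; [rewrite rem0|rewrite rem1]. Qed.

Variables (Theta : {rmorphism Ahat C -> Ahat C}) (chi t : C).
Hypothesis Theta_cst : forall c, Theta (hat_cst c) = hat_cst c.
(** These are the expansions for theta(a) = chi a + t a^2 + ... and b theta'(a), as a^2 eps = rho
    (rho + 1) b^2 eps. The identity is the case chi = 1, t = 0. *)
Hypothesis Theta_a : two_terms (Theta (hat_a C)) 1 (fun rho => chi * rho)
  (fun rho => t * rho * (rho + 1)).
Hypothesis Theta_b : two_terms (Theta (hat_b C)) 1 (fun=> chi) (fun rho => 2 * t * rho).

Lemma two_terms_hlin (c : C) : two_terms (Theta (hlin c)) 1 (fun rho => chi * (rho - c))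
  (fun rho => t * rho * (rho + 1 - 2 * c)).
Proof.
move=> rho; have [a0 a1 a2] := Theta_a rho; have [b0 b1 b2] := Theta_b rho.
have E N : rem rho (Theta (hlin c)) N = rem rho (Theta (hat_a C)) N - c * rem rho (Theta (hat_b C)) N.
  by rewrite rmorphB rmorphM Theta_cst remD remN rem_cst.
split; first by move=> N N1; rewrite E a0 // b0 // mulr0 subr0.
  by rewrite E a1 b1; ring.
by rewrite E a2 b2; ring.
Qed.

Lemma ser_b_split (U : fps C) : ser_b U = hat_cst (U 0%N) + hat_b C * ser_b (fun n => U n.+1).
Proof.
rewrite hat_b_ser ser_bD; congr ser_b; apply/funext => -[|n]; first by rewrite [RHS]addr0.
by rewrite [RHS]add0r.
Qed.

Lemma two_terms_ser (U : fps C) : U 0%N = 1 ->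
  two_terms (Theta (ser_b U)) 0 (fun=> 1) (fun=> chi * U 1%N).
Proof.
have r0 (V : fps C) rho : rem rho (Theta (ser_b V)) 0%N = V 0%N.
  rewrite ser_b_split rmorphD rmorphM Theta_cst remD.
  have [b0 _ _] := Theta_b (rho + 0%:R).
  transitivity (rem rho (hat_cst (V 0%N)) 0%N + rem rho (Theta (hat_b C) * Theta (ser_b (fun n => V n.+1))) 0%N); first by [].
  by rewrite rem_ser remM big_ord1 subn0 b0 // mulr0 addr0.
move=> U1 rho; split=> //; first by rewrite r0.
have [b0 b1 _] := Theta_b (rho + 0%:R).
have [b0' _ _] := Theta_b (rho + 1%:R).
rewrite ser_b_split rmorphD rmorphM Theta_cst remD.
transitivity (rem rho (hat_cst (U 0%N)) 1%N + rem rho (Theta (hat_b C) * Theta (ser_b (fun n => U n.+1))) 1%N); first by [].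
rewrite rem_ser add0r remM 2!big_ord_recr big_ord0 /= add0r subnn b0' // mulr0 addr0.
by rewrite r0 subn0 b1 mulrC.
Qed.

Fixpoint roots_word l : seq C := if l is x :: l' then (ratr x.1 - (size l')%:R) :: roots_word l' else [::].

Lemma size_roots_word l : size (roots_word l) = size l.
Proof. by elim: l => //= x l ->. Qed.

Lemma nth_roots_word l i : (i < size l)%N ->
  nth 0 (roots_word l) i = ratr (nth (0, 0) l i).1 - (size l - i.+1)%:R.
Proof. by elim: l i => // x l IH [|i] il /=; rewrite ?subn1 // IH. Qed.

Fixpoint lead_word l (rho : C) : C :=
  if l is x :: l' then chi * (rho + (size l')%:R - ratr x.1) * lead_word l' rho else 1.

Fixpoint next_word l (rho : C) : C :=
  if l is x :: l' then
    chi * (rho + (size l').+1%:R - ratr x.1) * next_word l' rho +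
    (chi * (rho + (size l').+1%:R - ratr x.1) * (chi * x.2 1%N)
     + t * (rho + (size l')%:R) * (rho + (size l')%:R + 1 - 2 * ratr x.1)) * lead_word l' rho
  else 0.

Lemma two_terms_word l : normalized l ->
  two_terms (Theta (hword l)) (size l) (lead_word l) (next_word l).
Proof.
elim: l => [_|x l IH /= [x1 nl]].
  rewrite hword0 rmorph1 => rho; have := two_terms_any 1 rho.
  by case=> H0 H1 H2; split=> //; rewrite H2 mulr0 addr0.
rewrite hword_cons rmorphM [hblk x]/(_ * _) rmorphM => rho.
have Hx := two_terms_mul (two_terms_hlin (ratr x.1)) (two_terms_ser x1).
have [H0 H1 H2] := two_terms_mul Hx (IH nl) rho.
split=> [N Nl||]; first by apply: H0; rewrite add1n.
  by move: H1; rewrite add1n => ->; rewrite addr0 mulr1.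
move: H2; rewrite add1n => ->; rewrite !addr0 !mulr1 -!natr1; ring.
Qed.

Lemma lead_wordE l rho : lead_word l rho = chi ^+ size l * (shifted_prod (roots_word l) 0).[rho].
Proof.
elim: l => [|x l IH] /=; first by rewrite hornerC mulr1.
by rewrite IH hornerM hornerXsubC exprS; ring.
Qed.

Hypothesis chi0 : chi != 0.

(** For a letter lambda followed by n letters, put y = rho + n. Then y (y + 1 - 2 lambda) = (y -
    lambda) (y - lambda + 1) - lambda (lambda - 1) with y - lambda = rho - r_i, which expresses the
    contribution of t through A_i and A_(i+1). *)
Lemma next_wordE l rho : next_word l rho = chi ^+ size l *
  (\sum_(i < size l) ((chi * (nth (0, 0) l i).2 1%N)%:P * shifted_prod (roots_word l) i.+1
    + (t / chi)%:P * (('X - (nth 0 (roots_word l) i)%:P) * shifted_prod (roots_word l) i.+1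
     - (ratr (nth (0, 0) l i).1 * (ratr (nth (0, 0) l i).1 - 1))%:P *
         (shifted_prod (roots_word l) i.+1 - shifted_prod (roots_word l) i)))).[rho].
Proof.
elim: l => [|x l IH]; first by rewrite big_ord0 horner0 mulr0.
set r0 : C := ratr x.1 - (size l)%:R.
have -> : roots_word (x :: l) = r0 :: roots_word l by [].
rewrite big_ord_recl.
have -> : \sum_(i < size l) ((chi * (nth (0, 0) (x :: l) (lift ord0 i)).2 1%N)%:P *
      shifted_prod (r0 :: roots_word l) (lift ord0 i).+1
    + (t / chi)%:P * (('X - (nth 0 (r0 :: roots_word l) (lift ord0 i))%:P) *
        shifted_prod (r0 :: roots_word l) (lift ord0 i).+1
     - (ratr (nth (0, 0) (x :: l) (lift ord0 i)).1 * (ratr (nth (0, 0) (x :: l) (lift ord0 i)).1 - 1))%:P *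
         (shifted_prod (r0 :: roots_word l) (lift ord0 i).+1 - shifted_prod (r0 :: roots_word l) (lift ord0 i))))
   = ('X - (r0 - 1)%:P) * \sum_(i < size l) ((chi * (nth (0, 0) l i).2 1%N)%:P * shifted_prod (roots_word l) i.+1
    + (t / chi)%:P * (('X - (nth 0 (roots_word l) i)%:P) * shifted_prod (roots_word l) i.+1
     - (ratr (nth (0, 0) l i).1 * (ratr (nth (0, 0) l i).1 - 1))%:P *
         (shifted_prod (roots_word l) i.+1 - shifted_prod (roots_word l) i))).
  by rewrite mulr_sumr; apply: eq_bigr => i _ /=; ring.
rewrite hornerD hornerM hornerXsubC /= IH lead_wordE.
set S := (X in X.[rho]); set A0 := shifted_prod _ 0.
rewrite !(hornerD, hornerN, hornerM, hornerC, hornerX) exprS /r0 -natr1.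
by field.
Qed.

End TwoTerms.

(** * Comparison of two words *)

Section CompareWords.
Variable C : numFieldType.
Local Notation letter := (rat * fps C)%type.
Implicit Types (W V : Ahat C) (l : seq letter).

Lemma two_terms_hat_a : two_terms (hat_a C) 1 (fun rho => 1 * rho) (fun rho => 0 * rho * (rho + 1)).
Proof.
move=> rho; rewrite -[hat_a C]mulr1.
have r1 n : rem rho (1 : Ahat C) n = (n == 0%N)%:R by rewrite -ser_b1 rem_ser.
split=> [[|N] // _||]; rewrite ?rem_a ?r1 /=.
- by rewrite rem0 mulr1.
- by rewrite addr0 mulr1 mul1r.
- by rewrite mulr0 !mul0r.
Qed.

Lemma two_terms_hat_b : two_terms (hat_b C) 1 (fun=> 1) (fun rho => 2 * 0 * rho).
Proof. by move=> rho; rewrite rem_ser mulr0 mul0r; split=> // -[]. Qed.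

Lemma two_terms_word_id l : normalized l ->
  two_terms (hword l) (size l) (lead_word 1 l) (next_word 1 0 l).
Proof.
move=> nl; apply: (@two_terms_word _ idfun _ _ _ _ _ _ nl) => //.
  exact: two_terms_hat_a.
exact: two_terms_hat_b.
Qed.

Lemma shifted_prod0_neq0 (r : seq C) : shifted_prod r 0 != 0.
Proof. by rewrite monic_neq0 ?monic_shifted_prod0. Qed.

Lemma roots_word_map l l' : map fst l = map fst l' -> roots_word l = roots_word l'.
Proof.
elim: l l' => [|x l IH] [|x' l'] //= [-> E]; rewrite (IH _ E); congr (_ - _%:R :: _).
by rewrite -(size_map fst l) E size_map.
Qed.

(** If l were longer, the right side would have no term of order [size l'], and the product of the X
    - r_i of l' would vanish at every rho. *)
Lemma compare_size l l' W V : normalized l -> normalized l' ->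
  hword l' * W = V * hword l -> W 0%N 0%N != 0 -> (size l <= size l')%N.
Proof.
move=> nl nl' E W0; rewrite leqNgt; apply/negP => ll.
have := shifted_prod0_neq0 (roots_word l'); apply/negP; rewrite negbK; apply/eqP.
apply: poly_fun_eq0 => rho.
have [_ H1 _] := two_terms_mul (two_terms_word_id nl') (two_terms_any W) rho.
have [H0 _ _] := two_terms_mul (two_terms_any V) (two_terms_word_id nl) rho.
move: H1; rewrite E addn0 H0 ?add0n // addr0 lead_wordE expr1n mul1r => /esym/eqP.
by rewrite mulf_eq0 (negbTE W0) orbF => /eqP.
Qed.

(** The lowest order terms make the two monic products of the X - r_i proportional, hence equal. *)
Lemma compare_roots l l' W V : normalized l -> normalized l' -> size l = size l' ->
  hword l' * W = V * hword l -> W 0%N 0%N != 0 -> perm_eq (roots_word l) (roots_word l').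
Proof.
move=> nl nl' sz E W0.
have EP : (W 0%N 0%N) *: shifted_prod (roots_word l') 0 = (V 0%N 0%N) *: shifted_prod (roots_word l) 0.
  apply: poly_funE => rho; rewrite !hornerZ.
  have [_ H1 _] := two_terms_mul (two_terms_word_id nl') (two_terms_any W) rho.
  have [_ H2 _] := two_terms_mul (two_terms_any V) (two_terms_word_id nl) rho.
  move: H1; rewrite E addn0 -sz -[size l]add0n H2 !lead_wordE !expr1n !mul1r addr0 => ->.
  exact: mulrC.
have EW : W 0%N 0%N = V 0%N 0%N.
  have := congr1 lead_coef EP; rewrite !lead_coefZ.
  by rewrite !(monicP (monic_shifted_prod0 _)) !mulr1.
apply: prod_XsubC_eq; rewrite -!shifted_prod0; apply/esym/(scalerI W0).
by rewrite EP EW.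
Qed.

Lemma compare_first_order (Theta : {rmorphism Ahat C -> Ahat C}) (chi t : C) l l' W V :
  (forall c, Theta (hat_cst c) = hat_cst c) ->
  two_terms (Theta (hat_a C)) 1 (fun rho => chi * rho) (fun rho => t * rho * (rho + 1)) ->
  two_terms (Theta (hat_b C)) 1 (fun=> chi) (fun rho => 2 * t * rho) -> chi != 0 ->
  normalized l -> normalized l' -> map fst l' = map fst l -> non_resonant (roots_word l) ->
  Theta (hword l') * W = V * hword l -> W 0%N 0%N != 0 ->
  exists K, forall i, (i.+1 < size l)%N ->
    let la i := ratr (nth (0, 0) l i).1 in
    chi * (nth (0, 0) l' i).2 1%N = (nth (0, 0) l i).2 1%N
      - (la i.+1 - la i) * (t / chi * (la i + la i.+1 + i%:R) - K).
Proof.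
move=> Tc Ta Tb chi0 nl nl' Em nr E W0.
have sz : size l' = size l by rewrite -(size_map fst l') Em size_map.
have Er : roots_word l' = roots_word l by exact: roots_word_map.
set rs := roots_word l in Er nr.
pose k := size l; pose c := chi ^+ k * W 0%N 0%N.
have c0 : c != 0 by rewrite mulf_neq0 // expf_neq0.
have HL rho := two_terms_mul (two_terms_word Tc Ta Tb nl') (two_terms_any W) rho.
have HR rho := two_terms_mul (two_terms_any V) (two_terms_word_id nl) rho.
have V0 : V 0%N 0%N = c.
  apply: polyC_inj; apply: (mulIf (shifted_prod0_neq0 rs)); apply: poly_funE => rho.
  rewrite !hornerM !hornerC; have [_ H1 _] := HL rho; have [_ H2 _] := HR rho.
  move: H1; rewrite E addn0 sz -[size l]add0n H2 !lead_wordE Er sz addr0 expr1n mul1r => ->.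
  by rewrite /c -/rs mulrAC.
pose la i : C := ratr (nth (0, 0) l i).1.
have la' i : ratr (nth (0, 0) l' i).1 = la i.
  rewrite /la; congr ratr.
  have [il|il] := ltnP i (size l); last by rewrite !nth_default ?sz.
  by rewrite -(nth_map _ 0) ?sz // Em (nth_map (0, 0)).
pose r := nth 0 rs.
have Ers : mkseq r k = rs by rewrite /k -(size_roots_word l) mkseq_nth.
have nr' : non_resonant (mkseq r k) by rewrite Ers.
(* W acts on eps as W_00 + (W_01 + rho W_10) b, while V acts after a word of order k, hence as V_00
   + (V_01 + (rho + k) V_10) b: these give the affine corrections, after division by W_00 and c. The
   factor of the first one is A_0(rho + 1) = A_k(rho). *)
have [|K HK] := @first_order_identity C r (fun i => (nth (0, 0) l i).2 1%N)
  (fun i => (nth (0, 0) l' i).2 1%N) la k chi (t / chi) (W 1%N 0%N / W 0%N 0%N) (V 1%N 0%N / c)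
  (W 0%N 1%N / W 0%N 0%N) ((V 0%N 1%N + k%:R * V 1%N 0%N) / c) nr'.
  rewrite Ers; apply: poly_funE => rho.
  have [_ _ H1] := HL rho; have [_ _ H2] := HR rho.
  move: H1; rewrite E addn0 sz -[size l]add0n H2 !addr0 V0 => H.
  apply: (mulfI c0).
  have Ak : (shifted_prod rs k).[rho] = (shifted_prod rs 0).[rho + 1].
    by rewrite -shifted_prod_full /k -(size_roots_word l).
  move: H; rewrite !next_wordE ?oner_eq0 // !lead_wordE Er sz -/rs -/k expr1n !mul1r.
  rewrite [X in c * X.[rho] + _](_ : _ = \sum_(i < k) ((nth (0, 0) l i).2 1%N)%:P * shifted_prod rs i.+1); last first.
    by apply: eq_bigr => i _; rewrite mul1r mul0r polyC0 mul0r addr0.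
  rewrite [X in chi ^+ k * X.[rho]](_ : _ = \sum_(i < k) ((chi * (nth (0, 0) l' i).2 1)%:P * shifted_prod rs i.+1 +
     (t / chi)%:P * (('X - (r i)%:P) * shifted_prod rs i.+1 -
      (la i * (la i - 1))%:P * (shifted_prod rs i.+1 - shifted_prod rs i)))); last first.
    by rewrite /k -sz; apply: eq_bigr => i _; rewrite la'.
  set S1 := (X in c * X.[rho] + _); set S2 := (X in chi ^+ k * X.[rho]) => H.
  rewrite !(hornerD, hornerM, hornerC, hornerX) Ak mulrDr [RHS]mulrDr -/S2.
  have -> : c * S1.[rho] = chi ^+ k * (shifted_prod rs 0).[rho + 1] * (W 0%N 1%N + rho * W 1%N 0%N) +
      chi ^+ k * S2.[rho] * W 0%N 0%N - (V 0%N 1%N + (rho + k%:R) * V 1%N 0%N) * (shifted_prod rs 0).[rho].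
    by rewrite -H addrK.
  by rewrite /c; field; rewrite W0 expf_neq0.
exists K => i il /=; apply: HK => //.
rewrite /r /rs !nth_roots_word ?(ltnW il) // -/(la i) -/(la i.+1).
have -> : (size l - i.+1)%:R = (size l - i.+2)%:R + 1 :> C.
  by rewrite natr1; congr _%:R; lia.
by ring.
Qed.

End CompareWords.

(** * Changes of variable *)

Section Ideals.
Variable C : numFieldType.
Local Notation letter := (rat * fps C)%type.
Implicit Types (u v w : Ahat C) (l : seq letter).

Definition hmult w u := exists v, u = v * w.

Lemma mul00 u v : (u * v) 0%N 0%N = u 0%N 0%N * v 0%N 0%N.
Proof. by rewrite mulAE !big_ord1. Qed.

Lemma one00 : (1 : Ahat C) 0%N 0%N = 1. Proof. by []. Qed.

Lemma rem_mod rho u v w : u = v * hlin rho + w -> rem rho u = rem rho w.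
Proof.
move=> ->; rewrite remD (proj2 (rem_eq0 _ _)) ?add0r //.
by exists v.
Qed.

Lemma rem_mull rho u w : rem rho (u * w) = rem rho (u * ser_b (rem rho w)).
Proof. by apply: (@rem_mod _ _ (u * quo rho w)); rewrite -mulrA -mulrDr -divE. Qed.

Lemma hmult_hlin rho u : hmult (hlin rho) u <-> rem rho u = 0.
Proof. by rewrite rem_eq0. Qed.

Lemma hword_rregI l u v : normalized l -> u * hword l = v * hword l -> u = v.
Proof.
move=> nl E; apply: subr0_eq; apply: (hword_rreg nl).
by rewrite mulrBl E subrr.
Qed.

(** Dividing u inside the subalgebra must give zero remainders, by uniqueness of the division in
    Ahat. *)
Lemma hmult_word l (u : Atilde C) : normalized l -> hmult (hword l) (val u) <-> mult (word l) u.
Proof.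
move=> nl; split=> [[v Ev]|[v ->]]; last by exists (val v); rewrite -val_word.
have [w [T E]] := word_div u nl; exists w; rewrite E.
suff T0 : forall i, (i < size l)%N -> T i = 0.
  by rewrite big1 ?addr0 // => i _; rewrite T0 // til_ser0 mul0r.
have [|//] := @hword_uniq C l (val w - v) T nl.
rewrite mulrBl -Ev addrAC; apply/eqP; rewrite subr_eq0; apply/eqP.
rewrite [in RHS]E rmorphD rmorphM /= val_word; congr (_ + _).
rewrite (val_til_sum _ (fun i => til_ser (T i) * word (drop i.+1 l))).
by apply: eq_bigr => i _; rewrite rmorphM /= val_word.
Qed.

End Ideals.

(** * Words under a change of variable *)

Section Automorphism.
Variable C : numFieldType.
Local Notation letter := (rat * fps C)%type.
Implicit Types (u v w x : Ahat C) (S T U V : fps C) (l : seq letter).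
Variables (theta : fps C) (Theta : {rmorphism Ahat C -> Ahat C}).
Hypothesis Htheta : is_change_of_variable theta.
Hypothesis HTheta : is_induced_automorphism theta Theta.
Let chi := theta 1%N.
Let t := theta 2.

Lemma Theta_surj u : exists v, Theta v = u.
Proof. by have [[g _ gK] _ _ _ _] := HTheta; exists (g u). Qed.

Lemma Theta_cst c : Theta (hat_cst c) = hat_cst c.
Proof. by case: HTheta. Qed.

Lemma rem_ser_a rho T n : rem rho (ser_a T) n = T n * rising rho n.
Proof.
rewrite /rem big_ord_recr /= subnn addr0 big1 ?add0r // => i _.
by rewrite /ser_a subn_eq0 leqNgt ltn_ord mul0r.
Qed.

Lemma Theta_a : two_terms (Theta (hat_a C)) 1 (fun rho => chi * rho) (fun rho => t * rho * (rho + 1)).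
Proof.
have [_ _ _ -> _] := HTheta; have [th0 _] := Htheta.
move=> rho; split=> [[|] // _||]; rewrite rem_ser_a.
- by rewrite th0 mul0r.
- by rewrite /rising big_ord1 addr0.
- by rewrite /rising !big_ord_recr big_ord0 /= addr0 mul1r mulrA.
Qed.

Lemma Theta_b : two_terms (Theta (hat_b C)) 1 (fun=> chi) (fun rho => 2 * t * rho).
Proof.
have [_ _ _ _ ->] := HTheta.
move=> rho; rewrite rem_b; split=> [[|] // _||]; rewrite /shift rem_ser_a.
- by rewrite /rising big_ord0 mul1r mulr1.
- by rewrite /rising big_ord1 addr0.
Qed.

Lemma chi_neq0 : chi != 0. Proof. by case: Htheta. Qed.

Lemma Theta_ser00 S : Theta (ser_b S) 0%N 0%N = S 0%N.
Proof.
rewrite ser_b_split rmorphD rmorphM Theta_cst AhatDE mul00 -[Theta (hat_b C) 0%N 0%N](rem0 0).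
have [b0 _ _] := Theta_b 0.
by rewrite b0 // mul0r addr0.
Qed.

(* theta_* E_lambda = E_lambda: the vector V eps of E_lambda is killed by Theta (a - lambda b). *)
Lemma rank_one_generator (c : C) :
  exists V, V 0%N = 1 /\ rem c (Theta (hlin c) * ser_b V) = 0.
Proof.
have HZ := two_terms_hlin Theta_cst Theta_a Theta_b c; set Z := Theta (hlin c) in HZ *.
have [|V HV] := @fps_fixpoint C (fun V n => if n == 0%N then 1 else
    - (n%:R * chi)^-1 * \sum_(i < n) V i * rem (c + i%:R) Z (n.+1 - i)%N).
  move=> S T n ST; case: eqP => // _; congr (_ * _); apply: eq_bigr => i _; by rewrite ST.
exists V; split; first by rewrite HV.
apply/funext => -[|n]; rewrite rem_mul_ser.
  by rewrite big_ord1; have [z0 _ _] := HZ (c + 0%:R); rewrite z0 // mulr0.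
rewrite !big_ord_recr /= subnn; have [z0 _ _] := HZ (c + n.+1%:R).
rewrite z0 // mulr0 addr0 subSn // subnn; have [_ z1 _] := HZ (c + n%:R).
(* For n > 0 this is nonzero and determines V_n; for n = 0 the equation is void, which leaves V_0 =
   1 free. *)
have -> : rem (c + n%:R) Z 1 = n%:R * chi by rewrite z1 [c + _]addrC addrK mulrC.
case: n {z0 z1} => [|n]; first by rewrite big_ord0 mul0r mulr0 addr0.
have n0 : n.+1%:R * chi != 0 by rewrite mulf_neq0 ?chi_neq0 // pnatr_eq0.
by rewrite [V n.+1]HV /= mulrAC mulNr mulVf // mulN1r addrN.
Qed.

(** If S starts at b^n, then Theta(S) V eps starts with chi^n S_n b^n. *)
Lemma Theta_ser_inj (c : C) V S : V 0%N = 1 -> rem c (Theta (ser_b S) * ser_b V) = 0 -> S = 0.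
Proof.
move=> V1 E0; apply/funext => n; elim/ltn_ind: n => n IH.
pose S' : fps C := fun i => S (i + n)%N.
have ES : ser_b S = hat_b C ^+ n * ser_b S'.
  have bS m (T : fps C) : hat_b C ^+ m * ser_b T = ser_b (iter m (@shift C) T).
    by elim: m => [|m IHm]; rewrite ?mul1r // exprS -mulrA IHm hat_b_ser.
  rewrite bS; congr ser_b; apply/funext => i.
  have itE m (T : fps C) : iter m (@shift C) T i = if (i < m)%N then 0 else T (i - m)%N.
    elim: m i => [|m IHm] i'; first by rewrite subn0.
    by case: i' => [|i'] //=; rewrite IHm ltnS subSS.
  rewrite itE; case: ltnP => [lt|ge]; first exact: IH.
  by rewrite /S' subnK.
have bn : two_terms (Theta (hat_b C) ^+ n) n (fun=> chi ^+ n)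
    (fun rho => rem rho (Theta (hat_b C) ^+ n) n.+1).
  elim: n {IH S' ES} => [|m IHm].
    by move=> rho; split=> //; rewrite rem0.
  move=> rho; have [H0 H1 _] := two_terms_mul Theta_b IHm rho.
  rewrite exprS; split=> [N Nm||//]; first by apply: H0; rewrite add1n.
  by move: H1; rewrite add1n => ->; rewrite exprS.
have [_ H1 _] := two_terms_mul bn (two_terms_any (Theta (ser_b S') * ser_b V)) c.
move: H1; rewrite mulrA -rmorphXn -rmorphM -ES E0 mul00 Theta_ser00 ser_bE V1 mulr1 => /esym/eqP.
by rewrite mulf_eq0 expf_eq0 (negbTE chi_neq0) andbF /= => /eqP.
Qed.

(** Multiplying by the inverse Xi of the series of the letter, the condition says that Theta(v)
    kills T eps, where T eps = g Xi eps. The vector V eps of [rank_one_generator] generates the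
    module for the twisted action, so T eps = Theta(T') V eps for some series T', and the condition
    becomes that v T' is a left multiple of a - lambda b. Hence U is T'^-1, normalized. *)
Lemma Theta_letter (x : letter) (g : Ahat C) : x.2 0%N = 1 -> g 0%N 0%N != 0 ->
  exists2 U, U 0%N = 1 & forall v, hmult (hblk x) (Theta v * g) <-> hmult (hblk (x.1, U)) v.
Proof.
move=> x1 g0; set c : C := ratr x.1.
have x0 : x.2 0%N != 0 by rewrite x1 oner_eq0.
have [Xi [Xi0 xXi Xix]] := ser_b_unit x0.
have [V [V1 HV]] := rank_one_generator c.
have V0 : V 0%N != 0 by rewrite V1 oner_eq0.
have [Vi [_ VVi ViV]] := ser_b_unit V0.
pose T := rem c (g * ser_b Xi).
have T0 : T 0%N != 0 by rewrite /T rem0 mul00 mulf_neq0 // ser_bE Xi0 invr_eq0.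
have [u Eu] := Theta_surj (ser_b T * ser_b Vi).
pose T' := rem c u.
have HT' : rem c (Theta (ser_b T') * ser_b V) = T.
  have E1 : Theta u * ser_b V = ser_b T by rewrite Eu -mulrA ViV mulr1.
  rewrite -[RHS](rem_ser c) -E1 {1}(divE c u) rmorphD mulrDl remD rmorphM -mulrA.
  by rewrite [X in X + _](_ : _ = 0) ?add0r // rem_mull HV ser_b0 mulr0 -ser_b0 rem_ser.
have T'0 : T' 0%N != 0.
  have := congr1 (fun f => f 0%N) HT'; rewrite rem0 mul00 Theta_ser00 ser_bE V1 mulr1.
  by move=> ->.
have [Ti [Ti0 TTi TiT]] := ser_b_unit T'0.
have key v : hmult (hblk x) (Theta v * g) <-> rem c (v * ser_b T') = 0.
  have -> : hmult (hblk x) (Theta v * g) <-> rem c (Theta v * g * ser_b Xi) = 0.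
    rewrite -hmult_hlin /hblk -/c; split=> -[w Ew].
      by exists w; rewrite Ew -!mulrA xXi mulr1.
    by exists w; rewrite mulrA -Ew -[RHS]mulrA Xix mulr1.
  have -> : rem c (Theta v * g * ser_b Xi) = rem c (Theta (v * ser_b T') * ser_b V).
    rewrite -mulrA rem_mull -/T -HT' -rem_mull rmorphM -mulrA //.
  have -> : rem c (Theta (v * ser_b T') * ser_b V) =
      rem c (Theta (ser_b (rem c (v * ser_b T'))) * ser_b V).
    rewrite {1}(divE c (v * ser_b T')) rmorphD mulrDl remD rmorphM -mulrA.
    by rewrite [X in X + _](_ : _ = 0) ?add0r // rem_mull HV ser_b0 mulr0 -ser_b0 rem_ser.
  split=> [/(Theta_ser_inj V1) //|->].
  by rewrite ser_b0 rmorph0 mul0r -ser_b0 rem_ser.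
pose d := T' 0%N; pose U : fps C := fun n => d * Ti n.
exists U; first by rewrite /U Ti0 divff.
have EU : ser_b U = hat_cst d * ser_b Ti by rewrite hat_cst_ser.
have dd : hat_cst d^-1 * hat_cst d = 1 by rewrite hat_cstM mulVf // hat_cst1.
move=> v; rewrite key -hmult_hlin /hblk EU -/c; split=> -[w Ew].
  exists (w * hat_cst d^-1); rewrite -[v]mulr1 -TTi mulrA Ew -!mulrA; congr (w * _).
  by rewrite [hlin c * (hat_cst d * _)]mulrA mul_hat_cst -mulrA mulrA dd mul1r.
exists (w * hat_cst d); rewrite Ew -!mulrA TiT mulr1; congr (w * _).
exact: mul_hat_cst.
Qed.

Lemma Theta_word l : normalized l -> exists l', [/\ normalized l', map fst l' = map fst l &
  forall u, hmult (hword l) (Theta u) <-> hmult (hword l') u].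
Proof.
elim: l => [_|x l IH /= [x1 nl]].
  exists [::]; split=> // u; rewrite hword0; split=> _; first by exists u; rewrite mulr1.
  by exists (Theta u); rewrite mulr1.
have [m [nm Em Hm]] := IH nl.
have [g Eg] : hmult (hword l) (Theta (hword m)) by apply/Hm; exists 1; rewrite mul1r.
have [w Ew] := Theta_surj (hword l).
have [g' Eg'] : hmult (hword m) w by apply/Hm; exists 1; rewrite Ew mul1r.
have g0 : g 0%N 0%N != 0.
  have : Theta g' * g = 1.
    by apply: (hword_rregI nl); rewrite -mulrA -Eg -rmorphM -Eg' Ew mul1r.
  move=> /(congr1 (fun f : Ahat C => f 0%N 0%N)); rewrite mul00 one00 => E1.
  by apply: contra_eq_neq E1 => ->; rewrite mulr0 eq_sym oner_eq0.
have [U U1 HU] := Theta_letter x1 g0.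
exists ((x.1, U) :: m); split=> //=; first by rewrite Em.
move=> u; rewrite !hword_cons; split=> [[v Ev]|[v ->]].
  have [v' Ev'] : hmult (hword m) u by apply/Hm; rewrite Ev mulrA; eexists.
  have : hmult (hblk x) (Theta v' * g).
    exists v; apply: (hword_rregI nl).
    by rewrite -[LHS]mulrA -Eg -rmorphM -Ev' Ev mulrA.
  by move=> /HU [v'' E1]; exists v''; rewrite Ev' E1 mulrA.
have [z Ez] : hmult (hblk x) (Theta (v * hblk (x.1, U)) * g) by apply/HU; exists v.
exists z; have -> : v * (hblk (x.1, U) * hword m) = (v * hblk (x.1, U)) * hword m by rewrite mulrA.
by rewrite [LHS]rmorphM Eg [LHS]mulrA Ez [RHS]mulrA.
Qed.

(** The same vector e generates the new module: each element is Theta(w) e, and w may be replaced by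
    its remainder modulo the word l', which lies in the subalgebra. *)
Theorem pres_change (M : lmodType (Ahat C)) (e : restr M) l : normalized l -> pres e l ->
  exists l' (V : Ahat C), [/\ normalized l', map fst l' = map fst l,
    exists e' : restr (pullback Theta M), pres e' l' & Theta (hword l') = V * hword l].
Proof.
move=> nl pe; have [l' [nl' Em H']] := Theta_word nl.
have [V EV] : hmult (hword l) (Theta (hword l')) by apply/H'; exists 1; rewrite mul1r.
exists l', V; split=> //.
have scM (u : Atilde C) (x : restr M) : u *: x = val u *: (x : M) by [].
have scT (u : Atilde C) (x : restr (pullback Theta M)) : u *: x = Theta (val u) *: (x : M) by [].
have annM (u : Ahat C) : u *: (e : M) = 0 <-> hmult (hword l) u.
  have we0 : hword l *: (e : M) = 0.
    rewrite -val_word -[LHS](scM (word l)); apply/pe.2; exists 1; by rewrite mul1r.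
  split=> [ue|[v ->]]; last by rewrite -scalerA we0 scaler0.
  have [v [T [Ev _]]] := hword_div u nl; exists v.
  pose s := \sum_(i < size l) til_ser (T i) * word (drop i.+1 l) : Atilde C.
  have Es : val s = \sum_(i < size l) ser_b (T i) * hword (drop i.+1 l).
    rewrite /s (val_til_sum _ (fun i => til_ser (T i) * word (drop i.+1 l))).
    by apply: eq_bigr => i _; rewrite rmorphM /= val_word.
  have se : s *: e = 0.
    rewrite scM Es; move: ue; rewrite Ev scalerDl -scalerA we0 scaler0 add0r //.
  have T0 : forall i, (i < size l)%N -> T i = 0.
    apply: (word_free nl pe); rewrite -[RHS]se /s scaler_suml.
    by apply: eq_bigr => i _; rewrite scalerA.
  by rewrite {1}Ev big1 ?addr0 // => i _; rewrite T0 // ser_b0 mul0r.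
have annT (u : Ahat C) : Theta u *: (e : M) = 0 <-> hmult (hword l') u.
  by rewrite annM H'.
exists e; split.
  move=> x; have [u Eu] := pe.1 x; have [w Ew] := Theta_surj (val u).
  have [v [T [Ev _]]] := hword_div w nl'.
  pose s := \sum_(i < size l') til_ser (T i) * word (drop i.+1 l') : Atilde C.
  have Es : val s = \sum_(i < size l') ser_b (T i) * hword (drop i.+1 l').
    rewrite /s (val_til_sum _ (fun i => til_ser (T i) * word (drop i.+1 l'))).
    by apply: eq_bigr => i _; rewrite rmorphM /= val_word.
  exists s; rewrite scT Es; transitivity (Theta w *: (e : M)); first by rewrite Ew -scM.
  rewrite Ev rmorphD scalerDl (proj2 (annT _)) ?add0r //.
  by exists v.
by move=> u; rewrite scT annT hmult_word.
Qed.

End Automorphism.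

(** * The numbers gamma and pi *)

Section Invariants.
Variable C : numFieldType.
Local Notation A := (Atilde C).
Local Notation letter := (rat * fps C)%type.
Implicit Types (E : lmodType A) (l : seq letter) (s : seq rat).
Variable le : rel QZ.
Hypothesis le_tot : total_order le.

(** W expresses e' through e. It is invertible modulo the left ideal of l, whose elements have zero
    constant term when l is nonempty. *)
Lemma pres_compare E (e e' : E) l l' : normalized l -> normalized l' -> pres e l -> pres e' l' ->
  exists W V : Ahat C, hword l' * W = V * hword l /\ ((0 < size l)%N -> W 0%N 0%N != 0).
Proof.
move=> nl nl' pe pe'; have [w Ew] := pe.1 e'; have [z Ez] := pe'.1 e.
have [v Ev] : mult (word l) (word l' * w).
  by apply/pe.2; rewrite -scalerA -Ew; apply/pe'.2; exists 1; rewrite mul1r.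
exists (val w), (val v); split; first by rewrite -!val_word -!rmorphM Ev.
move=> l0; have [y Ey] : mult (word l) (z * w - 1).
  by apply/pe.2; rewrite scalerBl scale1r -scalerA -Ew -Ez subrr.
have l00 : hword l 0%N 0%N = 0.
  case: (l) l0 => // x l1 _; rewrite hword_cons mul00 /hblk mul00.
  by rewrite -[hlin _]mul1r mulA_hlin subr0 !mul0r.
have Ey' : val z * val w - 1 = val y * hword l by rewrite -val_word; exact: (congr1 val Ey).
have := congr1 (fun f : Ahat C => f 0%N 0%N) Ey'.
rewrite AhatDE AhatNE !mul00 one00 l00 mulr0 => /eqP.
by rewrite subr_eq0 => /eqP H; apply: contra_eq_neq H => ->; rewrite mulr0 eq_sym oner_eq0.
Qed.

Lemma roots_wordE l : roots_word l =
  map (fun x => ratr x - (size l)%:R + 1 : C) (keys (map fst l)).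
Proof.
apply: (@eq_from_nth _ 0); first by rewrite size_roots_word size_map size_keys size_map.
move=> i; rewrite size_roots_word => il.
rewrite nth_roots_word // (nth_map 0) ?size_keys ?size_map // nth_mkseq ?size_map //.
rewrite (nth_map (0, 0)) // rmorphD /= ratr_nat natrB // -natr1; ring.
Qed.

Lemma pres_size E (e e' : E) l l' : normalized l -> normalized l' -> pres e l -> pres e' l' ->
  (size l <= size l')%N.
Proof.
move=> nl nl' pe pe'; have [W [V [H W0]]] := pres_compare nl nl' pe pe'.
by have [->//|l0] := posnP (size l); apply: (compare_size nl nl' H (W0 l0)).
Qed.

Lemma pres_uniq E (e e' : E) l l' : normalized l -> normalized l' -> pres e l -> pres e' l' ->
  principal_order le (map fst l) -> principal_order le (map fst l') -> map fst l = map fst l'.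
Proof.
move=> nl nl' pe pe' so so'.
have sz : size l = size l' by apply/eqP; rewrite eqn_leq (pres_size nl nl' pe pe') (pres_size nl' nl pe' pe).
apply: (principal_order_uniq le_tot) => //.
have [l0|l0] := posnP (size l).
  by rewrite (size0nil l0) (size0nil (esym (etrans (esym l0) sz))).
have [W [V [H W0]]] := pres_compare nl nl' pe pe'.
have := compare_roots nl nl' sz H (W0 l0); rewrite !roots_wordE -sz => H1.
by apply: (perm_map_inj _ H1) => x y /addIr /addIr /(fmorph_inj (ratr : {rmorphism rat -> C})).
Qed.

(** The quantity is the difference of two keys plus 1. Were it 0, the classes would agree, and
    sorting would make the difference nonnegative. *)
Lemma principal_non_resonant l : principal_order le (map fst l) -> non_resonant (roots_word l).
Proof.
move=> so i j ij; rewrite size_roots_word => jl; have il := ltn_trans ij jl.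
have nthE n : (n < size l)%N -> nth 0 (roots_word l) n =
    ratr (nth 0 (map fst l) n + n%:R) - (size l)%:R + 1.
  by move=> nl; rewrite roots_wordE (nth_map 0) ?size_keys ?size_map // nth_mkseq ?size_map.
rewrite !nthE //; set x := nth 0 _ i; set y := nth 0 _ j.
have -> : ratr (y + j%:R) - (size l)%:R + 1 - (ratr (x + i%:R) - (size l)%:R + 1) + 1
    = ratr ((y + j%:R) - (x + i%:R) + 1) :> C.
  by rewrite [in RHS]rmorphD [in RHS]rmorphB /= rmorph1; ring.
rewrite fmorph_eq0; apply/eqP => E.
have cl : qz_class x = qz_class y.
  have -> : x = y + (j%:R - i%:R + 1) by apply/eqP; rewrite -subr_eq0 -oppr_eq0; apply/eqP; rewrite -[RHS]E; ring.
  by rewrite qz_class_int // rpredD ?rpred1 // rpredB // intr_nat.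
have := principal_order_le so ij; rewrite size_map -/x -/y => /(_ jl cl).
by move: E; lra.
Qed.

Definition gap s i : rat := nth 0 s i.+1 - nth 0 s i.
Definition first_coef l i : C := (nth (0, 0) l i).2 1%N.
(** Letters carry U_j = S_j^-1, so U_j'(0) = - S_j'(0); hence the order of the two terms. *)
Definition gamma_word l i : C := ratr (gap (map fst l) i) * first_coef l i.+1
  - ratr (gap (map fst l) i.+1) * first_coef l i.

(** K enters each first coefficient multiplied by the gap, so it cancels in the combination; the
    terms in t / chi leave (lambda_(i+2) + i + 1) - (lambda_i + i). *)
Lemma gamma_word_change (Theta : {rmorphism Ahat C -> Ahat C}) (chi t : C) l l' (W V : Ahat C) :
  (forall c, Theta (hat_cst c) = hat_cst c) ->
  two_terms (Theta (hat_a C)) 1 (fun rho => chi * rho) (fun rho => t * rho * (rho + 1)) ->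
  two_terms (Theta (hat_b C)) 1 (fun=> chi) (fun rho => 2 * t * rho) -> chi != 0 ->
  normalized l -> normalized l' -> map fst l' = map fst l -> principal_order le (map fst l) ->
  Theta (hword l') * W = V * hword l -> W 0%N 0%N != 0 ->
  forall i, (i.+2 < size l)%N -> let s := map fst l in
    gamma_word l i = chi * gamma_word l' i +
      t / chi * ratr (gap s i * gap s i.+1 * (gap s i + gap s i.+1 + 1)).
Proof.
move=> Tc Ta Tb chi0 nl nl' Em so E W0 i il s.
have [K HK] := compare_first_order Tc Ta Tb chi0 nl nl' Em (principal_non_resonant so) E W0.
have nthE n : (n < size l)%N -> (nth (0, 0) l n).1 = nth 0 s n.
  by move=> nl1; rewrite (nth_map (0, 0)).
have H0 := HK i (ltnW il); have H1 := HK i.+1 il.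
rewrite /= !nthE // in H0 H1; try exact: ltnW; try exact: (ltnW (ltnW il)).
rewrite /gamma_word Em -/s mulrBr ![chi * (_ * _)]mulrCA /first_coef H0 H1 /gap.
rewrite !(rmorphM, rmorphB, rmorphD) /= rmorph1 -natr1; ring.
Qed.

Lemma gamma_word_uniq E (e e' : E) l l' : normalized l -> normalized l' ->
  pres e l -> pres e' l' -> principal_order le (map fst l) -> principal_order le (map fst l') ->
  forall i, (i.+2 < size l)%N -> gamma_word l i = gamma_word l' i.
Proof.
move=> nl nl' pe pe' so so' i il.
have Em := esym (pres_uniq nl nl' pe pe' so so').
have [W [V [H W0]]] := pres_compare nl nl' pe pe'.
have l0 : (0 < size l)%N by apply: leq_ltn_trans il.
have := @gamma_word_change idfun 1 0 l l' W V (fun=> erefl) (@two_terms_hat_a C) (@two_terms_hat_b C)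
  (oner_neq0 C) nl nl' Em so H (W0 l0) i il.
by move=> /= ->; rewrite mul1r !mul0r addr0.
Qed.

Lemma ring_inv_unique (u v : A) : v * u = 1 -> u * v = 1 -> ring_inv u = v.
Proof.
move=> vu uv; rewrite /ring_inv; set S := (X in xget 0 X).
have [wu uw] : S (xget 0 S) by apply: (xgetPex 0); exists v.
by rewrite -[LHS]mulr1 -uv mulrA wu mul1r.
Qed.

Lemma inverse_series U : U 0%N = 1 -> exists S : fps C, [/\ S 0%N = 1, S 1%N = - U 1%N,
  ring_inv (til_ser S) = til_ser U & ring_inv (til_ser U) = til_ser S].
Proof.
move=> U1; have [|S [S0 US SU]] := @til_ser_unit C U; first by rewrite U1 oner_eq0.
have S1 : S 0%N = 1 by rewrite S0 U1 invr1.
exists S; split=> //; try exact: ring_inv_unique.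
move: US; rewrite til_serM -til_ser1 => /til_ser_inj /(congr1 (fun f => f 1%N)).
rewrite /cmul 2!big_ord_recr big_ord0 /= add0r U1 S1 mul1r mulr1 => /eqP.
by rewrite addr_eq0 => /eqP.
Qed.

Lemma flags_span E (e : E) l : pres e l ->
  flags e l (fun j => span e (word (drop j l))) /\
  forall y, (y \in span e (word (drop 0 l))) = (y == 0).
Proof.
move=> pe; split.
  move=> j jl u; split=> [/spanP [v Ev]|[v ->]]; last by apply/spanP; exists v.
  have [w Ew] : mult (word l) (u - v * word (drop j l)).
    by apply/pe.2; rewrite scalerBl Ev subrr.
  exists (v + w * word (take j l)); rewrite mulrDl -mulrA -word_cat cat_take_drop -Ew.
  by rewrite addrC subrK.
move=> y; rewrite drop0; apply/idP/eqP => [/spanP [u ->]|->]; last exact: rpred0.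
by apply/pe.2; exists u.
Qed.

Lemma word_fundamental E (e : E) l : normalized l -> pres e l ->
  principal_order le (map fst l) -> exists F, is_principal_JH le (map fst l) (F : nat -> submodClosed E).
Proof.
move=> nl pe so; have [ff f0] := flags_span pe.
by exists (fun j => span e (word (drop j l))); exact: (word_principal le_tot nl pe ff f0 so).
Qed.

(** The presentation picked by [xget] is itself a word with last series 1, and its numbers are the
    sorted ones, so [gamma_word_uniq] compares it with l. *)
Lemma gamma_rank3 E (e : E) l : normalized l -> pres e l -> size l = 3 ->
  principal_order le (map fst l) -> gamma le E = gamma_word l 0.
Proof.
move=> nl pe s3 so; rewrite /gamma; set Z := (X in xget 0 X).
have Zl : Z (gamma_word l 0).
  case: l s3 nl pe so @Z => [|[r1 U1] [|[r2 U2] [|[r3 U3] [|? ?]]]] // _ /= [/= u1 [u2 [u3 _]]] pe so.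
  have [S1 [S10 S11 IS1 _]] := inverse_series u1; have [S2 [S20 S21 IS2 _]] := inverse_series u2.
  have U30 : U3 0%N != 0 by rewrite u3 oner_eq0.
  have [V3 [V30 UV VU]] := til_ser_unit U30.
  exists [:: r1; r2; r3], S1, S2; split=> //.
  - exact: (@word_fundamental E e [:: (r1, U1); (r2, U2); (r3, U3)] (conj u1 (conj u2 (conj u3 I))) pe so).
  - rewrite /ent /= IS1 IS2; set P := _ * lin C r3.
    have Ew : word [:: (r1, U1); (r2, U2); (r3, U3)] = P * til_ser U3.
      by rewrite !word_cons word0 /blk /= mulr1 /P !mulrA.
    have [c [gc ac]] := pres_cyc P.
    (* Replacing e by U3 e removes the last series from the word. *)
    have [||f bf _] := @iso_ann A E _ (til_ser U3 *: e) c _ gc; last by exists f.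
      move=> x; have [u ->] := pe.1 x; exists (u * til_ser V3).
      by rewrite scalerA -mulrA VU mulr1.
    move=> u; rewrite scalerA pe.2 ac Ew; split=> -[v Ev].
      exists v; rewrite -[u]mulr1 -UV mulrA Ev -mulrA -mulrA UV mulr1 //.
    by exists v; rewrite Ev mulrA.
  - rewrite S11 S21 /gamma_word /gap /first_coef /p_ /ent /= !addrK; ring.
have [s [S1 [S2 [s3' [F HF] [S10 S20] Hiso ->]]]] := xgetPex (0 : C) (ex_intro Z _ Zl).
have [l1 [nl1 El1 pl1 _ so1]] := principal_JH_word le_tot pe.1 HF.
have Es := pres_uniq nl nl1 pe pl1 so; rewrite El1 in Es; have {}Es := Es so1.
have [U1 [U10 U11 _ IU1]] := inverse_series S10; have [U2 [U20 U21 _ IU2]] := inverse_series S20.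
case: s s3' Es so1 Hiso HF El1 => [|r1 [|r2 [|r3 [|? ?]]]] // _ Es so1 Hiso _ _.
pose l2 : seq letter := [:: (r1, U1); (r2, U2); (r3, ser1 C)].
have nl2 : normalized l2 by [].
have [c [gc ac]] := pres_cyc (word l2).
have [f bf] : iso (cyc (word l2)) E.
  apply: iso_sym; rewrite /l2 !word_cons word0 /blk /= til_ser1 !mulr1 !mulrA.
  by move: Hiso; rewrite /ent /= IU1 IU2.
have pe2 : pres (f c) l2 by apply: iso_pres bf _; split.
rewrite (gamma_word_uniq nl nl2 pe pe2 so) ?s3 //.
rewrite /gamma_word /gap /first_coef /l2 /p_ /ent /= !addrK U11 U21; ring.
Qed.

Lemma principal_order_block s d n : principal_order le s -> principal_order le (take n (drop d s)).
Proof.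
move=> /principal_orderP H; apply/principal_orderP => i j ij.
rewrite size_take_min leq_min size_drop => /andP [jn jd].
rewrite !nth_take ?(ltn_trans ij) // !nth_drop.
have dij : (d + i < d + j)%N by rewrite ltn_add2l.
have djs : (d + j < size s)%N by rewrite -ltn_subRL.
have := H _ _ dij djs; rewrite /ple !qz_class_nat; case: eqP => // _.
by rewrite !natrD; lra.
Qed.

(** F_(h+2) / F_(h-1) is presented by three consecutive letters, still sorted, so that [gamma_rank3]
    applies. *)
Lemma gamma_of_word E (e : E) l h : normalized l -> pres e l -> principal_order le (map fst l) ->
  (0 < h)%N -> (h + 2 <= size l)%N -> gamma_ le h E = gamma_word l h.-1.
Proof.
move=> nl pe so h0 hl; rewrite /gamma_; set Z := (X in xget 0 X).
have [z Zz] : exists z, Z z.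
  have [F HF] := word_fundamental nl pe so.
  by exists (gamma le (subquo (F (h + 2)%N) (F h.-1))), (map fst l), F.
have [s [F [HF ->]]] := xgetPex (0 : C) (ex_intro Z _ Zz).
have [l1 [nl1 El1 pl1 f1 so1]] := principal_JH_word le_tot pe.1 HF.
rewrite -El1 in so1.
have sz : size l1 = size l.
  by apply/eqP; rewrite eqn_leq (pres_size nl nl1 pe pl1) (pres_size nl1 nl pl1 pe).
have hl1 : (h + 2 <= size l1)%N by rewrite sz.
have dE : take (h + 2 - h.-1) (drop h.-1 l1) ++ drop (h + 2) l1 = drop h.-1 l1.
  by rewrite -drop_take_cat //; lia.
have h3 : (h + 2 - h.-1 = 3)%N by lia.
rewrite h3 in dE.
have [||u|u|f [_ pf]] := @pres_subquo C E e (F (h + 2)%N) (F h.-1) (take 3 (drop h.-1 l1)) (drop (h + 2) l1).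
- exact: normalized_drop.
- exact: pe.1.
- exact: f1.
- by rewrite dE; apply: f1; lia.
have nb : normalized (take 3 (drop h.-1 l1)) by apply: normalized_take; exact: normalized_drop.
have sob : principal_order le (map fst (take 3 (drop h.-1 l1))).
  by rewrite map_take map_drop; exact: principal_order_block.
have szb : size (take 3 (drop h.-1 l1)) = 3 by rewrite size_takel // size_drop; lia.
rewrite (gamma_rank3 nb pf szb sob) (gamma_word_uniq nl nl1 pe pl1 so so1); last by lia.
rewrite /gamma_word /gap /first_coef !map_take !map_drop !nth_take // !nth_drop.
by rewrite addn0 addn1 addn2.
Qed.

(** Equivalent to negativity of all roots of [bernstein_word]. *)
Definition positive_order s := forall i, (i < size s)%N -> (size s - i.+1)%:R < nth 0 s i.

(** For positivity, [bernstein_root] gives a root - (lambda_i + m - n0) with n0 - m >= k - i - 1 for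
    i counted from 0; its negativity bounds lambda_i from below. *)
Theorem frescosP s E : frescos le s E <-> exists (e : E) l,
  [/\ normalized l, pres e l, map fst l = s, principal_order le s & positive_order s].
Proof.
split=> [[[[_ [B [HB rB]]] [e ge]] [F HF]]|[e [l [nl pe <- so pos]]]].
  have [l [nl El pe _ so]] := principal_JH_word le_tot ge HF; exists e, l; split=> //.
  move=> i il; have sz : size l = size s by rewrite -El size_map.
  rewrite -sz in il *; have [m [n0 [mn rt]]] := bernstein_root nl pe il HB.
  have [q q0] := rB _ rt; rewrite -rmorphN => /(fmorph_inj (ratr : {rmorphism rat -> C})) Eq.
  have -> : nth 0 s i = (nth (0, 0) l i).1 by rewrite -El (nth_map (0, 0)).
  have : (m + (size l - i.+1))%:R <= n0%:R :> rat by rewrite ler_nat.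
  by rewrite natrD; move: Eq q0; lra.
split; last by have [F HF] := word_fundamental nl pe so; exists F.
split; last by exists e; exact: pe.1.
split; first exact: (pres_regular nl pe).
exists (bernstein_word l); split; first exact: (pres_bernstein nl pe).
move=> r /root_bernstein_word [i il ->]; exists (- mu_ l i); last by rewrite rmorphN.
by have := pos i; rewrite size_map (nth_map (0, 0)) // => /(_ il); rewrite /mu_; lra.
Qed.

End Invariants.

(** * Quasi-invariance and holomorphy of pi *)

Lemma near_all (C : numFieldType) m n (x : 'M[C]_(m, n)) (P : 'M[C]_(m, n) -> Prop) :
  (forall y, P y) -> \forall y \near x, P y.
Proof. by move=> H; exact: (@filterE _ _ (nbhs_filter x) P H). Qed.

Section QuasiInvariance.
Variable C : numFieldType.
Local Notation A := (Atilde C).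
Local Notation letter := (rat * fps C)%type.
Implicit Types (E : lmodType A) (l : seq letter).
Variable le : rel QZ.
Hypothesis le_tot : total_order le.
Variables (s : seq rat) (i j : nat).
Hypothesis i0 : (0 < i)%N.
Hypothesis ij : (i < j)%N.
Hypothesis js : (j + 2 <= size s)%N.

Let weight h : rat := gap s h.-1 * gap s h * (gap s h.-1 + gap s h + 1).

Lemma p_gap h : (0 < h)%N -> p_ s h - 1 = gap s h.-1.
Proof. by case: h => // h _; rewrite /p_ /gap /ent addrK. Qed.

Lemma pi_weight E : pi_ le s i j E =
  ratr (weight j) * gamma_ le i E - ratr (weight i) * gamma_ le j E.
Proof.
have H h : (0 < h)%N -> (p_ s h - 1) * (p_ s h.+1 - 1) * (p_ s h + p_ s h.+1 - 1) = weight h.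
  move=> h0; rewrite /weight -(p_gap (h := h.+1)) // -p_gap //; congr (_ * _); ring.
by rewrite /pi_ !H ?(leq_trans i0 (ltnW ij)).
Qed.

Definition pi_word l : C :=
  ratr (weight j) * gamma_word l i.-1 - ratr (weight i) * gamma_word l j.-1.

Lemma pi_of_word E (e : E) l : normalized l -> pres e l -> map fst l = s ->
  principal_order le s -> pi_ le s i j E = pi_word l.
Proof.
move=> nl pe El so; have sz : size l = size s by rewrite -El size_map.
rewrite pi_weight !(gamma_of_word le_tot nl pe) ?El ?sz //.
- by rewrite (leq_trans i0) // ltnW.
- by rewrite (leq_trans _ js) // leq_add2r ltnW.
Qed.

Lemma frescos_iso E E' : frescos le s E -> iso E E' ->
  frescos le s E' /\ pi_ le s i j E = pi_ le s i j E'.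
Proof.
move=> /(frescosP le_tot) [e [l [nl pe El so pos]]] [f bf].
have pe' := iso_pres bf pe; split.
  by apply/(frescosP le_tot); exists (f e), l.
by rewrite (pi_of_word nl pe El so) (pi_of_word nl pe' El so).
Qed.

Lemma pi_quasi_invariant : quasi_invariant (@frescos C le s) (pi_ le s i j) 1.
Proof.
have key theta Theta (M : lmodType (Ahat C)) : is_change_of_variable theta ->
    is_induced_automorphism theta Theta -> frescos le s (restr M) ->
    frescos le s (restr (pullback Theta M)) /\
    pi_ le s i j (restr M) = theta 1%N ^+ 1 * pi_ le s i j (restr (pullback Theta M)).
  move=> Hth HTh /(frescosP le_tot) [e [l [nl pe El so pos]]].
  have [l' [V [nl' El' [e' pe'] EV]]] := pres_change Hth HTh nl pe.
  rewrite El in El'; split.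
    by apply/(frescosP le_tot); exists e', l'.
  rewrite (pi_of_word nl pe El so) (pi_of_word nl' pe' El' so) expr1.
  have Em : map fst l' = map fst l by rewrite El El'.
  have so' : principal_order le (map fst l) by rewrite El.
  have EV' : Theta (hword l') * 1 = V * hword l by rewrite mulr1.
  have sz : size l = size s by rewrite -El size_map.
  have G := @gamma_word_change C le Theta (theta 1%N) (theta 2) l l' 1 V (Theta_cst HTh)
    (Theta_a Hth HTh) (Theta_b HTh) (chi_neq0 Hth) nl nl' Em so' EV' (oner_neq0 C).
  (* The terms in t are proportional to [weight i] and [weight j], the coefficients exchanged in pi,
     so they cancel. *)
  have Gh h : (0 < h)%N -> (h + 2 <= size s)%N -> gamma_word l h.-1 =
      theta 1%N * gamma_word l' h.-1 + theta 2 / theta 1%N * ratr (weight h).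
    case: h => // h _ hs; have := G h; rewrite /= El; apply; rewrite sz; lia.
  have j0 : (0 < j)%N := leq_ltn_trans (leq0n _) ij.
  have i2 : (i + 2 <= size s)%N by apply: leq_trans js; rewrite leq_add2r ltnW.
  by rewrite /pi_word !Gh //; ring.
split=> [theta Theta M Hth HTh HM|theta Theta M Hth HTh HM].
  by have [] := key _ _ _ Hth HTh HM.
by have [_] := key _ _ _ Hth HTh HM.
Qed.

Let m := (size s).-1.
Let n := degY s.

Definition coef1 (h : nat) (g : 'M[C]_(m, n)) : C :=
  if insub h is Some r then S_ g r 1%N else 0.

Definition pi_coef (g : 'M[C]_(m, n)) : C :=
  ratr (weight j) * (ratr (gap s i) * coef1 i.-1 g - ratr (gap s i.-1) * coef1 i g)
  - ratr (weight i) * (ratr (gap s j) * coef1 j.-1 g - ratr (gap s j.-1) * coef1 j g).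

(** The letter in position h, counted from 0, carries the inverse of the series in row h; the last
    letter has no such row and carries the series 1. *)
Lemma word_calG (g : 'M[C]_(m, n)) : calG s g -> exists (e : I_ g) l,
  [/\ normalized l, pres e l, map fst l = s &
      forall h, (h < m)%N -> first_coef l h = - coef1 h g].
Proof.
move=> Hg; have S0 (r : 'I_m) : S_ g r 0%N = 1.
  by have [g1 _] := Hg r; rewrite /S_ insubT //= -[RHS]g1; congr (g r _); exact/val_inj.
have [U HU] : exists U : nat -> fps C, forall h, [/\ U h 0%N = 1, (h < m)%N -> U h 1%N = - coef1 h g &
    forall r : 'I_m, r = h :> nat -> ring_inv (til_ser (S_ g r)) = til_ser (U h)] /\
    ((h >= m)%N -> U h = ser1 C).
  have H h : exists V : fps C, [/\ V 0%N = 1, (h < m)%N -> V 1%N = - coef1 h g &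
    forall r : 'I_m, r = h :> nat -> ring_inv (til_ser (S_ g r)) = til_ser V] /\
    ((h >= m)%N -> V = ser1 C).
    have [hm|mh] := ltnP h m; last first.
      exists (ser1 C); split=> //; split=> // r Er.
      by have := ltn_ord r; rewrite Er ltnNge mh.
    have [V [V0 V1 _ EV]] := inverse_series (S0 (Ordinal hm)).
    exists V; split=> //; split=> // [_|r Er]; first by rewrite V1 /coef1 insubT.
    by rewrite -EV; congr (ring_inv (til_ser (S_ g _))); exact/val_inj.
  by have [U HU] := choice H; exists U.
pose l : seq letter := mkseq (fun h => (nth 0 s h, U h)) (size s).
have s0 : (0 < size s)%N by apply: leq_trans js; rewrite addn2.
have szs : size s = m.+1 by rewrite /m prednK.
have nl : normalized l.
  suff H t (a : nat) : normalized [seq (nth 0 s h, U h) | h <- iota a t] by exact: H.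
  by elim: t a => //= t IH a; split=> //; have [[]] := HU a.
have El : map fst l = s by rewrite -map_comp; exact: mkseq_nth.
have El1 h : (h < m)%N -> first_coef l h = - coef1 h g.
  move=> hm; rewrite /first_coef nth_mkseq; last by rewrite szs ltnW.
  by have [[_ H _] _] := HU h; exact: H.
have Ew : word l = lin C (ent s 1%N) *
    \prod_(r < m) (ring_inv (til_ser (S_ g r)) * lin C (ent s r.+2)).
  rewrite /word /l /mkseq szs big_map -[iota 0 m.+1]/(index_iota 0 m.+1) big_mkord.
  have -> : \prod_(r < m) (ring_inv (til_ser (S_ g r)) * lin C (ent s r.+2)) =
      \prod_(r < m) (til_ser (U r) * lin C (nth 0 s r.+1)).
    by apply: eq_bigr => r _; have [[_ _ H] _] := HU r; rewrite (H r erefl).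
  have H t : \prod_(h < t.+1) blk (nth 0 s h, U h) =
      lin C (nth 0 s 0) * \prod_(r < t) (til_ser (U r) * lin C (nth 0 s r.+1)) * til_ser (U t).
    elim: t => [|t IH]; first by rewrite big_ord1 big_ord0 mulr1.
    by rewrite big_ord_recr IH [in RHS]big_ord_recr /blk /= !mulrA.
  rewrite H; have [_ HUm] := HU m.
  by rewrite HUm // til_ser1 mulr1.
have [e [ge ae]] := pres_cyc (lin C (ent s 1%N) *
    \prod_(r < m) (ring_inv (til_ser (S_ g r)) * lin C (ent s r.+2))).
exists e, l; split=> //; split=> // u.
by rewrite ae Ew.
Qed.

Lemma pi_I (g : 'M[C]_(m, n)) : calG s g -> frescos le s (I_ g) -> pi_ le s i j (I_ g) = pi_coef g.
Proof.
move=> Hg /(frescosP le_tot) [_ [_ [_ _ _ so _]]].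
have [e [l [nl pe El Hl]]] := word_calG Hg.
have jm : (j < m)%N by rewrite /m; move: js; case: (size s) => [|k] /=; lia.
have j0 : (0 < j)%N := leq_ltn_trans (leq0n _) ij.
have [im im1 jm1] : [/\ (i < m)%N, (i.-1 < m)%N & (j.-1 < m)%N] by split; lia.
rewrite (pi_of_word nl pe El so) /pi_word /gamma_word El !prednK // !Hl // /pi_coef.
by ring.
Qed.

Lemma differentiable_coef1 h (g : 'M[C]_(m, n)) : differentiable (coef1 h : 'M[C]_(m, n) -> C^o) g.
Proof.
rewrite /coef1; case: insubP => [r _ _|_]; last exact: differentiable_cst.
rewrite /S_; case: insubP => [c _ _|_]; last exact: differentiable_cst.
exact: differentiable_coord.
Qed.

Lemma differentiable_pi_coef (g : 'M[C]_(m, n)) : differentiable (pi_coef : 'M[C]_(m, n) -> C^o) g.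
Proof.
have dZ (c : C) (f : 'M[C]_(m, n) -> C^o) : differentiable f g ->
    differentiable (fun x => c * f x : C^o) g.
  by move=> df; exact: (@differentiableZ _ _ _ f c g df).
have dB (f1 f2 : 'M[C]_(m, n) -> C^o) : differentiable f1 g -> differentiable f2 g ->
    differentiable (fun x => f1 x - f2 x : C^o) g.
  by move=> d1 d2; exact: (@differentiableB _ _ _ f1 f2 g d1 d2).
by apply: (dB _ _); apply: (dZ _ _); apply: (dB _ _); apply: (dZ _ _); exact: differentiable_coef1.
Qed.

Lemma calG_analytic : locally_closed_analytic (calG (C := C) s).
Proof.
(* A triple indexes an equation: with [true] the normalization of a row, repeated for every column;
   with [false] the vanishing of an entry outside Y, or 0 = 0 for an entry inside. *)
move=> x _; pose I := ('I_m * 'I_n * bool)%type.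
pose f (k : I) (y : 'M[C]_(m, n)) : C^o :=
  if k.2 then y k.1.1 ord0 - 1 else if in_Y s k.1.1.+1 k.1.2 then 0 else y k.1.1 k.1.2.
exists #|{: I}|, (fun k => f (enum_val k)); split.
  move=> k; apply: near_all => y; rewrite /f; case: (enum_val k) => [[r h] [|]] /=.
    apply: (@differentiableB _ _ _ (fun y : 'M[C]_(m, n) => y r ord0 : C^o) (fun=> 1) y).
      exact: differentiable_coord.
    exact: differentiable_cst.
  by case: in_Y; [exact: differentiable_cst|exact: differentiable_coord].
apply: near_all => y; split=> [Hy k|Hy r].
  rewrite /f; case: (enum_val k) => [[r h] [|]] /=; have [y1 y0] := Hy r.
    by rewrite y1 subrr.
  by case: ifPn => // /y0.
split.
  have := Hy (enum_rank (r, ord0, true)); rewrite enum_rankK /f /= => /eqP.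
  by rewrite subr_eq0 => /eqP.
move=> h nY; have := Hy (enum_rank (r, h, false)).
by rewrite enum_rankK /f /= (negbTE nY).
Qed.

(** All of [calG] is taken as analytic set, where pi is a linear form in the coefficients of b of
    the S_j. *)
Lemma pi_holomorphic : holomorphic_parameter le s (@frescos C le s) (pi_ le s i j).
Proof.
split=> // [E E'|]; first exact: frescos_iso.
exists (calG s), pi_coef; split=> //.
- exact: calG_analytic.
- move=> x _; exists pi_coef; split; apply: near_all => y //.
  exact: differentiable_pi_coef.
- exact: pi_I.
Qed.

End QuasiInvariance.

Theorem theorem7p4p2 (R : realType) (le : rel QZ) (k : nat) (lambda : k.-tuple rat)
    (i j : nat) :
  total_order le -> (1 <= i)%N -> (i < j)%N -> (j <= k - 2)%N ->
  let F := @frescos R[i]%C le lambda in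
  let pi := @pi_ R[i]%C le lambda i j in
  holomorphic_parameter le lambda F pi /\ quasi_invariant F pi 1.
Proof.
move=> le_tot i1 ij jk F pi.
have js : (j + 2 <= size lambda)%N by rewrite size_tuple; lia.
by split; [exact: pi_holomorphic|exact: pi_quasi_invariant].
Qed.
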